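(* Let $f(n)$ ($n\ge1$) be a sequence, let $\kappa_0\in\mathbb{R}\setminus\{0\}$ and $\kappa\in\mathbb{C}$ with $\operatorname{Re}\kappa>\kappa_0>-1$, let $\delta>0$ and $q>1$ be real numbers with $\delta\le\pi/\log q$ and $\delta<\operatorname{Re}\kappa-\kappa_0$, and let $m$ be a positive integer. Let $\Phi_0,\dots,\Phi_{m-1}$ be $1$-periodic functions, Hölder continuous with exponent $\alpha$ where $\operatorname{Re}\kappa-\kappa_0<\alpha\le1$, such that $$F(N)=\sum_{1\le n<N}f(n)=\sum_{0\le k<m}N^\kappa(\log_qN)^k\Phi_k(\{\log_qN\})+O(N^{\kappa_0})$$ for integers $N\to\infty$. For $\mathcal{F}(s)=\sum_{n\ge1}n^{-s}f(n)$ assume: (i) there is a real $\sigma_a\ge\operatorname{Re}\kappa$ such that $\mathcal{F}(s)$ converges absolutely for $\operatorname{Re}s>\sigma_a$; (ii) $\mathcal{F}$ can be continued to a meromorphic function on $\operatorname{Re}s>\kappa_0-\delta$ whose poles can only occur at $\kappa+\chi_\ell$, $\ell\in\mathbb{Z}$, and have order at most $m$; (iii) there is a real $\eta>0$ such that $\mathcal{F}(s)=O(|\operatorname{Im}s|^\eta)$ as $|\operatorname{Im}s|\to\infty$ for $\kappa_0\le\operatorname{Re}s\le\sigma_a$ with $|s-\kappa-\chi_\ell|\ge\delta$ for all $\ell\in\mathbb{Z}$. Then for $u\in\mathbb{R}$ and $0\le k<m$, $\Phi_k(u)=\sum_{\ell\in\mathbb{Z}}\varphi_{k\ell}\exp(2\ell\pi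 iu)$ with $$\varphi_{k\ell}=\frac{(\log q)^k}{k!}\operatorname*{Res}_{s=\kappa+\chi_\ell}\frac{\mathcal{F}(s)(s-\kappa-\chi_\ell)^k}{s}.$$ If moreover $-1<\kappa_0<0$ and $\kappa\notin\frac{2\pi i}{\log q}\mathbb{Z}$, then $\mathcal{F}(0)=0$.
   Context: $\chi_\ell=\frac{2\pi i\ell}{\log q}$ for $\ell\in\mathbb{Z}$; $\{z\}$ is the fractional part; $\log_qN=\log N/\log q$. Implicit $O$-constants may depend on $f,q,m,\kappa,\kappa_0,\alpha,\delta,\sigma_a,\eta$. *)

(* Defs.v *)
From Stdlib Require Import Reals ZArith.
From Coquelicot Require Import Coquelicot.

Open Scope R_scope.

Definition cexp (z : C) : C :=
  (exp (Re z) * cos (Im z), exp (Re z) * sin (Im z)).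

Definition cpowR (x : R) (z : C) : C := cexp (Cmult z (RtoC (ln x))).

Fixpoint cpown (z : C) (n : nat) : C :=
  match n with O => RtoC 1 | S n' => Cmult z (cpown z n') end.

Fixpoint csum (u : nat -> C) (a len : nat) : C :=
  match len with O => RtoC 0 | S l => Cplus (csum u a l) (u (a + l)%nat) end.

Definition symsum (a : Z -> C) (L : nat) : C :=
  csum (fun j => a (Z.of_nat j - Z.of_nat L)%Z) 0 (2 * L + 1).

Definition chi (q : R) (l : Z) : C := (0, 2 * PI * IZR l / ln q).

Definition logq (q x : R) : R := ln x / ln q.

Definition C_differentiable_at (g : C -> C) (z : C) : Prop :=
  exists d : C, forall eps : R, 0 < eps -> exists rho : R, 0 < rho /\
    forall w : C, 0 < Cmod (Cminus w z) < rho ->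
      Cmod (Cminus (Cdiv (Cminus (g w) (g z)) (Cminus w z)) d) < eps.

Definition holomorphic_on (g : C -> C) (U : C -> Prop) : Prop :=
  forall z, U z -> C_differentiable_at g z.

(* r is the residue of g at p: g has a Laurent expansion around p with a
   finite principal part, (s-p)^(M+1) g(s) = sum_j c_j (s-p)^j on a punctured
   disc, and r = c_M is the coefficient of (s-p)^(-1). *)
Definition is_residue (g : C -> C) (p r : C) : Prop :=
  exists (M : nat) (c : nat -> C) (rho : R), 0 < rho /\
    (forall s : C, 0 < Cmod (Cminus s p) < rho ->
       is_series (fun j => Cmult (c j) (cpown (Cminus s p) j))
                 (Cmult (cpown (Cminus s p) (S M)) (g s))) /\
    r = c M.

Definition periodic1 (Phi : R -> C) : Prop := forall u, Phi (u + 1) = Phi u.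

Definition holder (alpha : R) (Phi : R -> C) : Prop :=
  exists L : R, forall x y : R, Cmod (Cminus (Phi x) (Phi y)) <= L * Rpower (Rabs (x - y)) alpha.

(* Main.v *)
Require Import Defs.
From Stdlib Require Import Reals ZArith Lra Lia ClassicalEpsilon.
From Coquelicot Require Import Coquelicot.
Open Scope R_scope.

(* With t = log x, partial summation turns the Dirichlet series into s times the Laplace transform
   of S(e^t), where S is the summatory function of f. The assumed expansion splits that transform
   into transforms of e^(kappa t) t^k Phi_k(t / log q) and a remainder holomorphic for Re s > kappa0;
   Hölder continuity is what extends the expansion from integers to all real x with the same error.
   Letting s approach kappa + chi_l from the right, a mean-zero periodic function contributes only a
   bounded term, while the Fourier coefficient phi_kl contributes k! phi_kl / (log q)^k (s - kappa - chi_l)^(-k-1).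
   These are therefore the principal parts of G(s)/s, and the Fourier series converges by Dini's criterion.
   For the last claim, a power of 1 - q^(kappa-s) times the transform of the main term is entire,
   so G(s)/s stays bounded at 0 by unique continuation along horizontal lines that avoid the poles. *)

(** * Complex calculus *)

(** A ray suffices at each pole. By the order bound, (s-p)^(m+1) times G(s)(s-p)^k/s has a Taylor
    series at p = kappa + chi_l whose coefficient of index m is the residue; the extra power covers
    p = 0, where 1/s raises the order. Knowing G(s)/s up to a bounded error at p + x for small x > 0
    fixes the coefficients up to index m+k. Hence the transforms are studied only at real distance x
    from a pole, where they reduce to real integrals of t^k Psi(t) exp(-xt) with Psi of period L =
    log q, and Taylor's formula is proved with a geometric remainder. Contours are boundaries of
    rectangles, so that contour integrals are combinations of integrals over real intervals. The
    power of 1 - q^(kappa-s) is the m-th because k+1 differences of step L annihilate t^k times an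
    L-periodic function, and each difference costs one such factor. The obstacle at 0 is that the
    real axis may itself carry a pole to the right of 0; therefore lines slightly above the axis are
    used, and the value at 0 is reached by continuity. *)

Notation RN := R_NormedModule (only parsing).
Notation RC := R_CompleteNormedModule (only parsing).

Lemma continuous_Rplus {U : UniformSpace} (f g : U -> R) x :
  continuous f x -> continuous g x -> continuous (fun y => f y + g y) x.
Proof. exact (continuous_plus (V := RN) f g x). Qed.

Lemma continuous_Rminus {U : UniformSpace} (f g : U -> R) x :
  continuous f x -> continuous g x -> continuous (fun y => f y - g y) x.
Proof. exact (continuous_minus (V := RN) f g x). Qed.

Lemma continuous_Ropp {U : UniformSpace} (f : U -> R) x : continuous f x -> continuous (fun y => - f y) x.
Proof. exact (continuous_opp (V := RN) f x). Qed.

Lemma continuous_Rmult {U : UniformSpace} (f g : U -> R) x :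
  continuous f x -> continuous g x -> continuous (fun y => f y * g y) x.
Proof. exact (continuous_mult (K := R_AbsRing) f g x). Qed.

Lemma ex_RInt_cont (f : R -> R) a b : (forall t, continuous f t) -> ex_RInt f a b.
Proof. intros H. apply (ex_RInt_continuous (V := RC)). intros t _. apply H. Qed.

Ltac continuous_by_derive := apply (ex_derive_continuous (K := R_AbsRing) (V := RN)); auto_derive.

(** Continuity is split into real components because the integrals below are taken componentwise;
    [cc_eps] recovers the form in terms of [Cmod]. *)
Definition cc {U : UniformSpace} (f : U -> C) (x : U) : Prop :=
  continuous (fun y => fst (f y)) x /\ continuous (fun y => snd (f y)) x.

Lemma Cmod_le_abs (z : C) : Cmod z <= Rabs (fst z) + Rabs (snd z).
Proof.
  destruct z as [a b]; unfold Cmod; simpl.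
  apply Rsqr_incr_0_var.
  - rewrite Rsqr_sqrt by nra. unfold Rsqr.
    replace (a * (a * 1) + b * (b * 1)) with (Rabs a * Rabs a + Rabs b * Rabs b).
    + pose proof (Rabs_pos a); pose proof (Rabs_pos b); nra.
    + rewrite <- !Rabs_mult, !Rabs_pos_eq by nra. ring.
  - pose proof (Rabs_pos a); pose proof (Rabs_pos b); lra.
Qed.

Lemma fst_le_Cmod (z : C) : Rabs (fst z) <= Cmod z.
Proof. eapply Rle_trans; [apply Rmax_l | apply Rmax_Cmod]. Qed.

Lemma snd_le_Cmod (z : C) : Rabs (snd z) <= Cmod z.
Proof. eapply Rle_trans; [apply Rmax_r | apply Rmax_Cmod]. Qed.

Lemma cont_R_eps {U : UniformSpace} (f : U -> R) (x : U) :
  continuous f x <-> forall eps, 0 < eps -> locally x (fun y => Rabs (f y - f x) < eps).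
Proof.
  split.
  - intros H eps He.
    apply (H (fun v => Rabs (v - f x) < eps)).
    exists (mkposreal eps He). intros y Hy. exact Hy.
  - intros H P [e He].
    unfold filtermap. generalize (H e (cond_pos e)). apply filter_imp.
    intros y Hy. apply He. exact Hy.
Qed.

Lemma cc_eps {U : UniformSpace} (f : U -> C) (x : U) :
  cc f x <-> forall eps, 0 < eps -> locally x (fun y => Cmod (f y - f x)%C < eps).
Proof.
  unfold cc. split.
  - intros [H1 H2] eps He.
    apply cont_R_eps with (eps := eps / 2) in H1; [|lra].
    apply cont_R_eps with (eps := eps / 2) in H2; [|lra].
    generalize (filter_and _ _ H1 H2). apply filter_imp. intros y [A B].
    eapply Rle_lt_trans; [apply Cmod_le_abs|].
    change (fst (f y - f x)%C) with (fst (f y) - fst (f x)).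
    change (snd (f y - f x)%C) with (snd (f y) - snd (f x)). lra.
  - intros H; split; apply cont_R_eps; intros eps He; generalize (H eps He);
      apply filter_imp; intros y Hy; eapply Rle_lt_trans; [|exact Hy| |exact Hy].
    + apply (fst_le_Cmod (f y - f x)%C).
    + apply (snd_le_Cmod (f y - f x)%C).
Qed.

Lemma locally_C_iff (z : C) (P : C -> Prop) :
  locally z P <-> exists rho, 0 < rho /\ forall w, Cmod (w - z)%C < rho -> P w.
Proof.
  split.
  - intros [e He]. exists e. split; [apply cond_pos|]. intros w Hw. apply He.
    split.
    + eapply Rle_lt_trans; [|exact Hw]. apply (fst_le_Cmod (w - z)%C).
    + eapply Rle_lt_trans; [|exact Hw]. apply (snd_le_Cmod (w - z)%C).
  - intros [rho [Hr H]]. assert (Hr2 : 0 < rho / 2) by lra.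
    exists (mkposreal _ Hr2). intros w [A B]. apply H.
    eapply Rle_lt_trans; [apply Cmod_le_abs|].
    change (Rabs (fst w - fst z) < rho / 2) in A.
    change (Rabs (snd w - snd z) < rho / 2) in B.
    change (Rabs (fst w - fst z) + Rabs (snd w - snd z) < rho). lra.
Qed.

Lemma cc_C_eps (f : C -> C) (z : C) :
  cc f z <-> forall eps, 0 < eps -> exists rho, 0 < rho /\
    forall w, Cmod (w - z)%C < rho -> Cmod (f w - f z)%C < eps.
Proof.
  rewrite cc_eps. split; intros H eps He; apply locally_C_iff; apply H; exact He.
Qed.

Lemma cc_const {U : UniformSpace} (c : C) (x : U) : cc (fun _ => c) x.
Proof. split; apply continuous_const. Qed.

Lemma cc_id (z : C) : cc (fun w => w) z.
Proof. destruct z. split; [apply continuous_fst | apply continuous_snd]. Qed.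

Lemma cc_plus {U : UniformSpace} (f g : U -> C) (x : U) :
  cc f x -> cc g x -> cc (fun y => (f y + g y)%C) x.
Proof.
  intros [A B] [A' B']; split; simpl.
  - apply continuous_Rplus; assumption.
  - apply continuous_Rplus; assumption.
Qed.

Lemma cc_opp {U : UniformSpace} (f : U -> C) (x : U) :
  cc f x -> cc (fun y => (- f y)%C) x.
Proof.
  intros [A B]; split; simpl.
  - apply continuous_Ropp; assumption.
  - apply continuous_Ropp; assumption.
Qed.

Lemma cc_minus {U : UniformSpace} (f g : U -> C) (x : U) :
  cc f x -> cc g x -> cc (fun y => (f y - g y)%C) x.
Proof. intros A B. apply cc_plus; [|apply cc_opp]; assumption. Qed.

Lemma cc_mult {U : UniformSpace} (f g : U -> C) (x : U) :
  cc f x -> cc g x -> cc (fun y => (f y * g y)%C) x.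
Proof.
  intros [A B] [A' B']; split; simpl.
  - apply continuous_Rminus; apply continuous_Rmult; assumption.
  - apply continuous_Rplus; apply continuous_Rmult; assumption.
Qed.

Lemma continuous_Rinv_gen {U : UniformSpace} (f : U -> R) (x : U) :
  continuous f x -> f x <> 0 -> continuous (fun y => / f y) x.
Proof. intros H H0. apply (continuous_comp f Rinv); [exact H | apply continuous_Rinv, H0]. Qed.

Lemma C_sqr_neq (z : C) : z <> RtoC 0 -> fst z ^ 2 + snd z ^ 2 <> 0.
Proof.
  intros Hz H. apply Hz. destruct z as [a b]. simpl in H.
  assert (a = 0) by nra. assert (b = 0) by nra. subst; reflexivity.
Qed.

Lemma continuous_pow_2 (x : R) : continuous (fun u => u ^ 2) x.
Proof. continuous_by_derive. exact I. Qed.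

Lemma cc_inv {U : UniformSpace} (f : U -> C) (x : U) :
  cc f x -> f x <> RtoC 0 -> cc (fun y => (/ f y)%C) x.
Proof.
  intros [A B] H. apply C_sqr_neq in H.
  assert (K : continuous (fun y => / (fst (f y) ^ 2 + snd (f y) ^ 2)) x).
  { apply continuous_Rinv_gen; [|exact H]. apply continuous_Rplus.
    - apply (continuous_comp _ (fun u => u ^ 2)); [exact A | apply continuous_pow_2].
    - apply (continuous_comp _ (fun u => u ^ 2)); [exact B | apply continuous_pow_2]. }
  split; simpl; apply continuous_Rmult; try exact K; try assumption.
  apply continuous_Ropp; assumption.
Qed.

Lemma cc_div {U : UniformSpace} (f g : U -> C) (x : U) :
  cc f x -> cc g x -> g x <> RtoC 0 -> cc (fun y => (f y / g y)%C) x.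
Proof. intros A B H. apply cc_mult; [exact A | apply cc_inv; assumption]. Qed.

Lemma cc_comp {U : UniformSpace} (g : U -> C) (f : C -> C) (x : U) :
  cc g x -> cc f (g x) -> cc (fun y => f (g y)) x.
Proof.
  intros H K. apply cc_eps. intros eps He.
  destruct (proj1 (cc_C_eps f (g x)) K eps He) as [rho [Hr Hf]].
  generalize (proj1 (cc_eps g x) H rho Hr). apply filter_imp. intros y Hy. apply Hf, Hy.
Qed.

Lemma cc_ext {U : UniformSpace} (f g : U -> C) (x : U) :
  (forall y, f y = g y) -> cc f x -> cc g x.
Proof.
  intros E [A B]; split; [revert A | revert B]; apply continuous_ext; intros y; rewrite E; reflexivity.
Qed.

Lemma cc_ext_loc {U : UniformSpace} (f g : U -> C) (x : U) :
  locally x (fun y => f y = g y) -> cc f x -> cc g x.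
Proof.
  intros E [A B]; split; [revert A | revert B]; apply continuous_ext_loc; revert E;
    apply filter_imp; intros y ->; reflexivity.
Qed.

Lemma cc_comp_R (f : R -> C) (g : R -> R) (t : R) : cc f (g t) -> continuous g t -> cc (fun t => f (g t)) t.
Proof. intros [A B] H. split; [apply (continuous_comp g (fun u => fst (f u))) | apply (continuous_comp g (fun u => snd (f u)))]; assumption. Qed.

Lemma cc_shift (f : R -> C) (a t : R) : (forall u, cc f u) -> cc (fun t => f (t + a)) t.
Proof.
  intros H. apply (cc_comp_R f (fun t => t + a)); [apply H|].
  apply continuous_Rplus; [apply continuous_id | apply continuous_const].
Qed.

Lemma cc_RtoC {U : UniformSpace} (f : U -> R) (x : U) :
  continuous f x -> cc (fun y => RtoC (f y)) x.
Proof. intros H; split; [exact H | apply continuous_const]. Qed.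

Lemma cc_pown {U : UniformSpace} (f : U -> C) n (x : U) :
  cc f x -> cc (fun y => cpown (f y) n) x.
Proof.
  intros H; induction n; simpl; [apply cc_const | apply cc_mult; assumption].
Qed.

Lemma cc_cexp {U : UniformSpace} (f : U -> C) (x : U) :
  cc f x -> cc (fun y => cexp (f y)) x.
Proof.
  intros [A B]; split; simpl; apply continuous_Rmult.
  - apply (continuous_comp _ exp); [exact A | apply continuous_exp].
  - apply (continuous_comp _ cos); [exact B | apply continuous_cos].
  - apply (continuous_comp _ exp); [exact A | apply continuous_exp].
  - apply (continuous_comp _ sin); [exact B | apply continuous_sin].
Qed.

(* Carathéodory's form of differentiability, which is stable under algebraic operations. *)
Definition cdiff (g : C -> C) (z : C) : Prop :=
  exists psi : C -> C, cc psi z /\ forall w, (g w - g z)%C = (psi w * (w - z))%C.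

Lemma cdiff_cc g z : cdiff g z -> cc g z.
Proof.
  intros [psi [H E]]. apply cc_ext with (f := fun w => (g z + psi w * (w - z))%C).
  - intros w. rewrite <- E. ring.
  - apply cc_plus; [apply cc_const|]. apply cc_mult; [exact H|].
    apply cc_minus; [apply cc_id | apply cc_const].
Qed.

Lemma cdiff_of_def g z : C_differentiable_at g z -> cdiff g z.
Proof.
  intros [d Hd].
  exists (fun w => if Ceq_dec w z then d else ((g w - g z) / (w - z))%C). split.
  - apply cc_C_eps. intros eps He. destruct (Hd eps He) as [rho [Hr H]].
    exists rho; split; [exact Hr|]. intros w Hw.
    destruct (Ceq_dec z z) as [_|N]; [|congruence].
    destruct (Ceq_dec w z) as [->|N].
    + replace (d - d)%C with (RtoC 0) by ring. rewrite Cmod_0. exact He.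
    + apply H. split; [|exact Hw]. apply Cmod_gt_0. intros E. apply N. apply Ceq_minus. exact E.
  - intros w. destruct (Ceq_dec w z) as [->|N].
    + ring.
    + field. intros E. apply N. apply Ceq_minus. exact E.
Qed.

Lemma cdiff_eps g z : (exists d, forall eps, 0 < eps -> exists rho, 0 < rho /\
    forall w, Cmod (w - z)%C < rho -> Cmod (g w - g z - d * (w - z))%C <= eps * Cmod (w - z)%C) -> cdiff g z.
Proof.
  intros [d Hd]. apply cdiff_of_def. exists d. intros eps He.
  destruct (Hd (eps / 2) ltac:(lra)) as [rho [Hr H]]. exists rho; split; [exact Hr|].
  intros w [H0 Hw]. specialize (H w Hw).
  assert (N : (w - z)%C <> RtoC 0) by (apply Cmod_gt_0; exact H0).
  replace ((g w - g z) / (w - z) - d)%C with ((g w - g z - d * (w - z)) / (w - z))%C by (field; exact N).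
  rewrite Cmod_div by exact N. apply Rle_lt_trans with (eps / 2); [|lra].
  apply Rmult_le_reg_r with (Cmod (w - z)); [exact H0|]. unfold Rdiv at 1.
  rewrite Rmult_assoc, Rinv_l by lra. lra.
Qed.

Lemma cdiff_const c z : cdiff (fun _ => c) z.
Proof. exists (fun _ => RtoC 0). split; [apply cc_const | intros; ring]. Qed.

Lemma cdiff_id z : cdiff (fun w => w) z.
Proof. exists (fun _ => RtoC 1). split; [apply cc_const | intros; ring]. Qed.

Lemma cdiff_plus f g z : cdiff f z -> cdiff g z -> cdiff (fun w => (f w + g w)%C) z.
Proof.
  intros [p [Hp Ep]] [r [Hr Er]]. exists (fun w => (p w + r w)%C). split; [apply cc_plus; assumption|].
  intros w. replace (f w + g w - (f z + g z))%C with ((f w - f z) + (g w - g z))%C by ring.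
  rewrite Ep, Er. ring.
Qed.

Lemma cdiff_opp f z : cdiff f z -> cdiff (fun w => (- f w)%C) z.
Proof.
  intros [p [Hp Ep]]. exists (fun w => (- p w)%C). split; [apply cc_opp; assumption|].
  intros w. replace (- f w - - f z)%C with (- (f w - f z))%C by ring. rewrite Ep. ring.
Qed.

Lemma cdiff_minus f g z : cdiff f z -> cdiff g z -> cdiff (fun w => (f w - g w)%C) z.
Proof. intros A B. apply cdiff_plus; [|apply cdiff_opp]; assumption. Qed.

Lemma cdiff_mult f g z : cdiff f z -> cdiff g z -> cdiff (fun w => (f w * g w)%C) z.
Proof.
  intros Hf Hg. pose proof (cdiff_cc _ _ Hg) as Cg.
  destruct Hf as [p [Hp Ep]]. destruct Hg as [r [Hr Er]].
  exists (fun w => (p w * g w + f z * r w)%C). split.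
  - apply cc_plus; apply cc_mult; try assumption. apply cc_const.
  - intros w. replace (f w * g w - f z * g z)%C with ((f w - f z) * g w + f z * (g w - g z))%C by ring.
    rewrite Ep, Er. ring.
Qed.

Lemma cdiff_ext_loc f g z : locally z (fun w => f w = g w) -> cdiff f z -> cdiff g z.
Proof.
  intros E [p [Hp Ep]].
  pose proof (locally_singleton _ _ E) as Ez.
  (* Carathéodory's identity has to hold at every [w], while [f] and [g] agree only near [z]. The
     difference quotient of [g] satisfies it everywhere and coincides with [p] near [z]. *)
  exists (fun w => if Ceq_dec w z then p z else ((g w - g z) / (w - z))%C). split.
  - apply cc_ext_loc with (f := p); [|exact Hp].
    revert E. apply filter_imp. intros w Ew. destruct (Ceq_dec w z) as [->|N]; [reflexivity|].
    rewrite <- Ew, <- Ez, Ep. field. intros K. apply N, Ceq_minus, K.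
  - intros w. destruct (Ceq_dec w z) as [->|N]; [ring|].
    field. intros K. apply N, Ceq_minus, K.
Qed.

Lemma cdiff_ext f g z : (forall w, f w = g w) -> cdiff f z -> cdiff g z.
Proof. intros E. apply cdiff_ext_loc. apply filter_forall. exact E. Qed.

Lemma cc_neq_0 {U : UniformSpace} (f : U -> C) (x : U) :
  cc f x -> f x <> RtoC 0 -> locally x (fun y => f y <> RtoC 0).
Proof.
  intros H N. assert (P : 0 < Cmod (f x)) by (apply Cmod_gt_0; exact N).
  generalize (proj1 (cc_eps f x) H _ P). apply filter_imp. intros y Hy E.
  rewrite E in Hy. replace (0 - f x)%C with (- f x)%C in Hy by ring. rewrite Cmod_opp in Hy. lra.
Qed.

Lemma cdiff_inv f z : cdiff f z -> f z <> RtoC 0 -> cdiff (fun w => (/ f w)%C) z.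
Proof.
  intros Hf N. pose proof (cdiff_cc _ _ Hf) as Cf. destruct Hf as [p [Hp Ep]].
  assert (L := cc_neq_0 f z Cf N).
  (* Off the set where f <> 0 the junk value of the inverse is irrelevant, so we patch f there. *)
  apply cdiff_ext_loc with (f := fun w => (/ (if Ceq_dec (f w) 0 then f z else f w))%C).
  { revert L. apply filter_imp. intros w Hw. destruct (Ceq_dec (f w) 0); [contradiction | reflexivity]. }
  exists (fun w => if Ceq_dec (f w) 0 then RtoC 0 else (- p w / (f w * f z))%C). split.
  - apply cc_ext_loc with (f := fun w => (- p w / (f w * f z))%C).
    + revert L. apply filter_imp. intros w Hw. destruct (Ceq_dec (f w) 0); [contradiction | reflexivity].
    + apply cc_div; [apply cc_opp, Hp | apply cc_mult; [exact Cf | apply cc_const] |].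
      apply Cmult_neq_0; exact N.
  - intros w. destruct (Ceq_dec (f z) 0); [contradiction|].
    destruct (Ceq_dec (f w) 0) as [E0|N0]; [ring|].
    assert (Ew : f w = (f z + p w * (w - z))%C) by (rewrite <- Ep; ring).
    transitivity ((f z - f w) / (f w * f z))%C; [field; auto|].
    replace (f z - f w)%C with (- (p w * (w - z)))%C by (rewrite <- Ep; ring). field; auto.
Qed.

Lemma cdiff_div f g z : cdiff f z -> cdiff g z -> g z <> RtoC 0 -> cdiff (fun w => (f w / g w)%C) z.
Proof. intros A B N. apply cdiff_mult; [|apply cdiff_inv]; assumption. Qed.

Lemma cdiff_pown f n z : cdiff f z -> cdiff (fun w => cpown (f w) n) z.
Proof. intros H; induction n; simpl; [apply cdiff_const | apply cdiff_mult; assumption]. Qed.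

Lemma cdiff_shift p z : cdiff (fun w => (w - p)%C) z.
Proof. apply cdiff_minus; [apply cdiff_id | apply cdiff_const]. Qed.

(** * Integrals of complex-valued functions of a real variable *)

Definition cint (f : R -> C) (a b : R) : Prop :=
  ex_RInt (fun t => fst (f t)) a b /\ ex_RInt (fun t => snd (f t)) a b.

Definition CI (f : R -> C) (a b : R) : C :=
  (RInt (fun t => fst (f t)) a b, RInt (fun t => snd (f t)) a b).

Lemma cint_cc f a b : (forall t, Rmin a b <= t <= Rmax a b -> cc f t) -> cint f a b.
Proof. intros H; split; apply (ex_RInt_continuous (V := RC)); intros t Ht; apply (H t Ht). Qed.

Lemma cint_ext f g a b : (forall t, Rmin a b < t < Rmax a b -> f t = g t) -> cint f a b -> cint g a b.
Proof.
  intros E [A B]; split; [revert A | revert B]; apply ex_RInt_ext; intros t Ht; rewrite (E t Ht); reflexivity.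
Qed.

Lemma cint_Chasles f a b c : cint f a b -> cint f b c -> cint f a c.
Proof. intros [A B] [A' B']; split; eapply ex_RInt_Chasles; eassumption. Qed.

Lemma cint_sub f a b c d : a <= b -> b <= c -> c <= d -> cint f a d -> cint f b c.
Proof.
  intros H1 H2 H3 [A B]; split.
  - apply (ex_RInt_Chasles_1 (V := RC) _ b c d); [lra|].
    apply (ex_RInt_Chasles_2 (V := RC) _ a b d); [lra | assumption].
  - apply (ex_RInt_Chasles_1 (V := RC) _ b c d); [lra|].
    apply (ex_RInt_Chasles_2 (V := RC) _ a b d); [lra | assumption].
Qed.

Lemma cint_point f a : cint f a a.
Proof. split; apply ex_RInt_point. Qed.

Lemma cint_plus f g a b : cint f a b -> cint g a b -> cint (fun t => (f t + g t)%C) a b.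
Proof. intros [A B] [A' B']; split; apply (ex_RInt_plus (V := RN)); assumption. Qed.

Lemma cint_mult_const (c : C) f a b : cint f a b -> cint (fun t => (c * f t)%C) a b.
Proof.
  intros [A B]; split.
  - apply (ex_RInt_minus (V := RN)); apply (ex_RInt_scal (V := RN)); assumption.
  - apply (ex_RInt_plus (V := RN)); apply (ex_RInt_scal (V := RN)); assumption.
Qed.

Lemma CI_ext f g a b : (forall t, Rmin a b < t < Rmax a b -> f t = g t) -> CI f a b = CI g a b.
Proof. intros E. unfold CI. f_equal; apply RInt_ext; intros t Ht; rewrite (E t Ht); reflexivity. Qed.

Lemma CI_Chasles f a b c : cint f a b -> cint f b c -> (CI f a b + CI f b c)%C = CI f a c.
Proof.
  intros [A B] [A' B']. unfold CI, Cplus; simpl. f_equal;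
    apply (RInt_Chasles (V := RC)); assumption.
Qed.

Lemma CI_plus f g a b : cint f a b -> cint g a b ->
  CI (fun t => (f t + g t)%C) a b = (CI f a b + CI g a b)%C.
Proof.
  intros [A B] [A' B']. unfold CI, Cplus; simpl. f_equal;
    apply (RInt_plus (V := RC)); assumption.
Qed.

Lemma CI_mult_const (c : C) f a b : cint f a b -> CI (fun t => (c * f t)%C) a b = (c * CI f a b)%C.
Proof.
  intros [A B]. unfold CI, Cmult; simpl. f_equal.
  - rewrite (RInt_minus (V := RC) (fun t => fst c * fst (f t)) (fun t => snd c * snd (f t)));
      try (apply (ex_RInt_scal (V := RN)); assumption).
    rewrite !(RInt_scal (V := RC)) by assumption. reflexivity.
  - rewrite (RInt_plus (V := RC) (fun t => fst c * snd (f t)) (fun t => snd c * fst (f t)));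
      try (apply (ex_RInt_scal (V := RN)); assumption).
    rewrite !(RInt_scal (V := RC)) by assumption. reflexivity.
Qed.

Lemma cint_opp f a b : cint f a b -> cint (fun t => (- f t)%C) a b.
Proof.
  intros H. apply (cint_ext (fun t => (-1 * f t)%C)).
  - intros; ring.
  - apply cint_mult_const, H.
Qed.

Lemma CI_opp f a b : cint f a b -> CI (fun t => (- f t)%C) a b = (- CI f a b)%C.
Proof.
  intros H. rewrite (CI_ext _ (fun t => (-1 * f t)%C)) by (intros; ring).
  rewrite CI_mult_const by exact H. ring.
Qed.

Lemma CI_minus f g a b : cint f a b -> cint g a b ->
  CI (fun t => (f t - g t)%C) a b = (CI f a b - CI g a b)%C.
Proof.
  intros A B. unfold Cminus. rewrite (CI_plus f (fun t => - g t)%C a b A (cint_opp g a b B)).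
  rewrite (CI_opp g a b B). reflexivity.
Qed.

Lemma CI_point f a : CI f a a = RtoC 0.
Proof. unfold CI. rewrite !RInt_point. reflexivity. Qed.

(* Testing against the conjugate of the integral reduces the bound to the real one. *)
Lemma CI_norm_le f g a b : a <= b -> cint f a b -> ex_RInt g a b ->
  (forall t, a < t < b -> Cmod (f t) <= g t) -> Cmod (CI f a b) <= RInt g a b.
Proof.
  intros Hab Hf Hg H. set (I := CI f a b).
  assert (P0 : 0 <= RInt g a b).
  { apply RInt_ge_0; [exact Hab | exact Hg |]. intros t Ht. eapply Rle_trans; [apply Cmod_ge_0 | apply H, Ht]. }
  destruct (Req_dec (Cmod I) 0) as [E|N]; [rewrite E; exact P0|].
  assert (P : 0 < Cmod I) by (pose proof (Cmod_ge_0 I); lra).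
  assert (E : Cmod I * Cmod I = RInt (fun t => fst (Cconj I * f t)%C) a b).
  { change (RInt (fun t => fst (Cconj I * f t)%C) a b) with (fst (CI (fun t => Cconj I * f t)%C a b)).
    rewrite CI_mult_const by exact Hf. fold I. rewrite Cmult_comm, <- Cmod2_conj. simpl. ring. }
  apply Rmult_le_reg_l with (Cmod I); [exact P|]. rewrite E.
  rewrite <- (RInt_scal (V := RC)) by exact Hg.
  apply RInt_le; [exact Hab | apply (cint_mult_const (Cconj I) f a b Hf) | apply (ex_RInt_scal (V := RN)), Hg |].
  intros t Ht. change (scal (Cmod I) (g t)) with (Cmod I * g t).
  eapply Rle_trans; [apply Rle_abs|]. eapply Rle_trans; [apply fst_le_Cmod|].
  rewrite Cmod_mult, Cmod_conj. apply Rmult_le_compat_l; [lra | apply H, Ht].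
Qed.

Lemma CI_norm_const f M a b : a <= b -> cint f a b ->
  (forall t, a < t < b -> Cmod (f t) <= M) -> Cmod (CI f a b) <= (b - a) * M.
Proof.
  intros Hab Hf H. eapply Rle_trans; [apply (CI_norm_le f (fun _ => M)); try assumption; apply ex_RInt_const|].
  rewrite RInt_const. apply Req_le. reflexivity.
Qed.

Lemma CI_const (c : C) a b : CI (fun _ => c) a b = (RtoC (b - a) * c)%C.
Proof. unfold CI. rewrite !RInt_const. unfold Cmult, scal; simpl. unfold mult; simpl. f_equal; ring. Qed.

Lemma CI_derive f df a b :
  (forall t, Rmin a b <= t <= Rmax a b ->
     is_derive (fun t => fst (f t)) t (fst (df t)) /\ is_derive (fun t => snd (f t)) t (snd (df t)) /\ cc df t) ->
  CI df a b = (f b - f a)%C.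
Proof.
  intros H. unfold CI, Cminus, Cplus; simpl. f_equal; apply is_RInt_unique.
  - apply (is_RInt_derive (V := RC) (fun t => fst (f t))); intros t Ht; apply (H t Ht).
  - apply (is_RInt_derive (V := RC) (fun t => snd (f t))); intros t Ht; apply (H t Ht).
Qed.

(** * Goursat's theorem *)

(** The contour integral of [g] over the positively oriented boundary of [a,b] x [c,d]: dz is dx on
    the horizontal sides and i dy on the vertical ones. *)
Definition bd (g : C -> C) (a b c d : R) : C :=
  (CI (fun x => g (x, c)) a b - CI (fun x => g (x, d)) a b
   + Ci * (CI (fun y => g (b, y)) c d - CI (fun y => g (a, y)) c d))%C.

Definition inrect (a b c d : R) (z : C) : Prop := a <= fst z <= b /\ c <= snd z <= d.

Definition onbd (a b c d : R) (z : C) : Prop :=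
  inrect a b c d z /\ (fst z = a \/ fst z = b \/ snd z = c \/ snd z = d).

Lemma cc_hline (g : C -> C) (x y : R) : cc g (x, y) -> cc (fun t => g (t, y)) x.
Proof.
  intros H. apply (cc_comp (fun t : R => (t, y) : C) g x); [|exact H].
  split; [apply continuous_id | apply continuous_const].
Qed.

Lemma cc_vline (g : C -> C) (x y : R) : cc g (x, y) -> cc (fun t => g (x, t)) y.
Proof.
  intros H. apply (cc_comp (fun t : R => (x, t) : C) g y); [|exact H].
  split; [apply continuous_const | apply continuous_id].
Qed.

Lemma cint_hline (g : C -> C) a b (y : R) : a <= b -> (forall x, a <= x <= b -> cc g (x, y)) -> cint (fun x => g (x, y)) a b.
Proof.
  intros Hab H. apply cint_cc. rewrite Rmin_left, Rmax_right by exact Hab.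
  intros t Ht. apply cc_hline, H, Ht.
Qed.

Lemma cint_vline (g : C -> C) (x : R) c d : c <= d -> (forall y, c <= y <= d -> cc g (x, y)) -> cint (fun y => g (x, y)) c d.
Proof.
  intros Hab H. apply cint_cc. rewrite Rmin_left, Rmax_right by exact Hab.
  intros t Ht. apply cc_vline, H, Ht.
Qed.

Definition bint (g : C -> C) (a b c d : R) : Prop :=
  (cint (fun x => g (x, c)) a b /\ cint (fun x => g (x, d)) a b) /\
  (cint (fun y => g (b, y)) c d /\ cint (fun y => g (a, y)) c d).

Lemma bint_cc g a b c d : a <= b -> c <= d ->
  (forall z, onbd a b c d z -> cc g z) -> bint g a b c d.
Proof.
  intros Hab Hcd H. split; split;
    [apply (cint_hline g a b c) | apply (cint_hline g a b d) | apply (cint_vline g b c d) | apply (cint_vline g a c d)];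
    try assumption; intros t Ht; apply H; unfold onbd, inrect; simpl; lra.
Qed.

Lemma bd_ext f g a b c d : a <= b -> c <= d ->
  (forall z, onbd a b c d z -> f z = g z) -> bd f a b c d = bd g a b c d.
Proof.
  intros Hab Hcd H. unfold bd.
  rewrite (CI_ext (fun x => f (x, c)) (fun x => g (x, c))), (CI_ext (fun x => f (x, d)) (fun x => g (x, d))),
    (CI_ext (fun y => f (a, y)) (fun y => g (a, y))), (CI_ext (fun y => f (b, y)) (fun y => g (b, y)));
    [reflexivity | | | | ]; intros t Ht;
    rewrite Rmin_left, Rmax_right in Ht by assumption; apply H; unfold onbd, inrect; simpl; lra.
Qed.

Lemma bd_plus f g a b c d : bint f a b c d -> bint g a b c d ->
  bd (fun z => f z + g z)%C a b c d = (bd f a b c d + bd g a b c d)%C.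
Proof.
  intros [[A1 A2] [A3 A4]] [[B1 B2] [B3 B4]]. unfold bd.
  rewrite (CI_plus (fun x => f (x, c)) (fun x => g (x, c))) by assumption.
  rewrite (CI_plus (fun x => f (x, d)) (fun x => g (x, d))) by assumption.
  rewrite (CI_plus (fun y => f (b, y)) (fun y => g (b, y))) by assumption.
  rewrite (CI_plus (fun y => f (a, y)) (fun y => g (a, y))) by assumption.
  ring.
Qed.

Lemma bd_mult_const k f a b c d : bint f a b c d ->
  bd (fun z => k * f z)%C a b c d = (k * bd f a b c d)%C.
Proof.
  intros [[A1 A2] [A3 A4]]. unfold bd.
  rewrite (CI_mult_const k (fun x => f (x, c))) by assumption.
  rewrite (CI_mult_const k (fun x => f (x, d))) by assumption.
  rewrite (CI_mult_const k (fun y => f (b, y))) by assumption.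
  rewrite (CI_mult_const k (fun y => f (a, y))) by assumption.
  ring.
Qed.

Lemma bd_norm g M a b c d : a <= b -> c <= d -> bint g a b c d ->
  (forall z, onbd a b c d z -> Cmod (g z) <= M) ->
  Cmod (bd g a b c d) <= 2 * ((b - a) + (d - c)) * M.
Proof.
  intros Hab Hcd [[A1 A2] [A3 A4]] H.
  assert (E1 := CI_norm_const _ M a b Hab A1). assert (E2 := CI_norm_const _ M a b Hab A2).
  assert (E3 := CI_norm_const _ M c d Hcd A3). assert (E4 := CI_norm_const _ M c d Hcd A4).
  assert (K1 := E1 ltac:(intros t Ht; apply H; unfold onbd, inrect; simpl; lra)).
  assert (K2 := E2 ltac:(intros t Ht; apply H; unfold onbd, inrect; simpl; lra)).
  assert (K3 := E3 ltac:(intros t Ht; apply H; unfold onbd, inrect; simpl; lra)).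
  assert (K4 := E4 ltac:(intros t Ht; apply H; unfold onbd, inrect; simpl; lra)).
  unfold bd. eapply Rle_trans; [apply Cmod_triangle|].
  rewrite Cmod_mult, Cmod_Ci.
  set (I1 := CI (fun x => g (x, c)) a b) in *. set (I2 := CI (fun x => g (x, d)) a b) in *.
  set (I3 := CI (fun y => g (b, y)) c d) in *. set (I4 := CI (fun y => g (a, y)) c d) in *.
  pose proof (Cmod_triangle I1 (- I2)). pose proof (Cmod_triangle I3 (- I4)).
  rewrite Cmod_opp in *. unfold Cminus. lra.
Qed.

Lemma bd_split_x g a e b c d :
  cint (fun x => g (x, c)) a e -> cint (fun x => g (x, c)) e b ->
  cint (fun x => g (x, d)) a e -> cint (fun x => g (x, d)) e b ->
  bd g a b c d = (bd g a e c d + bd g e b c d)%C.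
Proof.
  intros A1 A2 B1 B2. unfold bd.
  rewrite <- (CI_Chasles (fun x => g (x, c)) a e b), <- (CI_Chasles (fun x => g (x, d)) a e b) by assumption.
  ring.
Qed.

Lemma bd_split_y g a b c e d :
  cint (fun y => g (a, y)) c e -> cint (fun y => g (a, y)) e d ->
  cint (fun y => g (b, y)) c e -> cint (fun y => g (b, y)) e d ->
  bd g a b c d = (bd g a b c e + bd g a b e d)%C.
Proof.
  intros A1 A2 B1 B2. unfold bd.
  rewrite <- (CI_Chasles (fun y => g (a, y)) c e d), <- (CI_Chasles (fun y => g (b, y)) c e d) by assumption.
  ring.
Qed.

(** An affine function has a quadratic primitive, so each side contributes a difference of its
    values at two corners, and the four differences cancel. *)
Lemma bd_affine k l z0 a b c d : bd (fun z => k + l * (z - z0))%C a b c d = RtoC 0.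
Proof.
  assert (Hc : forall z, cc (fun z => k + l * (z - z0))%C z).
  { intros z. apply cc_plus; [apply cc_const|]. apply cc_mult; [apply cc_const|].
    apply cc_minus; [apply cc_id | apply cc_const]. }
  destruct k as [k1 k2], l as [l1 l2], z0 as [x0 y0].
  set (F := fun z : C => ((k1, k2) * z + (l1, l2) * ((z - (x0, y0)) * (z - (x0, y0))) * RtoC (/ 2))%C).
  unfold bd.
  assert (Hx : forall y, CI (fun x => (k1, k2) + (l1, l2) * ((x, y) - (x0, y0)))%C a b = (F (b, y) - F (a, y))%C).
  { intros y. apply (CI_derive (fun x => F (x, y))). intros t _. split; [|split].
    - unfold F; simpl. auto_derive; [exact I | field].
    - unfold F; simpl. auto_derive; [exact I | field].
    - apply (cc_hline _ t y (Hc (t, y))). }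
  (* Along a vertical side d/dy F(x+iy) = i F'(x+iy), so the primitive in [y] is -i F; the factor
     [Ci] in [bd] undoes the -i. *)
  assert (Hy : forall x, CI (fun y => (k1, k2) + (l1, l2) * ((x, y) - (x0, y0)))%C c d = (- Ci * F (x, d) - - Ci * F (x, c))%C).
  { intros x. apply (CI_derive (fun y => - Ci * F (x, y))%C). intros t _. split; [|split].
    - unfold F; simpl. auto_derive; [exact I | field].
    - unfold F; simpl. auto_derive; [exact I | field].
    - apply (cc_vline _ x t (Hc (x, t))). }
  rewrite !Hx, !Hy. unfold F, Ci. apply injective_projections; simpl; field.
Qed.

Lemma nested_intervals (u l : nat -> R) :
  (forall n, 0 <= l n) -> (forall n, u n <= u (S n)) -> (forall n, u (S n) + l (S n) <= u n + l n) ->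
  exists x, forall n, u n <= x <= u n + l n.
Proof.
  intros Hl Hu Hul.
  assert (M1 : forall n k, u n <= u (n + k)%nat).
  { intros n k; induction k; [rewrite Nat.add_0_r; lra | rewrite Nat.add_succ_r; pose proof (Hu (n + k)%nat); lra]. }
  assert (M2 : forall n k, u (n + k)%nat + l (n + k)%nat <= u n + l n).
  { intros n k; induction k; [rewrite Nat.add_0_r; lra | rewrite Nat.add_succ_r; pose proof (Hul (n + k)%nat); lra]. }
  assert (M : forall n k, u n <= u k + l k).
  { intros n k. pose proof (M1 n k). pose proof (M2 k n). rewrite Nat.add_comm in H0.
    pose proof (Hl (n + k)%nat). lra. }
  destruct (completeness (fun y => exists n, y = u n)) as [x [Hx1 Hx2]].
  - exists (u 0%nat + l 0%nat). intros y [n ->]. apply M.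
  - exists (u 0%nat), 0%nat. reflexivity.
  - exists x. intros n. split; [apply Hx1; exists n; reflexivity|].
    apply Hx2. intros y [k ->]. apply M.
Qed.

(* Lower left corners of nested quarters, each chosen, when possible, so that its boundary integral stays large. *)
Fixpoint corner (g : C -> C) (e w h : R) (q : R * R) (n : nat) : R * R :=
  match n with
  | O => q
  | S k =>
    let p := corner g e w h q k in
    let w' := w / 2 ^ S k in let h' := h / 2 ^ S k in
    let bad r := Rlt_dec (e * (w' + h') ^ 2) (Cmod (bd g (fst r) (fst r + w') (snd r) (snd r + h'))) in
    let p1 := p in let p2 := (fst p + w', snd p) in
    let p3 := (fst p, snd p + h') in let p4 := (fst p + w', snd p + h') in
    if bad p1 then p1 else if bad p2 then p2 else if bad p3 then p3 else p4
  end.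

Lemma bd_quarter g a c w h : 0 <= w -> 0 <= h ->
  (forall z, inrect a (a + (w + w)) c (c + (h + h)) z -> cc g z) ->
  bd g a (a + (w + w)) c (c + (h + h)) =
  (bd g a (a + w) c (c + h) + bd g (a + w) (a + w + w) c (c + h)
   + bd g a (a + w) (c + h) (c + h + h) + bd g (a + w) (a + w + w) (c + h) (c + h + h))%C.
Proof.
  intros Hw Hh H. replace (a + (w + w)) with (a + w + w) in * by ring.
  replace (c + (h + h)) with (c + h + h) in * by ring.
  rewrite (bd_split_x g a (a + w) (a + w + w) c (c + h + h)).
  2-5: apply (cint_hline g); [lra | intros x Hx; apply H; split; simpl; lra].
  rewrite (bd_split_y g a (a + w) c (c + h) (c + h + h)).
  2-5: apply (cint_vline g); [lra | intros x Hx; apply H; split; simpl; lra].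
  rewrite (bd_split_y g (a + w) (a + w + w) c (c + h) (c + h + h)).
  2-5: apply (cint_vline g); [lra | intros x Hx; apply H; split; simpl; lra].
  ring.
Qed.

Lemma Cmod_rect a b c d z z0 : inrect a b c d z -> inrect a b c d z0 -> Cmod (z - z0)%C <= (b - a) + (d - c).
Proof.
  intros [A B] [A0 B0]. eapply Rle_trans; [apply Cmod_le_abs|].
  change (fst (z - z0)%C) with (fst z - fst z0). change (snd (z - z0)%C) with (snd z - snd z0).
  apply Rplus_le_compat; apply Rabs_le; lra.
Qed.

(** The quantity (w+h)^2 drops to a quarter when both sides are halved, so a rectangle violating the
    bound e (w+h)^2 has a quarter violating its own bound. The nested quarters shrink to a point
    where [g] is affine up to an error that is small compared with the distance; the affine part
    integrates to 0 and the rest is too small for the violation. *)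
Lemma goursat g a b c d : a <= b -> c <= d ->
  (forall z, inrect a b c d z -> cdiff g z) -> bd g a b c d = RtoC 0.
Proof.
  intros Hab Hcd Hg.
  set (w := b - a). set (h := d - c).
  assert (Main : forall e, 0 < e -> Cmod (bd g a b c d) <= e * (w + h) ^ 2).
  { intros e He. apply Rnot_lt_le. intros Bad.
    set (q := corner g e w h (a, c)).
    set (wn := fun n => w / 2 ^ n). set (hn := fun n => h / 2 ^ n).
    assert (P2 : forall n, 0 < 2 ^ n) by (intros; apply pow_lt; lra).
    assert (Hwn : forall n, 0 <= wn n) by (intros n; apply Rdiv_le_0_compat; [unfold w; lra | apply P2]).
    assert (Hhn : forall n, 0 <= hn n) by (intros n; apply Rdiv_le_0_compat; [unfold h; lra | apply P2]).
    assert (Ww : forall n, wn n = wn (S n) + wn (S n)) by (intros n; unfold wn; simpl; field; apply Rgt_not_eq, P2).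
    assert (Hh : forall n, hn n = hn (S n) + hn (S n)) by (intros n; unfold hn; simpl; field; apply Rgt_not_eq, P2).
    assert (Step : forall n, (fst (q (S n)) = fst (q n) \/ fst (q (S n)) = fst (q n) + wn (S n)) /\
                             (snd (q (S n)) = snd (q n) \/ snd (q (S n)) = snd (q n) + hn (S n))).
    { intros n. unfold q; cbn [corner]; cbv zeta. fold q. fold (wn (S n)) (hn (S n)).
      repeat (match goal with |- context [if ?X then _ else _] => destruct X end); simpl; auto. }
    assert (In : forall n, a <= fst (q n) /\ fst (q n) + wn n <= b /\ c <= snd (q n) /\ snd (q n) + hn n <= d).
    { induction n as [|n IH].
      - unfold q, wn, hn, w, h; simpl. lra.
      - pose proof (Hwn (S n)). pose proof (Hhn (S n)). rewrite Ww, Hh in IH.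
        destruct (Step n) as [[-> | ->] [-> | ->]]; lra. }
    assert (B : forall n, e * (wn n + hn n) ^ 2 <
        Cmod (bd g (fst (q n)) (fst (q n) + wn n) (snd (q n)) (snd (q n) + hn n))).
    { induction n as [|n IH].
      - unfold q, wn, hn; simpl corner. simpl (2 ^ 0). simpl fst; simpl snd.
        replace (a + w / 1) with b by (unfold w; field). replace (c + h / 1) with d by (unfold h; field).
        replace (w / 1 + h / 1) with (w + h) by field. exact Bad.
      - rewrite Ww, Hh in IH. rewrite bd_quarter in IH; [ | apply Hwn | apply Hhn |].
        2:{ intros z [Z1 Z2]. rewrite <- Ww in Z1. rewrite <- Hh in Z2. apply cdiff_cc, Hg. pose proof (In n). split; lra. }
        unfold q; cbn [corner]; cbv zeta. fold q. fold (wn (S n)) (hn (S n)).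
        repeat (match goal with |- context [if ?X then _ else _] => destruct X end); simpl fst in *; simpl snd in *; try assumption.
        (* Only the branch of the fourth quarter is left. The other three satisfy the bound there,
           and if the fourth did too, the four bounds would add up to that of the parent. *)
        apply Rnot_le_lt. intros N. repeat match goal with K : ~ (_ < _) |- _ => apply Rnot_lt_le in K end.
        revert IH. apply Rle_not_lt.
        set (s := wn (S n) + hn (S n)) in *.
        replace (wn (S n) + wn (S n) + (hn (S n) + hn (S n))) with (2 * s) by (unfold s; ring).
        eapply Rle_trans; [apply Cmod_triangle|].
        eapply Rle_trans; [apply Rplus_le_compat_r, Cmod_triangle|].
        eapply Rle_trans; [apply Rplus_le_compat_r, Rplus_le_compat_r, Cmod_triangle|].
        replace (e * (2 * s) ^ 2) with (e * s ^ 2 + e * s ^ 2 + e * s ^ 2 + e * s ^ 2) by ring. lra. }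
    destruct (nested_intervals (fun n => fst (q n)) wn) as [x Hx]; [exact Hwn | | |].
    { intros n. pose proof (Hwn (S n)). destruct (Step n) as [[-> | ->] _]; lra. }
    { intros n. pose proof (Hwn (S n)). rewrite (Ww n). destruct (Step n) as [[-> | ->] _]; lra. }
    destruct (nested_intervals (fun n => snd (q n)) hn) as [y Hy]; [exact Hhn | | |].
    { intros n. pose proof (Hhn (S n)). destruct (Step n) as [_ [-> | ->]]; lra. }
    { intros n. pose proof (Hhn (S n)). rewrite (Hh n). destruct (Step n) as [_ [-> | ->]]; lra. }
    assert (Z0 : inrect a b c d (x, y)).
    { pose proof (Hx 0%nat). pose proof (Hy 0%nat). pose proof (In 0%nat). split; simpl; lra. }
    destruct (Hg _ Z0) as [psi [Hpsi Epsi]].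
    (* The perimeter 2 (W+HH) times the bound (e/4)(W+HH) for the remainder is (e/2)(W+HH)^2, within
       the bound that the quarters violate. *)
    assert (He4 : 0 < e / 4) by lra.
    destruct (proj1 (cc_C_eps psi (x, y)) Hpsi (e / 4) He4) as [rho [Hr Hrho]].
    destruct (pow_lt_1_zero (/ 2) ltac:(rewrite Rabs_pos_eq; lra) (rho / (w + h + 1))) as [n Hn].
    { apply Rdiv_lt_0_compat; [exact Hr | unfold w, h; lra]. }
    specialize (Hn n (le_n n)). rewrite Rabs_pos_eq in Hn by (apply pow_le; lra).
    assert (Small : wn n + hn n < rho).
    { unfold wn, hn. unfold Rdiv. rewrite <- pow_inv. apply Rlt_div_r in Hn; [|unfold w, h; lra].
      assert (0 < (/ 2) ^ n) by (apply pow_lt; lra). nra. }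
    specialize (B n). revert B. apply Rle_not_lt.
    pose proof (In n) as Inn. pose proof (Hwn n) as W0. pose proof (Hhn n) as H0'.
    set (A := fst (q n)) in *. set (Cn := snd (q n)) in *. set (W := wn n) in *. set (HH := hn n) in *.
    assert (Z0n : inrect A (A + W) Cn (Cn + HH) (x, y)).
    { pose proof (Hx n). pose proof (Hy n). split; simpl; assumption. }
    assert (InR : forall z, inrect A (A + W) Cn (Cn + HH) z -> inrect a b c d z).
    { intros z [Z1 Z2]. split; lra. }
    set (z0 := (x, y) : C) in *.
    assert (Cg : forall z, onbd A (A + W) Cn (Cn + HH) z -> cc g z).
    { intros z [Hz _]. apply cdiff_cc, Hg, InR, Hz. }
    assert (Caff : forall z, cc (fun z => g z0 + psi z0 * (z - z0))%C z).
    { intros z. apply cc_plus; [apply cc_const|]. apply cc_mult; [apply cc_const|]. apply cc_minus; [apply cc_id | apply cc_const]. }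
    set (rem := fun z => (g z + (-1) * (g z0 + psi z0 * (z - z0)))%C).
    assert (Hrem : bd g A (A + W) Cn (Cn + HH) = bd rem A (A + W) Cn (Cn + HH)).
    { unfold rem. rewrite bd_plus.
      - rewrite (bd_mult_const (-1)). + rewrite bd_affine. ring.
        + apply bint_cc; try lra. intros z _. apply Caff.
      - apply bint_cc; try lra. exact Cg.
      - apply bint_cc; try lra. intros z _. apply cc_mult; [apply cc_const | apply Caff]. }
    rewrite Hrem.
    eapply Rle_trans; [apply (bd_norm rem (e / 4 * (W + HH)))|].
    - lra.
    - lra.
    - apply bint_cc; try lra. intros z Hz. apply cc_plus; [apply Cg, Hz | apply cc_mult; [apply cc_const | apply Caff]].
    - intros z [Hz _].
      replace (rem z) with ((psi z - psi z0) * (z - z0))%C.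
      2:{ unfold rem. replace (g z) with (g z0 + psi z * (z - z0))%C; [ring|]. rewrite <- Epsi. ring. }
      assert (Dz : Cmod (z - z0)%C <= W + HH).
      { eapply Rle_trans; [apply (Cmod_rect _ _ _ _ _ _ Hz Z0n)|]. lra. }
      rewrite Cmod_mult. apply Rmult_le_compat; try apply Cmod_ge_0; [|exact Dz].
      left. apply Hrho. lra.
    - replace (A + W - A + (Cn + HH - Cn)) with (W + HH) by ring.
      pose proof (pow2_ge_0 (W + HH)). simpl in *. nra. }
  apply Cmod_eq_0. apply Rle_antisym; [|apply Cmod_ge_0].
  apply Rnot_lt_le. intros P.
  assert (K : 0 < (w + h) ^ 2 + 1) by (pose proof (pow2_ge_0 (w + h)); lra).
  set (e := Cmod (bd g a b c d) / (2 * ((w + h) ^ 2 + 1))).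
  assert (He : 0 < e) by (apply Rdiv_lt_0_compat; lra).
  specialize (Main e He).
  assert (Ee : Cmod (bd g a b c d) = e * (2 * ((w + h) ^ 2 + 1))) by (unfold e; field; lra).
  rewrite Ee in Main. pose proof (pow2_ge_0 (w + h)). nra.
Qed.

(** * Cauchy's formula, Taylor expansion and unique continuation *)

(* The hypothesis excludes w only, so g may have an arbitrary isolated singularity there. *)
Lemma bd_cut g a b c d (w : C) r : 0 < r ->
  a <= fst w - r -> fst w + r <= b -> c <= snd w - r -> snd w + r <= d ->
  (forall z, inrect a b c d z -> z <> w -> cdiff g z) ->
  bd g a b c d = bd g (fst w - r) (fst w + r) (snd w - r) (snd w + r).
Proof.
  intros Hr H1 H2 H3 H4 Hg. destruct w as [x y]; simpl in *.
  assert (Hc : forall u v, a <= u <= b -> c <= v <= d -> u <> x \/ v <> y -> cdiff g (u, v)).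
  { intros u v Hu Hv N. apply Hg; [split; assumption|]. intros E. injection E. intros. lra. }
  assert (CH : forall e f v, a <= e -> e <= f -> f <= b -> c <= v <= d -> v <> y ->
                cint (fun t => g (t, v)) e f).
  { intros e f v A B D V N. apply (cint_hline g); [exact B|]. intros t Ht. apply cdiff_cc, Hc; lra. }
  assert (CV : forall e f u, c <= e -> e <= f -> f <= d -> a <= u <= b -> u <> x ->
                cint (fun t => g (u, t)) e f).
  { intros e f u A B D V N. apply (cint_vline g); [exact B|]. intros t Ht. apply cdiff_cc, Hc; lra. }
  rewrite (bd_split_x g a (x - r) b) by (apply CH; lra).
  rewrite (bd_split_x g (x - r) (x + r) b) by (apply CH; lra).
  rewrite (bd_split_y g (x - r) (x + r) c (y - r) d) by (apply CV; lra).
  rewrite (bd_split_y g (x - r) (x + r) (y - r) (y + r) d) by (apply CV; lra).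
  rewrite (goursat g a (x - r)), (goursat g (x + r) b), (goursat g (x - r) (x + r) c),
    (goursat g (x - r) (x + r) (y + r) d); try lra; try ring;
    intros [u v] [Hu Hv]; simpl in *; apply Hc; lra.
Qed.

Definition c2pi : C := (0, 2 * PI).

Lemma c2pi_neq : c2pi <> RtoC 0.
Proof. intros E. injection E. pose proof PI_RGT_0. lra. Qed.

Lemma sq_plus_sq_neq u r : 0 < r -> u ^ 2 + r ^ 2 <> 0.
Proof. intros Hr. pose proof (pow2_ge_0 u). pose proof (pow_lt r 2 Hr). lra. Qed.

(** Two opposite sides of a square around a pole jointly contribute this kernel, with primitive 2
    arctan((t-x)/r), which runs from -pi/2 to pi/2. *)
Lemma RInt_kernel r x : 0 < r ->
  is_RInt (fun t => 2 * r / ((t - x) ^ 2 + r ^ 2)) (x - r) (x + r) PI.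
Proof.
  intros Hr.
  replace PI with (minus ((fun t => 2 * atan ((t - x) / r)) (x + r)) ((fun t => 2 * atan ((t - x) / r)) (x - r))).
  - apply (is_RInt_derive (V := RC) (fun t => 2 * atan ((t - x) / r))); intros t _.
    + auto_derive; [exact I|]. field. split; [apply sq_plus_sq_neq, Hr | lra].
    + continuous_by_derive. apply sq_plus_sq_neq, Hr.
  - unfold minus, plus, opp; simpl.
    replace ((x + r - x) / r) with 1 by (field; lra). replace ((x - r - x) / r) with (- (1)) by (field; lra).
    rewrite atan_opp, atan_1. field.
Qed.

(** Subtracting opposite sides leaves a purely imaginary integrand on the horizontal pair and a real
    one on the vertical pair; with the factor i each pair yields i pi. *)
Lemma bd_pole w r : 0 < r ->
  bd (fun z => / (z - w))%C (fst w - r) (fst w + r) (snd w - r) (snd w + r) = c2pi.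
Proof.
  intros Hr. destruct w as [x y]; simpl fst; simpl snd.
  assert (Cz : forall z, z <> (x, y) -> cc (fun z => / (z - (x, y)))%C z).
  { intros z N. apply cc_inv; [apply cc_minus; [apply cc_id | apply cc_const]|].
    intros E. apply N, Ceq_minus, E. }
  assert (CH : forall v, v <> y -> cint (fun t => / ((t, v) - (x, y)))%C (x - r) (x + r)).
  { intros v N. apply (cint_hline (fun z => / (z - (x, y)))%C); [lra|]. intros t _. apply Cz. intros E. injection E; intros; lra. }
  assert (CV : forall u, u <> x -> cint (fun t => / ((u, t) - (x, y)))%C (y - r) (y + r)).
  { intros u N. apply (cint_vline (fun z => / (z - (x, y)))%C); [lra|]. intros t _. apply Cz. intros E. injection E; intros; lra. }
  unfold bd.
  rewrite <- (CI_minus (fun t => / ((t, (y - r)%R) - (x, y)))%C (fun t => / ((t, (y + r)%R) - (x, y)))%C) by (apply CH; lra).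
  rewrite <- (CI_minus (fun t => / (((x + r)%R, t) - (x, y)))%C (fun t => / (((x - r)%R, t) - (x, y)))%C) by (apply CV; lra).
  rewrite (CI_ext _ (fun t => (0, 2 * r / ((t - x) ^ 2 + r ^ 2)))).
  2:{ intros t _. unfold Cminus, Cinv, Cplus, Copp; simpl. f_equal; field; repeat split; apply Rgt_not_eq;
      pose proof (Rle_0_sqr (t - x)); pose proof (Rle_0_sqr (t - y)); pose proof (Rmult_lt_0_compat r r Hr Hr); unfold Rsqr in *; lra. }
  rewrite (CI_ext (fun t => (/ (((x + r)%R, t) - (x, y)) - / (((x - r)%R, t) - (x, y)))%C)
             (fun t => (2 * r / ((t - y) ^ 2 + r ^ 2), 0))).
  2:{ intros t _. unfold Cminus, Cinv, Cplus, Copp; simpl. f_equal; field; repeat split; apply Rgt_not_eq;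
      pose proof (Rle_0_sqr (t - x)); pose proof (Rle_0_sqr (t - y)); pose proof (Rmult_lt_0_compat r r Hr Hr); unfold Rsqr in *; lra. }
  unfold CI; cbn [fst snd]. rewrite !RInt_const.
  rewrite (is_RInt_unique _ _ _ _ (RInt_kernel r x Hr)), (is_RInt_unique _ _ _ _ (RInt_kernel r y Hr)).
  unfold c2pi, Ci, scal; simpl. unfold mult; simpl. apply injective_projections; simpl; ring.
Qed.

Lemma Cminus_neq (z w : C) : z <> w -> (z - w)%C <> RtoC 0.
Proof. intros N E. apply N, Ceq_minus, E. Qed.

(** With Carathéodory's slope [psi], the integrand is psi(z) + f(w)/(z-w). [bd_cut] moves the
    contour to a small square of half-side [r] around [w]; the pole gives f(w) times [c2pi], and the
    bounded [psi] contributes O(r). *)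
Lemma bd_cauchy f a b c d w : a < fst w < b -> c < snd w < d ->
  (forall z, inrect a b c d z -> cdiff f z) ->
  bd (fun z => f z / (z - w))%C a b c d = (f w * c2pi)%C.
Proof.
  intros Hx Hy Hf.
  assert (Hw : inrect a b c d w) by (split; lra).
  destruct (Hf w Hw) as [psi [Cpsi Epsi]].
  destruct (proj1 (cc_C_eps psi w) Cpsi 1 Rlt_0_1) as [rho [Hr Hrho]].
  set (M := Cmod (psi w) + 1). assert (HM : 0 < M) by (pose proof (Cmod_ge_0 (psi w)); unfold M; lra).
  set (D := (bd (fun z => f z / (z - w)) a b c d - f w * c2pi)%C).
  enough (HD : D = RtoC 0).
  { unfold D in HD. apply Ceq_minus. exact HD. }
  apply Cmod_eq_0, Rle_antisym; [|apply Cmod_ge_0]. apply Rnot_lt_le. intros P.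
  (* The square has perimeter 8r and [psi] is at most [M] on it, so r <= |D|/(16M) leads to |D| <=
     |D|/2. Its points lie within 2r of [w], hence rho/3; the other terms keep it inside the
     rectangle. *)
  set (r := Rmin (Rmin (rho / 3) (Cmod D / (16 * M)))
              (Rmin (Rmin (fst w - a) (b - fst w)) (Rmin (snd w - c) (d - snd w)))).
  assert (Hr1 : 0 < r).
  { repeat apply Rmin_glb_lt; try lra. apply Rdiv_lt_0_compat; lra. }
  assert (B : r <= rho / 3 /\ r <= Cmod D / (16 * M) /\ r <= fst w - a /\ r <= b - fst w /\ r <= snd w - c /\ r <= d - snd w).
  { unfold r. repeat split.
    - eapply Rle_trans; [apply Rmin_l | apply Rmin_l].
    - eapply Rle_trans; [apply Rmin_l | apply Rmin_r].
    - eapply Rle_trans; [apply Rmin_r |]. eapply Rle_trans; [apply Rmin_l | apply Rmin_l].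
    - eapply Rle_trans; [apply Rmin_r |]. eapply Rle_trans; [apply Rmin_l | apply Rmin_r].
    - eapply Rle_trans; [apply Rmin_r |]. eapply Rle_trans; [apply Rmin_r | apply Rmin_l].
    - eapply Rle_trans; [apply Rmin_r |]. eapply Rle_trans; [apply Rmin_r | apply Rmin_r]. }
  destruct B as [B1 [B2 [B3 [B4 [B5 B6]]]]].
  assert (ND : forall z, onbd (fst w - r) (fst w + r) (snd w - r) (snd w + r) z -> z <> w).
  { intros z [_ Hz] E. subst z. lra. }
  assert (Cq : forall z, z <> w -> cc (fun z => / (z - w))%C z).
  { intros z N. apply cc_inv; [apply cc_minus; [apply cc_id | apply cc_const] | apply Cminus_neq, N]. }
  assert (Inr : forall z, inrect (fst w - r) (fst w + r) (snd w - r) (snd w + r) z -> inrect a b c d z).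
  { intros z [Z1 Z2]. split; lra. }
  assert (Ipsi : bint psi (fst w - r) (fst w + r) (snd w - r) (snd w + r)).
  { apply bint_cc; try lra. intros z Hz.
    apply cc_ext_loc with (f := fun z => ((f z - f w) / (z - w))%C).
    + generalize (cc_neq_0 (fun z => z - w)%C z (cc_minus _ _ _ (cc_id z) (cc_const w z)) (Cminus_neq _ _ (ND z Hz))).
      apply filter_imp. intros v Hv. rewrite Epsi. field. exact Hv.
    + apply cc_div.
      * apply cc_minus; [apply cdiff_cc, Hf, Inr, Hz | apply cc_const].
      * apply cc_minus; [apply cc_id | apply cc_const].
      * apply Cminus_neq, ND, Hz. }
  assert (E : D = bd psi (fst w - r) (fst w + r) (snd w - r) (snd w + r)).
  { unfold D. rewrite (bd_cut _ a b c d w r); [ | exact Hr1 | lra | lra | lra | lra | ].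
    2:{ intros z Hz N; apply cdiff_div; [apply Hf, Hz | apply cdiff_shift | apply Cminus_neq, N]. }
    rewrite <- (bd_pole w r Hr1).
    rewrite (bd_ext _ (fun z => psi z + f w * / (z - w))%C); [|lra|lra|].
    2:{ intros z Hz. replace (f z) with (f w + psi z * (z - w))%C by (rewrite <- Epsi; ring).
        field. apply Cminus_neq, ND, Hz. }
    rewrite (bd_plus psi), (bd_mult_const (f w)).
    - ring.
    - apply bint_cc; try lra. intros z Hz. apply Cq, ND, Hz.
    - exact Ipsi.
    - apply bint_cc; try lra. intros z Hz. apply cc_mult; [apply cc_const | apply Cq, ND, Hz]. }
  assert (Bd : Cmod D <= 2 * ((fst w + r - (fst w - r)) + (snd w + r - (snd w - r))) * M).
  { rewrite E. apply bd_norm; try lra.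
    - exact Ipsi.
    - intros z [[Z1 Z2] _].
      replace (psi z) with (psi w + (psi z - psi w))%C by ring.
      eapply Rle_trans; [apply Cmod_triangle|]. apply Rplus_le_compat_l. left. apply Hrho.
      eapply Rle_lt_trans; [apply Cmod_le_abs|].
      change (fst (z - w)%C) with (fst z - fst w). change (snd (z - w)%C) with (snd z - snd w).
      assert (Rabs (fst z - fst w) <= r) by (apply Rabs_le; lra).
      assert (Rabs (snd z - snd w) <= r) by (apply Rabs_le; lra). lra. }
  apply Rle_div_r in B2; [|lra]. nra.
Qed.

(** * Taylor series and unique continuation *)

Lemma is_series_C (a : nat -> C) (l : C) :
  is_series a l <-> forall eps, 0 < eps -> exists N, forall n, (N <= n)%nat -> Cmod (csum a 0 n - l)%C < eps.
Proof.
  assert (E : forall n, sum_n a n = csum a 0 (S n)).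
  { induction n as [|n IH].
    - rewrite sum_O. simpl. ring.
    - rewrite sum_Sn, IH. reflexivity. }
  split.
  - intros H eps He. destruct (H (fun v => Cmod (v - l)%C < eps)) as [N HN].
    { assert (X : exists rho, 0 < rho /\ forall v, Cmod (v - l)%C < rho -> Cmod (v - l)%C < eps) by (exists eps; auto).
      exact (proj2 (locally_C_iff l (fun v => Cmod (v - l)%C < eps)) X). }
    exists (S N). intros n Hn. destruct n as [|n]; [lia|]. rewrite <- E. apply HN. lia.
  - intros H P HP. apply (proj1 (locally_C_iff l P)) in HP. destruct HP as [rho [Hr HP]].
    destruct (H rho Hr) as [N HN]. exists N. intros n Hn. apply HP. rewrite E. apply HN. lia.
Qed.

Lemma cpown_neq z n : z <> RtoC 0 -> cpown z n <> RtoC 0.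
Proof. intros N; induction n; simpl; [apply C1_nz | apply Cmult_neq_0; assumption]. Qed.

Lemma Cmod_cpown z n : Cmod (cpown z n) = Cmod z ^ n.
Proof. induction n; simpl; [apply Cmod_1 | rewrite Cmod_mult, IHn; reflexivity]. Qed.

Lemma cc_bounded (f : R -> C) a b : (forall t, a <= t <= b -> cc f t) ->
  exists M, forall t, a <= t <= b -> Cmod (f t) <= M.
Proof.
  intros H.
  destruct (bounded_continuity (V := RN) (fun t => fst (f t)) a b) as [M1 H1].
  { intros t Ht. apply (H t Ht). }
  destruct (bounded_continuity (V := RN) (fun t => snd (f t)) a b) as [M2 H2].
  { intros t Ht. apply (H t Ht). }
  exists (M1 + M2). intros t Ht. eapply Rle_trans; [apply Cmod_le_abs|].
  specialize (H1 t Ht). specialize (H2 t Ht).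
  change (Rabs (fst (f t)) < M1) in H1. change (Rabs (snd (f t)) < M2) in H2. lra.
Qed.

Lemma onbd_bounded g a b c d : a <= b -> c <= d -> (forall z, onbd a b c d z -> cc g z) ->
  exists M, 0 < M /\ forall z, onbd a b c d z -> Cmod (g z) <= M.
Proof.
  intros Hab Hcd H.
  destruct (cc_bounded (fun t => g (t, c)) a b) as [M1 H1].
  { intros t Ht. apply cc_hline, H. unfold onbd, inrect; simpl; lra. }
  destruct (cc_bounded (fun t => g (t, d)) a b) as [M2 H2].
  { intros t Ht. apply cc_hline, H. unfold onbd, inrect; simpl; lra. }
  destruct (cc_bounded (fun t => g (a, t)) c d) as [M3 H3].
  { intros t Ht. apply cc_vline, H. unfold onbd, inrect; simpl; lra. }
  destruct (cc_bounded (fun t => g (b, t)) c d) as [M4 H4].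
  { intros t Ht. apply cc_vline, H. unfold onbd, inrect; simpl; lra. }
  exists (Rabs M1 + Rabs M2 + Rabs M3 + Rabs M4 + 1).
  pose proof (Rabs_pos M1); pose proof (Rabs_pos M2); pose proof (Rabs_pos M3); pose proof (Rabs_pos M4).
  pose proof (Rle_abs M1); pose proof (Rle_abs M2); pose proof (Rle_abs M3); pose proof (Rle_abs M4).
  split; [lra|]. intros [x y] [[Hx Hy] E]; simpl in *.
  destruct E as [E | [E | [E | E]]]; subst.
  - specialize (H3 y Hy). lra.
  - specialize (H4 y Hy). lra.
  - specialize (H1 x Hx). lra.
  - specialize (H2 x Hx). lra.
Qed.

Definition sqbd (g : C -> C) (p : C) (r : R) : C := bd g (fst p - r) (fst p + r) (snd p - r) (snd p + r).
Definition insq (p : C) (r : R) (z : C) : Prop := inrect (fst p - r) (fst p + r) (snd p - r) (snd p + r) z.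

(** Cauchy's integral for the [j]-th Taylor coefficient at [p], over the square of half-side [r]. *)
Definition tcoef (f : C -> C) (p : C) (r : R) (j : nat) : C :=
  (sqbd (fun z => f z / cpown (z - p) (S j)) p r / c2pi)%C.

Lemma onsq_dist p r z : 0 < r -> onbd (fst p - r) (fst p + r) (snd p - r) (snd p + r) z -> r <= Cmod (z - p)%C.
Proof.
  intros Hr [_ H]. destruct H as [H | [H | [H | H]]].
  1,2: eapply Rle_trans; [|apply (fst_le_Cmod (z - p)%C)];
    change (fst (z - p)%C) with (fst z - fst p); rewrite H.
  3,4: eapply Rle_trans; [|apply (snd_le_Cmod (z - p)%C)];
    change (snd (z - p)%C) with (snd z - snd p); rewrite H.
  1,3: rewrite Rabs_left; lra.
  all: rewrite Rabs_pos_eq; lra.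
Qed.

(** The remainder after n terms is (w-p)^n/(2 pi i) times the contour integral of f(z)/((z-p)^n
    (z-w)), by iterating 1/((z-p)^n (z-w)) = 1/(z-p)^(n+1) + (w-p)/((z-p)^(n+1) (z-w)). On the
    square |z-p| >= r, whence the geometric rate. [M] does not depend on [w] or [n], which the
    comparison of coefficients at a pole requires. *)
Lemma taylor_remainder f p r : 0 < r -> (forall z, insq p r z -> cdiff f z) ->
  exists M, 0 < M /\ forall w, Cmod (w - p)%C < r -> forall n,
    Cmod (csum (fun j => tcoef f p r j * cpown (w - p) j) 0 n - f w)%C
      <= M / (r - Cmod (w - p)%C) * (Cmod (w - p)%C / r) ^ n.
Proof.
  intros Hr Hf.
  set (x := fst p) in *. set (y := snd p) in *.
  assert (Np : forall z, onbd (x - r) (x + r) (y - r) (y + r) z -> (z - p)%C <> RtoC 0).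
  { intros z Hz. apply Cmod_gt_0. pose proof (onsq_dist p r z Hr Hz). lra. }
  assert (Cf : forall z, onbd (x - r) (x + r) (y - r) (y + r) z -> cc f z).
  { intros z [Hz _]. apply cdiff_cc, Hf, Hz. }
  destruct (onbd_bounded f (x - r) (x + r) (y - r) (y + r)) as [M [HM0 HM]]; try lra; [exact Cf|].
  assert (Hp : 0 < Cmod c2pi) by (apply Cmod_gt_0, c2pi_neq).
  (* 8r is the perimeter of the square. *)
  exists (8 * r * M / Cmod c2pi). split.
  { apply Rdiv_lt_0_compat; [|exact Hp]. nra. }
  intros w Hw.
  assert (Dw : forall z, onbd (x - r) (x + r) (y - r) (y + r) z -> r - Cmod (w - p)%C <= Cmod (z - w)%C).
  { intros z Hz. pose proof (onsq_dist p r z Hr Hz).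
    replace (z - p)%C with ((z - w) + (w - p))%C in H by ring.
    pose proof (Cmod_triangle (z - w) (w - p)). lra. }
  assert (Nw : forall z, onbd (x - r) (x + r) (y - r) (y + r) z -> (z - w)%C <> RtoC 0).
  { intros z Hz. apply Cmod_gt_0. pose proof (Dw z Hz). lra. }
  assert (C1 : forall n z, onbd (x - r) (x + r) (y - r) (y + r) z -> cc (fun z => f z / cpown (z - p) n)%C z).
  { intros n z Hz. apply cc_div; [apply Cf, Hz | |].
    - apply cc_pown, cc_minus; [apply cc_id | apply cc_const].
    - apply cpown_neq, Np, Hz. }
  assert (C2 : forall n z, onbd (x - r) (x + r) (y - r) (y + r) z -> cc (fun z => f z / cpown (z - p) n / (z - w))%C z).
  { intros n z Hz. apply cc_div; [apply C1, Hz | |].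
    - apply cc_minus; [apply cc_id | apply cc_const].
    - apply Nw, Hz. }
  assert (Hid : forall n, (f w - csum (fun j => tcoef f p r j * cpown (w - p) j) 0 n)%C =
            (cpown (w - p) n * sqbd (fun z => f z / cpown (z - p) n / (z - w)) p r / c2pi)%C).
  { induction n as [|n IH].
    - simpl csum. simpl cpown. unfold sqbd. fold x y.
      rewrite (bd_ext _ (fun z => f z / (z - w))%C); [|lra|lra|].
      + rewrite bd_cauchy.
        * field. apply c2pi_neq.
        * pose proof (fst_le_Cmod (w - p)%C). change (fst (w - p)%C) with (fst w - x) in H.
          assert (H' : Rabs (fst w - x) < r) by lra; apply Rabs_def2 in H'; lra.
        * pose proof (snd_le_Cmod (w - p)%C). change (snd (w - p)%C) with (snd w - y) in H.
          assert (H' : Rabs (snd w - y) < r) by lra; apply Rabs_def2 in H'; lra.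
        * exact Hf.
      + intros z Hz. simpl cpown. field. apply Nw, Hz.
    - simpl csum.
      replace (f w - (csum (fun j => tcoef f p r j * cpown (w - p) j) 0 n + tcoef f p r n * cpown (w - p) n))%C
        with ((f w - csum (fun j => tcoef f p r j * cpown (w - p) j) 0 n) - tcoef f p r n * cpown (w - p) n)%C by ring.
      rewrite IH. unfold tcoef, sqbd. fold x y.
      rewrite (bd_ext (fun z => f z / cpown (z - p) n / (z - w))%C
        (fun z => f z / cpown (z - p) (S n) + (w - p) * (f z / cpown (z - p) (S n) / (z - w)))%C); [|lra|lra|].
      + rewrite (bd_plus (fun z => f z / cpown (z - p) (S n))%C), (bd_mult_const (w - p)%C).
        * simpl cpown. field. apply c2pi_neq.
        * apply bint_cc; try lra. apply C2.
        * apply bint_cc; try lra. apply C1.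
        * apply bint_cc; try lra. intros z Hz. apply cc_mult; [apply cc_const | apply C2, Hz].
      + intros z Hz. simpl cpown. field. repeat split; try apply Nw, Hz; try apply Np, Hz; apply cpown_neq, Np, Hz. }
  set (rho := Cmod (w - p)%C) in *.
  assert (Rho : 0 <= rho) by apply Cmod_ge_0.
  intros n. rewrite <- Cmod_opp.
  replace (- (csum (fun j => tcoef f p r j * cpown (w - p) j) 0 n - f w))%C
    with (f w - csum (fun j => tcoef f p r j * cpown (w - p) j) 0 n)%C by ring.
  rewrite Hid, Cmod_div, Cmod_mult, Cmod_cpown by apply c2pi_neq. fold rho.
  assert (Hb : Cmod (sqbd (fun z => f z / cpown (z - p) n / (z - w))%C p r) <= 8 * r * (M / r ^ n / (r - rho))).
  { unfold sqbd. fold x y. eapply Rle_trans; [apply (bd_norm _ (M / r ^ n / (r - rho)))|]; try lra.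
    - apply bint_cc; try lra. apply C2.
    - intros z Hz. rewrite !Cmod_div, Cmod_cpown; [|apply cpown_neq, Np, Hz | apply Nw, Hz].
      assert (0 < r ^ n) by (apply pow_lt, Hr).
      assert (r ^ n <= Cmod (z - p)%C ^ n) by (apply pow_incr; split; [lra | apply onsq_dist; assumption]).
      specialize (Dw z Hz). unfold Rdiv.
      apply Rmult_le_compat.
      + apply Rmult_le_pos; [apply Cmod_ge_0|]. left. apply Rinv_0_lt_compat. lra.
      + left. apply Rinv_0_lt_compat. lra.
      + apply Rmult_le_compat; [apply Cmod_ge_0 | left; apply Rinv_0_lt_compat; lra | apply HM, Hz | apply Rinv_le_contravar; lra].
      + apply Rinv_le_contravar; lra. }
  replace ((rho / r) ^ n) with (rho ^ n * / r ^ n) by (unfold Rdiv; rewrite Rpow_mult_distr, pow_inv; reflexivity).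
  apply Rle_trans with (rho ^ n * (8 * r * (M / r ^ n / (r - rho))) * / Cmod c2pi).
  - apply Rmult_le_compat_r; [left; apply Rinv_0_lt_compat, Hp|].
    apply Rmult_le_compat_l; [apply pow_le, Rho | exact Hb].
  - apply Req_le. field. repeat split; try lra. apply pow_nonzero; lra.
Qed.

Lemma taylor f p r : 0 < r -> (forall z, insq p r z -> cdiff f z) ->
  forall w, Cmod (w - p)%C < r ->
    is_series (fun j => tcoef f p r j * cpown (w - p) j)%C (f w).
Proof.
  intros Hr Hf w Hw. destruct (taylor_remainder f p r Hr Hf) as [M [HM Hbound]]. specialize (Hbound w Hw).
  set (rho := Cmod (w - p)%C) in *. set (K := M / (r - rho)) in *.
  assert (Rho : 0 <= rho) by apply Cmod_ge_0.
  assert (HK : 0 < K + 1) by (assert (0 < K) by (apply Rdiv_lt_0_compat; lra); lra).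
  apply is_series_C. intros eps He.
  destruct (pow_lt_1_zero (rho / r)) with (y := eps / (K + 1)) as [N HN].
  { rewrite Rabs_pos_eq by (apply Rdiv_le_0_compat; lra). apply Rlt_div_l; lra. }
  { apply Rdiv_lt_0_compat; lra. }
  exists N. intros n Hn. eapply Rle_lt_trans; [apply Hbound|].
  specialize (HN n Hn). rewrite Rabs_pos_eq in HN by (apply pow_le, Rdiv_le_0_compat; lra).
  apply Rlt_div_r in HN; [|lra].
  assert (0 <= (rho / r) ^ n) by (apply pow_le, Rdiv_le_0_compat; lra). lra.
Qed.

Lemma csum_ext u v a n : (forall j, (a <= j < a + n)%nat -> u j = v j) -> csum u a n = csum v a n.
Proof.
  intros H; induction n as [|n IH]; simpl; [reflexivity|].
  rewrite IH, H by (try lia; intros; apply H; lia). reflexivity.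
Qed.

Lemma csum_0 a n : csum (fun _ => RtoC 0) a n = RtoC 0.
Proof. induction n as [|n IH]; simpl; [reflexivity | rewrite IH; ring]. Qed.

(** Since [f] vanishes near [p], division by any power of z-p leaves it holomorphic on the whole
    square, so all Taylor coefficients at [p] are 0 by Goursat's theorem. *)
Lemma vanish_disc f p r rho : 0 < r -> 0 < rho -> (forall z, insq p r z -> cdiff f z) ->
  (forall z, Cmod (z - p)%C < rho -> f z = RtoC 0) ->
  forall w, Cmod (w - p)%C < r -> f w = RtoC 0.
Proof.
  intros Hr Hrho Hf H0 w Hw.
  assert (T : forall j, tcoef f p r j = RtoC 0).
  { intros j. unfold tcoef, sqbd. rewrite goursat; try lra.
    - field. apply c2pi_neq.
    - intros z Hz. destruct (Ceq_dec z p) as [->|N].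
      (* Near [p] the numerator is 0, so the quotient is 0 whatever value the inverse takes at [p]
         itself. *)
      + apply cdiff_ext_loc with (f := fun _ => RtoC 0); [|apply cdiff_const].
        apply locally_C_iff. exists rho; split; [exact Hrho|]. intros v Hv. rewrite H0 by exact Hv.
        unfold Cdiv. ring.
      + apply cdiff_div; [apply Hf, Hz | apply cdiff_pown, cdiff_shift | apply cpown_neq, Cminus_neq, N]. }
  pose proof (taylor f p r Hr Hf w Hw) as S. apply Cmod_eq_0, Rle_antisym; [|apply Cmod_ge_0].
  apply Rnot_lt_le. intros P. destruct (proj1 (is_series_C _ _) S _ P) as [N HN].
  specialize (HN N (le_n N)). rewrite (csum_ext _ (fun _ => RtoC 0)) in HN by (intros; rewrite T; ring).
  rewrite csum_0 in HN. replace (0 - f w)%C with (- f w)%C in HN by ring. rewrite Cmod_opp in HN. lra.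
Qed.

(** A chain of discs of radius [rho] walks left along the line in steps of rho/2: the disc of radius
    rho/2 about the next centre lies in the present disc, and [vanish_disc] enlarges it to radius
    [rho]. Working in a strip allows poles at other heights. *)
Lemma unique_continuation D x0 X y0 r : 0 < r ->
  (forall z, x0 < fst z -> Rabs (snd z - y0) < r -> cdiff D z) ->
  (forall z, X < fst z -> Rabs (snd z - y0) < r -> D z = RtoC 0) ->
  forall x, x0 < x -> D (x, y0) = RtoC 0.
Proof.
  intros Hr HD H0 x1 Hx1.
  destruct (Rlt_le_dec X x1) as [L|L].
  { apply H0; simpl; [exact L | rewrite Rminus_diag, Rabs_R0; exact Hr]. }
  set (rho := Rmin r (x1 - x0) / 2).
  assert (R0 : 0 < rho) by (unfold rho; assert (0 < Rmin r (x1 - x0)) by (apply Rmin_glb_lt; lra); lra).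
  assert (R1 : rho < r) by (unfold rho; pose proof (Rmin_l r (x1 - x0)); lra).
  assert (R2 : rho < x1 - x0) by (unfold rho in *; pose proof (Rmin_r r (x1 - x0)); lra).
  (* The start at X + r with rho < r places the first disc in the region where [D] is known to
     vanish. *)
  set (xn := fun n => X + r - INR n * (rho / 2)).
  assert (P : forall n, x1 <= xn n -> forall z, Cmod (z - (xn n, y0))%C < rho -> D z = RtoC 0).
  { induction n as [|n IH]; intros Hn z Hz.
    - pose proof (fst_le_Cmod (z - (xn 0%nat, y0))%C). pose proof (snd_le_Cmod (z - (xn 0%nat, y0))%C).
      change (fst (z - (xn 0%nat, y0))%C) with (fst z - xn 0%nat) in H.
      change (snd (z - (xn 0%nat, y0))%C) with (snd z - y0) in H1.
      assert (A : Rabs (fst z - xn 0%nat) < rho) by lra. apply Rabs_def2 in A. unfold xn in A; simpl in A.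
      apply H0; lra.
    - assert (En : xn n = xn (S n) + rho / 2) by (unfold xn; rewrite S_INR; ring).
      revert z Hz. apply (vanish_disc D (xn (S n), y0) rho (rho / 2)); try lra.
      + intros v [V1 V2]; simpl in *. apply HD; [lra|]. apply Rabs_def1; lra.
      + intros v Hv. apply IH; [lra|].
        replace (v - (xn n, y0))%C with ((v - (xn (S n), y0)) + RtoC (- (rho / 2)))%C.
        2:{ rewrite En. apply injective_projections; simpl; ring. }
        eapply Rle_lt_trans; [apply Cmod_triangle|].
        rewrite Cmod_R, Rabs_Ropp, Rabs_pos_eq; lra. }
  destruct (nfloor_ex ((X + r - x1) / (rho / 2))) as [n [N1 N2]].
  { apply Rdiv_le_0_compat; lra. }
  apply Rle_div_r in N1; [|lra]. apply Rlt_div_l in N2; [|lra].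
  apply (P n); [unfold xn; lra|].
  replace ((x1, y0) - (xn n, y0))%C with (RtoC (x1 - xn n)) by (apply injective_projections; simpl; ring).
  rewrite Cmod_R. unfold xn. apply Rabs_def1; lra.
Qed.

(** * Laplace transforms *)

Lemma exp_le_mono x y : x <= y -> exp x <= exp y.
Proof. intros [H | ->]; [left; apply exp_increasing, H | right; reflexivity]. Qed.

Lemma cexp_plus a b : cexp (a + b)%C = (cexp a * cexp b)%C.
Proof.
  unfold cexp, Cplus, Cmult, Re, Im; simpl. rewrite exp_plus, cos_plus, sin_plus. f_equal; ring.
Qed.

Lemma cexp_0 : cexp 0 = RtoC 1.
Proof. unfold cexp; simpl. rewrite exp_0, cos_0, sin_0. apply injective_projections; simpl; ring. Qed.

Lemma Cmod_cexp z : Cmod (cexp z) = exp (fst z).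
Proof.
  unfold cexp, Cmod, Re, Im; simpl.
  replace (exp (fst z) * cos (snd z) * (exp (fst z) * cos (snd z) * 1) +
           exp (fst z) * sin (snd z) * (exp (fst z) * sin (snd z) * 1))
    with (exp (fst z) * exp (fst z) * (Rsqr (sin (snd z)) + Rsqr (cos (snd z)))) by (unfold Rsqr; ring).
  rewrite sin2_cos2, Rmult_1_r. apply sqrt_square. left; apply exp_pos.
Qed.

Lemma cexp_opp z : (cexp (- z) * cexp z)%C = RtoC 1.
Proof. rewrite <- cexp_plus. replace (- z + z)%C with (RtoC 0) by ring. apply cexp_0. Qed.

Lemma cexp_neq z : cexp z <> RtoC 0.
Proof. apply Cmod_gt_0. rewrite Cmod_cexp. apply exp_pos. Qed.

Lemma cc_lin (h : C) (t : R) : cc (fun t : R => h * RtoC t)%C t.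
Proof. apply cc_mult; [apply cc_const | apply cc_RtoC, continuous_id]. Qed.

Lemma cc_exp_lin (h : C) (t : R) : cc (fun t : R => cexp (h * RtoC t)) t.
Proof. apply cc_cexp, cc_lin. Qed.

Lemma CI_cexp (h : C) a b : (h * CI (fun t => cexp (h * RtoC t)) a b = cexp (h * RtoC b) - cexp (h * RtoC a))%C.
Proof.
  rewrite <- CI_mult_const by (apply cint_cc; intros; apply cc_exp_lin).
  set (x := fst h). set (y := snd h).
  assert (E : forall t, cexp (h * RtoC t) = (exp (x * t) * cos (y * t), exp (x * t) * sin (y * t))).
  { intros t. unfold cexp, Re, Im; simpl. fold x y.
    replace (x * t - y * 0) with (x * t) by ring. replace (x * 0 + y * t) with (y * t) by ring. reflexivity. }
  rewrite !E. apply (CI_derive (fun t => (exp (x * t) * cos (y * t), exp (x * t) * sin (y * t)))).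
  intros t _. split; [|split].
  - rewrite E. simpl. fold x y. auto_derive; [exact I | ring].
  - rewrite E. simpl. fold x y. auto_derive; [exact I | ring].
  - apply cc_mult; [apply cc_const | apply cc_exp_lin].
Qed.

Lemma CI_cexp_unit h : (h * CI (fun t => cexp (h * RtoC t)) 0 1 = cexp h - 1)%C.
Proof.
  rewrite CI_cexp. replace (h * RtoC 1)%C with h by ring. replace (h * 0)%C with (RtoC 0) by ring.
  rewrite cexp_0. reflexivity.
Qed.

Lemma Cmod_cexp_le h t : 0 <= t <= 1 -> Cmod (cexp (h * RtoC t)) <= exp (Cmod h).
Proof.
  intros Ht. rewrite Cmod_cexp. apply exp_le_mono. simpl.
  pose proof (fst_le_Cmod h). pose proof (Rle_abs (fst h)). pose proof (Cmod_ge_0 h). nra.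
Qed.

(** Both this bound and the quadratic one below come from exp(h) - 1 = h times the integral of
    exp(ht) over [0,1], used once here and twice there. *)
Lemma cexp_bound1 h : Cmod (cexp h - 1)%C <= Cmod h * exp (Cmod h).
Proof.
  rewrite <- CI_cexp_unit, Cmod_mult. apply Rmult_le_compat_l; [apply Cmod_ge_0|].
  replace (exp (Cmod h)) with ((1 - 0) * exp (Cmod h)) by ring.
  apply CI_norm_const; [lra | apply cint_cc; intros; apply cc_exp_lin |].
  intros t Ht. apply Cmod_cexp_le. lra.
Qed.

Lemma cexp_bound2 h : Cmod (cexp h - 1 - h)%C <= Cmod h ^ 2 * exp (Cmod h).
Proof.
  assert (E : (cexp h - 1 - h = h * CI (fun t => cexp (h * RtoC t) - 1)%C 0 1)%C).
  { rewrite (CI_minus (fun t => cexp (h * RtoC t)) (fun _ => RtoC 1)).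
    - rewrite CI_const. rewrite <- CI_cexp_unit. replace (RtoC (1 - 0)) with (RtoC 1) by (f_equal; ring). ring.
    - apply cint_cc; intros; apply cc_exp_lin.
    - apply cint_cc; intros; apply cc_const. }
  rewrite E, Cmod_mult. simpl (_ ^ 2). rewrite Rmult_1_r, Rmult_assoc.
  apply Rmult_le_compat_l; [apply Cmod_ge_0|].
  replace (Cmod h * exp (Cmod h)) with ((1 - 0) * (Cmod h * exp (Cmod h))) by ring.
  apply CI_norm_const; [lra | |].
  - apply cint_cc; intros; apply cc_minus; [apply cc_exp_lin | apply cc_const].
  - intros t Ht. eapply Rle_trans; [apply cexp_bound1|].
    assert (B : Cmod (h * RtoC t)%C <= Cmod h).
    { rewrite Cmod_mult, Cmod_R, Rabs_pos_eq by lra. pose proof (Cmod_ge_0 h). nra. }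
    apply Rmult_le_compat; [apply Cmod_ge_0 | left; apply exp_pos | exact B | apply exp_le_mono, B].
Qed.

Lemma exp_small c eps : 0 < c -> 0 < eps -> exists T0, 0 <= T0 /\ forall T, T0 <= T -> exp (- (c * T)) < eps.
Proof.
  intros Hc He. exists (Rmax 0 (- ln eps / c + 1)). split; [apply Rmax_l|].
  intros T HT. assert (K : - ln eps / c + 1 <= T) by (eapply Rle_trans; [apply Rmax_r | exact HT]).
  rewrite <- (exp_ln eps He). apply exp_increasing.
  assert (c * (- ln eps / c + 1) <= c * T) by (apply Rmult_le_compat_l; lra).
  replace (c * (- ln eps / c + 1)) with (- ln eps + c) in H by (field; lra). lra.
Qed.

Lemma RInt_exp C0 c a b : 0 < c ->
  is_RInt (fun t => C0 * exp (- (c * t))) a b (C0 / c * (exp (- (c * a)) - exp (- (c * b)))).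
Proof.
  intros Hc.
  replace (C0 / c * (exp (- (c * a)) - exp (- (c * b)))) with
    (minus ((fun t => - (C0 / c) * exp (- (c * t))) b) ((fun t => - (C0 / c) * exp (- (c * t))) a)).
  - apply (is_RInt_derive (V := RC) (fun t => - (C0 / c) * exp (- (c * t)))); intros t _.
    + auto_derive; [exact I | field; lra].
    + continuous_by_derive. exact I.
  - unfold minus, plus, opp; simpl. ring.
Qed.

Lemma t_le_exp eta t : 0 < eta -> t <= / eta * exp (eta * t).
Proof.
  intros He. apply Rmult_le_reg_l with eta; [exact He|]. rewrite <- Rmult_assoc, Rinv_r, Rmult_1_l by lra.
  pose proof (exp_ineq1_le (eta * t)). lra.
Qed.

(* Integrability against every continuous weight: products of Riemann integrable functions are
   not available in Coquelicot, and in this form no such product is needed. *)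
Definition loci (e : R -> C) : Prop :=
  forall w : R -> C, (forall t, cc w t) -> forall T, 0 <= T -> cint (fun t => e t * w t)%C 0 T.

Definition expb (e : R -> C) (C0 a : R) : Prop := forall t, 0 <= t -> Cmod (e t) <= C0 * exp (a * t).

Definition is_lap (e : R -> C) (s l : C) : Prop :=
  forall eps, 0 < eps -> exists T0, forall T, T0 <= T ->
    Cmod (CI (fun t => e t * cexp (- s * RtoC t)) 0 T - l)%C < eps.

(* Unspecified where the integral diverges. *)
Definition Lap (e : R -> C) (s : C) : C := epsilon (inhabits (RtoC 0)) (is_lap e s).

Lemma loci_cc e : (forall t, cc e t) -> loci e.
Proof. intros H w Hw T HT. apply cint_cc. intros t _. apply cc_mult; [apply H | apply Hw]. Qed.

Lemma loci_mult e u : loci e -> (forall t, cc u t) -> loci (fun t => e t * u t)%C.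
Proof.
  intros He Hu w Hw T HT. apply (cint_ext (fun t => e t * (u t * w t))%C); [intros; ring|].
  apply He; [|exact HT]. intros t. apply cc_mult; [apply Hu | apply Hw].
Qed.

Lemma loci_plus e u : loci e -> loci u -> loci (fun t => e t + u t)%C.
Proof.
  intros He Hu w Hw T HT. apply (cint_ext (fun t => e t * w t + u t * w t)%C); [intros; ring|].
  apply cint_plus; [apply He | apply Hu]; assumption.
Qed.

Lemma loci_scal c e : loci e -> loci (fun t => c * e t)%C.
Proof.
  intros He w Hw T HT. apply (cint_ext (fun t => c * (e t * w t))%C); [intros; ring|].
  apply cint_mult_const, He; assumption.
Qed.

Lemma loci_exp e s T : loci e -> 0 <= T -> cint (fun t => e t * cexp (- s * RtoC t))%C 0 T.
Proof. intros H HT. apply H; [intros; apply cc_exp_lin | exact HT]. Qed.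

Lemma expb_nonneg e C0 a : expb e C0 a -> 0 <= C0.
Proof.
  intros H. specialize (H 0 (Rle_refl 0)). rewrite Rmult_0_r, exp_0, Rmult_1_r in H.
  pose proof (Cmod_ge_0 (e 0)). lra.
Qed.

Lemma expb_weaken e C0 a b : a <= b -> expb e C0 a -> expb e C0 b.
Proof.
  intros Hab H t Ht. eapply Rle_trans; [apply H, Ht|].
  apply Rmult_le_compat_l; [apply (expb_nonneg e C0 a H)|]. apply exp_le_mono. nra.
Qed.

Lemma expb_plus e u C1 C2 a : expb e C1 a -> expb u C2 a -> expb (fun t => e t + u t)%C (C1 + C2) a.
Proof.
  intros H1 H2 t Ht. eapply Rle_trans; [apply Cmod_triangle|].
  specialize (H1 t Ht). specialize (H2 t Ht). lra.
Qed.

Lemma expb_mult e u C1 C2 a b : expb e C1 a -> expb u C2 b -> expb (fun t => e t * u t)%C (C1 * C2) (a + b).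
Proof.
  intros H1 H2 t Ht. rewrite Cmod_mult. replace (C1 * C2 * exp ((a + b) * t)) with ((C1 * exp (a * t)) * (C2 * exp (b * t))).
  - apply Rmult_le_compat; try apply Cmod_ge_0; [apply H1, Ht | apply H2, Ht].
  - rewrite Rmult_plus_distr_r, exp_plus. ring.
Qed.

Lemma lap_piece e C0 a s T T' : loci e -> expb e C0 a -> a < fst s -> 0 <= T -> T <= T' ->
  Cmod (CI (fun t => e t * cexp (- s * RtoC t)) T T')%C <= C0 / (fst s - a) * exp (- ((fst s - a) * T)).
Proof.
  intros He Hb Hs HT HTT.
  assert (Hi : cint (fun t => e t * cexp (- s * RtoC t))%C T T').
  { apply (cint_sub _ 0 T T' T'); try lra. apply loci_exp; [exact He | lra]. }
  assert (C00 := expb_nonneg _ _ _ Hb).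
  assert (Hc : 0 < fst s - a) by lra.
  pose proof (RInt_exp C0 (fst s - a) T T' Hc) as HR.
  eapply Rle_trans; [apply (CI_norm_le _ (fun t => C0 * exp (- ((fst s - a) * t)))); [exact HTT | exact Hi | eexists; exact HR |]|].
  - intros t Ht. rewrite Cmod_mult, Cmod_cexp.
    replace (exp (- ((fst s - a) * t))) with (exp (a * t) * exp (fst (- s * RtoC t)%C)).
    + rewrite <- Rmult_assoc. apply Rmult_le_compat_r; [left; apply exp_pos|]. apply Hb. lra.
    + rewrite <- exp_plus. f_equal. simpl. ring.
  - rewrite (is_RInt_unique _ _ _ _ HR). apply Rmult_le_compat_l.
    + apply Rdiv_le_0_compat; lra.
    + pose proof (exp_pos (- ((fst s - a) * T'))). lra.
Qed.

Lemma lap_ex e C0 a s : loci e -> expb e C0 a -> a < fst s -> exists l, is_lap e s l.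
Proof.
  intros He Hb Hs.
  set (I := fun T => CI (fun t => e t * cexp (- s * RtoC t))%C 0 T).
  assert (Hc : 0 < fst s - a) by lra.
  assert (C00 := expb_nonneg _ _ _ Hb).
  assert (Cau : forall eps, 0 < eps -> exists T0, 0 <= T0 /\ forall T T', T0 <= T -> T0 <= T' -> Cmod (I T - I T')%C < eps).
  { intros eps Heps. destruct (exp_small (fst s - a) (eps / (C0 / (fst s - a) + 1)) Hc) as [T0 [H0 HT0]].
    { apply Rdiv_lt_0_compat; [exact Heps|]. assert (0 <= C0 / (fst s - a)) by (apply Rdiv_le_0_compat; lra). lra. }
    exists T0. split; [exact H0|].
    assert (W : forall T T', T0 <= T -> T <= T' -> Cmod (I T' - I T)%C < eps).
    { intros T T' A B. unfold I. rewrite <- (CI_Chasles _ 0 T T').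
      - replace (CI (fun t => e t * cexp (- s * RtoC t)) 0 T + CI (fun t => e t * cexp (- s * RtoC t)) T T' -
          CI (fun t => e t * cexp (- s * RtoC t)) 0 T)%C with (CI (fun t => e t * cexp (- s * RtoC t)) T T')%C by ring.
        eapply Rle_lt_trans; [apply (lap_piece e C0 a); try assumption; lra|].
        specialize (HT0 T A).
        assert (K : 0 <= C0 / (fst s - a)) by (apply Rdiv_le_0_compat; lra).
        apply Rlt_div_r in HT0; [|lra]. pose proof (exp_pos (- ((fst s - a) * T))). nra.
      - apply loci_exp; [exact He | lra].
      - apply (cint_sub _ 0 T T' T'); try lra. apply loci_exp; [exact He | lra]. }
    intros T T' A B. destruct (Rle_dec T T') as [L|L].
    - rewrite <- Cmod_opp. replace (- (I T - I T'))%C with (I T' - I T)%C by ring. apply W; assumption.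
    - apply W; lra. }
  assert (Comp : forall pr : C -> R, (forall z w, Rabs (pr z - pr w) <= Cmod (z - w)%C) ->
     exists y, forall eps, 0 < eps -> exists T0, forall T, T0 <= T -> Rabs (pr (I T) - y) < eps).
  { intros pr Hpr.
    destruct (proj1 (filterlim_locally_cauchy (U := R_CompleteSpace) (F := Rbar_locally p_infty) (fun T => pr (I T)))) as [y Hy].
    - intros eps. destruct (Cau eps (cond_pos eps)) as [T0 [_ H]].
      exists (fun T => T0 < T). split; [exists T0; auto|]. intros u v Hu Hv.
      change (Rabs (pr (I v) - pr (I u)) < eps). eapply Rle_lt_trans; [apply Hpr|]. apply H; lra.
    - exists y. intros eps Heps.
      destruct (proj1 (filterlim_locally (F := Rbar_locally p_infty) (fun T => pr (I T)) y) Hy (mkposreal eps Heps)) as [M HM].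
      exists (M + 1). intros T HT. apply HM. lra. }
  destruct (Comp fst) as [x Hx]; [intros z w; apply (fst_le_Cmod (z - w)%C)|].
  destruct (Comp snd) as [y Hy]; [intros z w; apply (snd_le_Cmod (z - w)%C)|].
  exists (x, y). intros eps Heps.
  destruct (Hx (eps / 2)) as [T1 H1]; [lra|]. destruct (Hy (eps / 2)) as [T2 H2]; [lra|].
  exists (Rmax T1 T2). intros T HT.
  assert (A1 : T1 <= T) by (eapply Rle_trans; [apply Rmax_l | exact HT]).
  assert (A2 : T2 <= T) by (eapply Rle_trans; [apply Rmax_r | exact HT]).
  eapply Rle_lt_trans; [apply Cmod_le_abs|]. fold (I T).
  specialize (H1 T A1). specialize (H2 T A2).
  change (fst (I T - (x, y))%C) with (fst (I T) - x). change (snd (I T - (x, y))%C) with (snd (I T) - y). lra.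
Qed.

Lemma Cmod_lt_eps_eq (z w : C) : (forall eps, 0 < eps -> Cmod (z - w)%C < eps) -> z = w.
Proof.
  intros H. apply Ceq_minus, Cmod_eq_0, Rle_antisym; [|apply Cmod_ge_0].
  apply Rnot_lt_le. intros P. specialize (H _ P). lra.
Qed.

Lemma is_lap_unique e s l l' : is_lap e s l -> is_lap e s l' -> l = l'.
Proof.
  intros H H'. apply Cmod_lt_eps_eq. intros eps He.
  destruct (H (eps / 2)) as [T1 H1]; [lra|]. destruct (H' (eps / 2)) as [T2 H2]; [lra|].
  specialize (H1 _ (Rmax_l T1 T2)). specialize (H2 _ (Rmax_r T1 T2)).
  set (J := CI (fun t => e t * cexp (- s * RtoC t))%C 0 (Rmax T1 T2)) in *.
  replace (l - l')%C with (- (J - l) + (J - l'))%C by ring.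
  eapply Rle_lt_trans; [apply Cmod_triangle|]. rewrite Cmod_opp. lra.
Qed.

Lemma is_lap_Lap_ex e s l : is_lap e s l -> is_lap e s (Lap e s).
Proof. intros H. unfold Lap. apply epsilon_spec. exists l. exact H. Qed.

Lemma Lap_eq e s l : is_lap e s l -> Lap e s = l.
Proof. intros H. apply (is_lap_unique e s); [apply (is_lap_Lap_ex e s l H) | exact H]. Qed.

Lemma Lap_spec e C0 a s : loci e -> expb e C0 a -> a < fst s -> is_lap e s (Lap e s).
Proof. intros A B D. destruct (lap_ex e C0 a s A B D) as [l Hl]. apply (is_lap_Lap_ex e s l Hl). Qed.

Lemma is_lap_ext e u s l : (forall t, 0 < t -> e t = u t) -> is_lap e s l -> is_lap u s l.
Proof.
  intros E H eps He. destruct (H eps He) as [T0 HT]. exists (Rmax 0 T0). intros T H1.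
  assert (0 <= T) by (eapply Rle_trans; [apply Rmax_l | exact H1]).
  rewrite (CI_ext _ (fun t => e t * cexp (- s * RtoC t))%C).
  - apply HT. eapply Rle_trans; [apply Rmax_r | exact H1].
  - intros t Ht. rewrite Rmin_left in Ht by lra. rewrite E by lra. reflexivity.
Qed.

Lemma is_lap_plus e u s l k : loci e -> loci u -> is_lap e s l -> is_lap u s k ->
  is_lap (fun t => e t + u t)%C s (l + k)%C.
Proof.
  intros Le Lu He Hu eps Heps.
  destruct (He (eps / 2)) as [T1 H1]; [lra|]. destruct (Hu (eps / 2)) as [T2 H2]; [lra|].
  exists (Rmax 0 (Rmax T1 T2)). intros T HT.
  assert (0 <= T) by (eapply Rle_trans; [apply Rmax_l | exact HT]).
  assert (A : Rmax T1 T2 <= T) by (eapply Rle_trans; [apply Rmax_r | exact HT]).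
  specialize (H1 T (Rle_trans _ _ _ (Rmax_l _ _) A)). specialize (H2 T (Rle_trans _ _ _ (Rmax_r _ _) A)).
  rewrite (CI_ext _ (fun t => e t * cexp (- s * RtoC t) + u t * cexp (- s * RtoC t))%C) by (intros; ring).
  rewrite (CI_plus (fun t => e t * cexp (- s * RtoC t))%C) by (apply loci_exp; assumption).
  set (I1 := CI (fun t => e t * cexp (- s * RtoC t))%C 0 T) in *.
  set (I2 := CI (fun t => u t * cexp (- s * RtoC t))%C 0 T) in *.
  replace (I1 + I2 - (l + k))%C with ((I1 - l) + (I2 - k))%C by ring.
  eapply Rle_lt_trans; [apply Cmod_triangle|]. lra.
Qed.

Lemma is_lap_scal c e s l : loci e -> is_lap e s l -> is_lap (fun t => c * e t)%C s (c * l)%C.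
Proof.
  intros Le He eps Heps. pose proof (Cmod_ge_0 c).
  destruct (He (eps / (Cmod c + 1))) as [T0 H0]; [apply Rdiv_lt_0_compat; lra|].
  exists (Rmax 0 T0). intros T HT.
  assert (0 <= T) by (eapply Rle_trans; [apply Rmax_l | exact HT]).
  specialize (H0 T (Rle_trans _ _ _ (Rmax_r _ _) HT)).
  rewrite (CI_ext _ (fun t => c * (e t * cexp (- s * RtoC t)))%C) by (intros; ring).
  rewrite CI_mult_const by (apply loci_exp; assumption).
  set (I1 := CI (fun t => e t * cexp (- s * RtoC t))%C 0 T) in *.
  replace (c * I1 - c * l)%C with (c * (I1 - l))%C by ring. rewrite Cmod_mult.
  apply Rlt_div_r in H0; [|lra]. pose proof (Cmod_ge_0 (I1 - l)%C). nra.
Qed.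

Lemma is_lap_shift e s h l : is_lap e (s + h)%C l <-> is_lap (fun t => e t * cexp (- h * RtoC t))%C s l.
Proof.
  assert (E : forall T, CI (fun t => e t * cexp (- (s + h) * RtoC t))%C 0 T =
              CI (fun t => e t * cexp (- h * RtoC t) * cexp (- s * RtoC t))%C 0 T).
  { intros T. apply CI_ext. intros t _. rewrite <- Cmult_assoc, <- cexp_plus. do 2 f_equal. ring. }
  split; intros H eps He; destruct (H eps He) as [T0 HT]; exists T0; intros T Hle; specialize (HT T Hle);
    [rewrite <- E | rewrite E]; exact HT.
Qed.

Lemma is_lap_norm e C0 a s l : loci e -> expb e C0 a -> a < fst s -> is_lap e s l ->
  Cmod l <= C0 / (fst s - a).
Proof.
  intros Le He Hs Hl. apply le_epsilon. intros eps Heps.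
  destruct (Hl eps Heps) as [T0 H0]. specialize (H0 _ (Rmax_r 0 T0)).
  pose proof (lap_piece e C0 a s 0 (Rmax 0 T0) Le He Hs (Rle_refl 0) (Rmax_l 0 T0)) as B.
  rewrite Rmult_0_r, Ropp_0, exp_0, Rmult_1_r in B.
  set (J := CI (fun t => e t * cexp (- s * RtoC t))%C 0 (Rmax 0 T0)) in *.
  replace l with (J - (J - l))%C by ring. unfold Cminus at 1.
  eapply Rle_trans; [apply Cmod_triangle|]. rewrite Cmod_opp. lra.
Qed.

Lemma loci_t e : loci e -> loci (fun t => e t * RtoC (- t))%C.
Proof. intros H. apply loci_mult; [exact H|]. intros t. apply cc_RtoC, (continuous_opp (V := RN)), continuous_id. Qed.

Lemma expb_t e C0 a eta : 0 < eta -> expb e C0 a -> expb (fun t => e t * RtoC (- t))%C (C0 * / eta) (a + eta).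
Proof.
  intros He H. apply expb_mult; [exact H|]. intros t Ht.
  rewrite Cmod_R, Rabs_Ropp, Rabs_pos_eq by exact Ht. apply t_le_exp, He.
Qed.

(** The derivative is the transform of -t e(t). The error of the linear approximation at s+h is the
    transform of e(t)(exp(-ht) - 1 + ht), whose second factor is at most (|h|t)^2 exp(|h|t). *)
Lemma Lap_cdiff e C0 a s : loci e -> expb e C0 a -> a < fst s -> cdiff (Lap e) s.
Proof.
  (* A quarter of the gap: each of the two factors [t] and the factor exp(|h|t) costs one [eta], and
     a + 3 eta is still below Re s. *)
  intros Le He Hs. set (eta := (fst s - a) / 4). assert (Heta : 0 < eta) by (unfold eta; lra).
  assert (C00 := expb_nonneg _ _ _ He).
  set (D := Lap (fun t => e t * RtoC (- t))%C s).
  assert (HD : is_lap (fun t => e t * RtoC (- t))%C s D).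
  { apply (Lap_spec _ (C0 * / eta) (a + eta)); [apply loci_t, Le | apply expb_t; assumption | unfold eta; lra]. }
  set (K := C0 * (/ eta * / eta) / (fst s - (a + 3 * eta))).
  assert (HK : 0 <= K).
  { apply Rdiv_le_0_compat; [|unfold eta; lra]. pose proof (Rinv_0_lt_compat eta Heta). nra. }
  apply cdiff_eps. exists D. intros eps Heps. exists (Rmin eta (eps / (K + 1))). split.
  { apply Rmin_glb_lt; [exact Heta | apply Rdiv_lt_0_compat; lra]. }
  intros w Hw. set (h := (w - s)%C) in *.
  assert (Hh1 : Cmod h <= eta) by (left; eapply Rlt_le_trans; [exact Hw | apply Rmin_l]).
  assert (Hh2 : Cmod h < eps / (K + 1)) by (eapply Rlt_le_trans; [exact Hw | apply Rmin_r]).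
  assert (Ew : w = (s + h)%C) by (unfold h; ring).
  assert (Fh : - eta <= fst h) by (pose proof (fst_le_Cmod h) as F; pose proof (Rabs_maj2 (fst h)); lra).
  set (u := fun t : R => (e t * (cexp (- h * RtoC t) - 1 + h * RtoC t))%C).
  assert (Hl : is_lap u s (Lap e w - Lap e s - D * h)%C).
  { apply is_lap_ext with (e := fun t => ((e t * cexp (- h * RtoC t) + (-1) * e t) + - h * (e t * RtoC (- t)))%C).
    { intros t _. unfold u. rewrite RtoC_opp. ring. }
    replace (Lap e w - Lap e s - D * h)%C with ((Lap e w + (-1) * Lap e s) + - h * D)%C by ring.
    assert (L1 : loci (fun t => e t * cexp (- h * RtoC t))%C) by (apply loci_mult; [exact Le | intros; apply cc_exp_lin]).
    assert (L2 : loci (fun t => (-1) * e t)%C) by (apply loci_scal, Le).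
    apply is_lap_plus; [apply loci_plus; assumption | apply loci_scal, loci_t, Le | |].
    - apply is_lap_plus; [exact L1 | exact L2 | |].
      + apply (proj1 (is_lap_shift e s h (Lap e w))). rewrite <- Ew. apply (Lap_spec e C0 a); try assumption.
        rewrite Ew. change (a < fst s + fst h). unfold eta in *; lra.
      + apply is_lap_scal; [exact Le | apply (Lap_spec e C0 a); assumption].
    - apply is_lap_scal; [apply loci_t, Le | exact HD]. }
  assert (Hu : expb u (C0 * (/ eta * / eta) * Cmod h ^ 2) (a + 3 * eta)).
  { intros t Ht. unfold u. rewrite Cmod_mult.
    assert (B : Cmod (cexp (- h * RtoC t) - 1 + h * RtoC t)%C <= (Cmod h * t) ^ 2 * exp (eta * t)).
    { pose proof (cexp_bound2 (- h * RtoC t)%C) as B.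
      replace (cexp (- h * RtoC t) - 1 - - h * RtoC t)%C with (cexp (- h * RtoC t) - 1 + h * RtoC t)%C in B by ring.
      rewrite Cmod_mult, Cmod_opp, Cmod_R, Rabs_pos_eq in B by exact Ht.
      eapply Rle_trans; [exact B|]. apply Rmult_le_compat_l; [apply pow2_ge_0|]. apply exp_le_mono. nra. }
    pose proof (t_le_exp eta t Heta) as Bt.
    assert (Bt2 : t ^ 2 <= (/ eta * / eta) * (exp (eta * t) * exp (eta * t))).
    { replace (/ eta * / eta * (exp (eta * t) * exp (eta * t))) with ((/ eta * exp (eta * t)) ^ 2) by ring.
      apply pow_incr. lra. }
    eapply Rle_trans; [apply Rmult_le_compat; [apply Cmod_ge_0 | apply Cmod_ge_0 | apply He, Ht | exact B]|].
    replace (exp ((a + 3 * eta) * t)) with (exp (a * t) * (exp (eta * t) * exp (eta * t)) * exp (eta * t)).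
    2:{ rewrite <- !exp_plus. f_equal. ring. }
    rewrite Rpow_mult_distr.
    replace (C0 * exp (a * t) * (Cmod h ^ 2 * t ^ 2 * exp (eta * t))) with
      ((C0 * exp (a * t) * Cmod h ^ 2 * exp (eta * t)) * t ^ 2) by ring.
    eapply Rle_trans; [apply Rmult_le_compat_l; [|exact Bt2]|].
    - pose proof (exp_pos (a * t)). pose proof (exp_pos (eta * t)). pose proof (Cmod_ge_0 h).
      repeat apply Rmult_le_pos; lra.
    - apply Req_le. ring. }
  assert (Lu : loci u).
  { apply loci_mult; [exact Le|]. intros t. apply cc_plus; [apply cc_minus; [apply cc_exp_lin | apply cc_const] | apply cc_lin]. }
  pose proof (is_lap_norm u _ (a + 3 * eta) s _ Lu Hu ltac:(unfold eta; lra) Hl) as B.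
  eapply Rle_trans; [exact B|].
  replace (C0 * (/ eta * / eta) * Cmod h ^ 2 / (fst s - (a + 3 * eta))) with (K * Cmod h * Cmod h).
  2:{ unfold K. simpl. field. unfold eta; lra. }
  apply Rmult_le_compat_r; [apply Cmod_ge_0|].
  apply Rlt_div_r in Hh2; [|lra]. pose proof (Cmod_ge_0 h). lra.
Qed.

(** * The summatory function and its asymptotic expansion *)

Definition nfl (x : R) : nat := Z.to_nat (Int_part x).

Lemma nfl_eq n x : INR n <= x < INR n + 1 -> nfl x = n.
Proof.
  intros H. unfold nfl. rewrite <- (Int_part_spec x (Z.of_nat n)).
  - apply Nat2Z.id.
  - rewrite <- INR_IZR_INZ. lra.
Qed.

Lemma nfl_bounds x : 0 <= x -> INR (nfl x) <= x < INR (nfl x) + 1.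
Proof.
  intros Hx. destruct (nfloor_ex x Hx) as [n Hn]. rewrite (nfl_eq n x Hn). exact Hn.
Qed.

(* The variable is t = log x. *)
Definition Shat (f : nat -> C) (t : R) : C := csum f 1 (nfl (exp t)).

Lemma Shat_eq f n t : ln (INR (S n)) <= t < ln (INR (S (S n))) -> Shat f t = csum f 1 (S n).
Proof.
  intros [H1 H2]. unfold Shat. f_equal. apply nfl_eq.
  assert (0 < INR (S n)) by (apply lt_0_INR; lia). assert (0 < INR (S (S n))) by (apply lt_0_INR; lia).
  rewrite <- (S_INR (S n)). split.
  - rewrite <- (exp_ln (INR (S n))) by assumption. apply exp_le_mono, H1.
  - rewrite <- (exp_ln (INR (S (S n)))) by assumption. apply exp_increasing, H2.
Qed.

Lemma ln_INR_le n m : (1 <= n)%nat -> (n <= m)%nat -> ln (INR n) <= ln (INR m).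
Proof.
  intros H1 H2. assert (0 < INR n) by (apply lt_0_INR; lia). apply le_INR in H2.
  destruct H2 as [H2 | ->]; [left; apply ln_increasing; assumption | right; reflexivity].
Qed.

Lemma Shat_piece f (w : R -> C) n : (forall t, cc w t) ->
  cint (fun t => Shat f t * w t)%C (ln (INR (S n))) (ln (INR (S (S n)))).
Proof.
  intros Hw. apply (cint_ext (fun t => csum f 1 (S n) * w t)%C).
  - intros t Ht. pose proof (ln_INR_le (S n) (S (S n)) ltac:(lia) ltac:(lia)).
    rewrite Rmin_left, Rmax_right in Ht by assumption. rewrite (Shat_eq f n) by lra. reflexivity.
  - apply cint_cc. intros t _. apply cc_mult; [apply cc_const | apply Hw].
Qed.

Lemma ln_INR_large T : exists N, forall n, (N <= n)%nat -> T <= ln (INR (S n)).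
Proof.
  exists (S (nfl (exp T))). intros n Hn. rewrite <- (ln_exp T) at 1.
  pose proof (nfl_bounds (exp T) (Rlt_le _ _ (exp_pos T))). apply le_INR in Hn. rewrite S_INR in Hn.
  rewrite S_INR. left. apply ln_increasing; [apply exp_pos | lra].
Qed.

Lemma Shat_loci f : loci (Shat f).
Proof.
  intros w Hw.
  assert (H : forall n, cint (fun t => Shat f t * w t)%C 0 (ln (INR (S n)))).
  { induction n as [|n IH].
    - simpl INR. rewrite ln_1. apply cint_point.
    - apply (cint_Chasles _ _ (ln (INR (S n)))); [exact IH | apply Shat_piece, Hw]. }
  intros T HT. destruct (ln_INR_large T) as [N HN]. specialize (HN N (le_n N)).
  apply (cint_sub _ 0 0 T (ln (INR (S N)))); try lra. apply H.
Qed.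

(** On [log(n+1), log(n+2)) the summatory function is constant, so each piece integrates exactly.
    The boundary term pairs the sum up to [n] with log(n+1), the right end of the interval on which
    that sum is the value of S. *)
Lemma abel_summation f (s : C) n :
  csum (fun k => f (S k) * cpowR (INR (S k)) (- s))%C 0 n =
  (csum f 1 n * cexp (- s * RtoC (ln (INR (S n))))
   + s * CI (fun t => Shat f t * cexp (- s * RtoC t)) 0 (ln (INR (S n))))%C.
Proof.
  induction n as [|n IH].
  - simpl INR. rewrite ln_1, CI_point. simpl csum. ring.
  - set (a := ln (INR (S n))) in *. set (b := ln (INR (S (S n)))).
    assert (Ha : 0 <= a) by (unfold a; rewrite <- ln_1; apply (ln_INR_le 1 (S n)); lia).
    assert (Hab : a <= b) by (apply ln_INR_le; lia).
    rewrite <- (CI_Chasles _ 0 a b).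
    2: apply loci_exp; [apply Shat_loci | exact Ha].
    2: apply (Shat_piece f (fun t => cexp (- s * RtoC t))); intros; apply cc_exp_lin.
    rewrite (CI_ext (fun t => Shat f t * cexp (- s * RtoC t))%C (fun t => csum f 1 (S n) * cexp (- s * RtoC t))%C a b).
    2:{ intros t Ht. rewrite Rmin_left, Rmax_right in Ht by exact Hab. rewrite (Shat_eq f n) by (fold a b; lra). reflexivity. }
    rewrite CI_mult_const by (apply cint_cc; intros; apply cc_exp_lin).
    change (csum (fun k => f (S k) * cpowR (INR (S k)) (- s))%C 0 (S n)) with
      (csum (fun k => f (S k) * cpowR (INR (S k)) (- s))%C 0 n + f (S n) * cpowR (INR (S n)) (- s))%C.
    rewrite IH. unfold cpowR. fold a.
    pose proof (CI_cexp (- s)%C a b) as E.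
    set (J := CI (fun t => cexp (- s * RtoC t)) a b) in *.
    change (csum f 1 (S n)) with (csum f 1 n + f (S n))%C.
    set (I0 := CI (fun t => Shat f t * cexp (- s * RtoC t))%C 0 a).
    replace (s * (I0 + (csum f 1 n + f (S n)) * J))%C with (s * I0 - (csum f 1 n + f (S n)) * (- s * J))%C by ring.
    rewrite E. ring.
Qed.

Lemma dirichlet_laplace f s g C0 a : expb (Shat f) C0 a -> a < fst s ->
  is_series (fun n => f (S n) * cpowR (INR (S n)) (- s))%C g -> g = (s * Lap (Shat f) s)%C.
Proof.
  intros Hb Hs Hser.
  assert (C00 := expb_nonneg _ _ _ Hb).
  pose proof (Lap_spec (Shat f) C0 a s (Shat_loci f) Hb Hs) as HL.
  set (l := Lap (Shat f) s) in *.
  apply Cmod_lt_eps_eq. intros eps Heps. pose proof (Cmod_ge_0 s) as Ms.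
  destruct (proj1 (is_series_C _ _) Hser (eps / 3)) as [N1 H1]; [lra|].
  destruct (HL (eps / 3 / (Cmod s + 1))) as [T2 H2]; [apply Rdiv_lt_0_compat; lra|].
  destruct (exp_small (fst s - a) (eps / 3 / (C0 * exp (Rabs a) + 1))) as [T3 [_ H3]]; [lra | |].
  { apply Rdiv_lt_0_compat; [lra|]. pose proof (exp_pos (Rabs a)). nra. }
  destruct (ln_INR_large (Rmax T2 T3)) as [N2 HN2].
  set (n := S (Nat.max N1 N2)).
  specialize (H1 n ltac:(unfold n; lia)). specialize (HN2 n ltac:(unfold n; lia)).
  rewrite abel_summation in H1.
  assert (A2 : T2 <= ln (INR (S n))) by (eapply Rle_trans; [apply Rmax_l | exact HN2]).
  assert (A3 : T3 <= ln (INR (S n))) by (eapply Rle_trans; [apply Rmax_r | exact HN2]).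
  specialize (H2 _ A2). specialize (H3 _ A3).
  set (I0 := CI (fun t => Shat f t * cexp (- s * RtoC t))%C 0 (ln (INR (S n)))) in *.
  set (B := (csum f 1 n * cexp (- s * RtoC (ln (INR (S n)))))%C) in *.
  assert (HB : Cmod B < eps / 3).
  { set (b := ln (INR (S n))) in *. set (a0 := ln (INR n)).
    assert (P1 : 1 <= INR n) by (apply (le_INR 1); unfold n; lia).
    assert (Ha0 : 0 <= a0) by (unfold a0; rewrite <- ln_1; apply (ln_INR_le 1 n); unfold n; lia).
    assert (Hab : a0 <= b) by (apply ln_INR_le; unfold n; lia).
    (* [Hb] is applied at log n, while the exponential sits at log(n+1). They differ by at most 1,
       which costs the factor exp(|a|) provided for in [T3]. *)
    assert (Hba : b <= a0 + 1).
    { unfold b, a0. rewrite <- (ln_exp 1). rewrite <- ln_mult by (try apply exp_pos; lra).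
      assert (INR (S n) <= INR n * exp 1).
      { rewrite S_INR. pose proof (exp_ineq1_le 1). nra. }
      destruct H as [H|H]; [left; apply ln_increasing; [rewrite S_INR; lra | exact H] | rewrite H; right; reflexivity]. }
    assert (Hba' : a0 < b) by (apply ln_increasing; [lra | rewrite S_INR; lra]).
    assert (E : csum f 1 n = Shat f a0).
    { unfold n in *. symmetry. apply Shat_eq. split; [right; reflexivity | exact Hba']. }
    unfold B. rewrite Cmod_mult, Cmod_cexp, E.
    apply Rle_lt_trans with (C0 * exp (Rabs a) * exp (- ((fst s - a) * b))).
    - apply Rle_trans with (C0 * exp (a * a0) * exp (fst (- s * RtoC b)%C)).
      + apply Rmult_le_compat_r; [left; apply exp_pos | apply Hb, Ha0].
      + rewrite !Rmult_assoc. apply Rmult_le_compat_l; [exact C00|]. rewrite <- !exp_plus.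
        apply exp_le_mono. change (fst (- s * RtoC b)%C) with (- fst s * b - - snd s * 0).
        pose proof (Rle_abs a). pose proof (Rabs_maj2 a). nra.
    - pose proof (exp_pos (Rabs a)). apply Rlt_div_r in H3; [|nra].
      pose proof (exp_pos (- ((fst s - a) * b))). nra. }
  replace (g - s * l)%C with ((B + s * (I0 - l)) - (B + s * I0 - g))%C by ring.
  unfold Cminus at 1. eapply Rle_lt_trans; [apply Cmod_triangle|]. rewrite Cmod_opp.
  pose proof (Cmod_triangle B (s * (I0 - l))) as T. rewrite Cmod_mult in T.
  apply Rlt_div_r in H2; [|lra]. pose proof (Cmod_ge_0 (I0 - l)%C). nra.
Qed.

(* Products of such functions are again of this kind, with added exponents b; here al is the
   Hölder exponent in the variable x = e^t, since T <= t + e^(-t) means e^T <= e^t + O(1). *)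
Definition lh (al b : R) (g : R -> C) : Prop :=
  exists C0, expb g C0 b /\
    forall t T, 0 <= t -> t <= T -> T <= t + exp (- t) -> Cmod (g T - g t)%C <= C0 * exp ((b - al) * t).

Lemma exp_neg_le_1 t : 0 <= t -> exp (- t) <= 1.
Proof. intros H. rewrite <- exp_0. apply exp_le_mono. lra. Qed.

Lemma exp_near b t T : t <= T -> T <= t + 1 -> exp (b * T) <= exp (Rabs b) * exp (b * t).
Proof.
  intros H1 H2. rewrite <- exp_plus. apply exp_le_mono.
  pose proof (Rle_abs b). pose proof (Rabs_pos b). nra.
Qed.

Lemma lh_mult al b1 b2 g1 g2 : lh al b1 g1 -> lh al b2 g2 -> lh al (b1 + b2) (fun t => g1 t * g2 t)%C.
Proof.
  intros [C1 [B1 D1]] [C2 [B2 D2]].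
  pose proof (expb_nonneg _ _ _ B1) as P1. pose proof (expb_nonneg _ _ _ B2) as P2.
  pose proof (exp_pos (Rabs b2)) as E2.
  assert (Pm : 0 <= C1 * C2) by (apply Rmult_le_pos; assumption).
  exists (C1 * C2 * (exp (Rabs b2) + 1)). split.
  - intros t Ht. eapply Rle_trans; [apply (expb_mult g1 g2 C1 C2 b1 b2 B1 B2 t Ht)|].
    apply Rmult_le_compat_r; [left; apply exp_pos | nra].
  - intros t T Ht HT1 HT2.
    replace (g1 T * g2 T - g1 t * g2 t)%C with ((g1 T - g1 t) * g2 T + g1 t * (g2 T - g2 t))%C by ring.
    eapply Rle_trans; [apply Cmod_triangle|]. rewrite !Cmod_mult.
    specialize (D1 t T Ht HT1 HT2). specialize (D2 t T Ht HT1 HT2).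
    assert (K2 : Cmod (g2 T) <= C2 * (exp (Rabs b2) * exp (b2 * t))).
    { eapply Rle_trans; [apply B2; lra|]. apply Rmult_le_compat_l; [exact P2|]. apply exp_near; [exact HT1|].
      pose proof (exp_neg_le_1 t Ht). lra. }
    specialize (B1 t Ht).
    apply Rle_trans with ((C1 * exp ((b1 - al) * t)) * (C2 * (exp (Rabs b2) * exp (b2 * t))) +
                          (C1 * exp (b1 * t)) * (C2 * exp ((b2 - al) * t))).
    + apply Rplus_le_compat; apply Rmult_le_compat; try apply Cmod_ge_0; assumption.
    + apply Req_le.
      replace (exp ((b1 + b2 - al) * t)) with (exp ((b1 - al) * t) * exp (b2 * t)) by (rewrite <- exp_plus; f_equal; ring).
      replace (exp (b1 * t)) with (exp ((b1 - al) * t) * exp (al * t)) by (rewrite <- exp_plus; f_equal; ring).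
      replace (exp ((b2 - al) * t)) with (exp (b2 * t) * / exp (al * t)).
      * field. apply Rgt_not_eq, exp_pos.
      * rewrite <- exp_Ropp, <- exp_plus. f_equal. ring.
Qed.

Lemma lh_weaken al b b' g : b <= b' -> lh al b g -> lh al b' g.
Proof.
  intros Hb [C0 [B D]]. exists C0. split; [apply (expb_weaken g C0 b b' Hb B)|].
  intros t T Ht H1 H2. eapply Rle_trans; [apply D; assumption|].
  apply Rmult_le_compat_l; [apply (expb_nonneg _ _ _ B)|]. apply exp_le_mono. nra.
Qed.

Lemma lh_plus al b g1 g2 : lh al b g1 -> lh al b g2 -> lh al b (fun t => g1 t + g2 t)%C.
Proof.
  intros [C1 [B1 D1]] [C2 [B2 D2]]. exists (C1 + C2). split; [apply expb_plus; assumption|].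
  intros t T Ht H1 H2. replace (g1 T + g2 T - (g1 t + g2 t))%C with ((g1 T - g1 t) + (g2 T - g2 t))%C by ring.
  eapply Rle_trans; [apply Cmod_triangle|]. specialize (D1 t T Ht H1 H2). specialize (D2 t T Ht H1 H2). lra.
Qed.

Lemma lh_const al c : lh al 0 (fun _ => c).
Proof.
  exists (Cmod c). split.
  - intros t _. rewrite Rmult_0_l, exp_0. lra.
  - intros. replace (c - c)%C with (RtoC 0) by ring. rewrite Cmod_0.
    apply Rmult_le_pos; [apply Cmod_ge_0 | left; apply exp_pos].
Qed.

Lemma lh_csum al b (g : nat -> R -> C) m : (forall k, (k < m)%nat -> lh al b (g k)) ->
  lh al b (fun t => csum (fun k => g k t) 0 m).
Proof.
  intros H; induction m as [|m IH]; simpl.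
  - exists 0. split; intros.
    + intros t _. rewrite Cmod_0. lra.
    + replace (0 - 0)%C with (RtoC 0) by ring. rewrite Cmod_0. lra.
  - apply lh_plus; [apply IH; intros; apply H; lia | apply H; lia].
Qed.

Lemma lh_cexp al kappa : al <= 1 -> lh al (fst kappa) (fun t => cexp (kappa * RtoC t)).
Proof.
  intros Hal. set (M := Cmod kappa). assert (HM : 0 <= M) by apply Cmod_ge_0.
  exists (1 + M * exp M).
  assert (HK : 0 <= M * exp M) by (apply Rmult_le_pos; [exact HM | left; apply exp_pos]).
  assert (E : forall t, Cmod (cexp (kappa * RtoC t)) = exp (fst kappa * t)).
  { intros t. rewrite Cmod_cexp. f_equal. simpl. ring. }
  split.
  - intros t Ht. rewrite E. pose proof (exp_pos (fst kappa * t)). nra.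
  - intros t T Ht H1 H2.
    replace (cexp (kappa * RtoC T) - cexp (kappa * RtoC t))%C with
      (cexp (kappa * RtoC t) * (cexp (kappa * RtoC (T - t)) - 1))%C.
    2:{ rewrite RtoC_minus. replace (kappa * RtoC T)%C with (kappa * RtoC t + kappa * (RtoC T - RtoC t))%C by ring.
        rewrite cexp_plus. ring. }
    rewrite Cmod_mult, E.
    assert (D : Cmod (cexp (kappa * RtoC (T - t)) - 1)%C <= M * exp M * exp (- (al * t))).
    { eapply Rle_trans; [apply cexp_bound1|]. rewrite Cmod_mult, Cmod_R, Rabs_pos_eq by lra. fold M.
      pose proof (exp_neg_le_1 t Ht) as L1.
      apply Rle_trans with (M * exp (- t) * exp M).
      - apply Rmult_le_compat.
        + apply Rmult_le_pos; lra.
        + left; apply exp_pos.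
        + apply Rmult_le_compat_l; lra.
        + apply exp_le_mono. nra.
      - assert (exp (- t) <= exp (- (al * t))) by (apply exp_le_mono; nra). nra. }
    apply Rle_trans with (exp (fst kappa * t) * (M * exp M * exp (- (al * t)))).
    + apply Rmult_le_compat_l; [left; apply exp_pos | exact D].
    + replace (exp ((fst kappa - al) * t)) with (exp (fst kappa * t) * exp (- (al * t))) by (rewrite <- exp_plus; f_equal; ring).
      pose proof (exp_pos (fst kappa * t)). pose proof (exp_pos (- (al * t))).
      assert (0 <= exp (fst kappa * t) * exp (- (al * t))) by nra. nra.
Qed.

(** Linear growth is booked as an arbitrarily small exponent [e], so that powers of the logarithm do
    not affect the exponents that matter. *)
Lemma lh_id al L e : al <= 1 -> 0 < L -> 0 < e -> lh al e (fun t => RtoC (t / L)).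
Proof.
  intros Hal HL He. exists (/ L * (/ e + 1)).
  assert (PL := Rinv_0_lt_compat L HL). assert (Pe := Rinv_0_lt_compat e He).
  split.
  - intros t Ht. rewrite Cmod_R, Rabs_pos_eq by (apply Rdiv_le_0_compat; lra).
    unfold Rdiv. rewrite Rmult_comm, Rmult_assoc. apply Rmult_le_compat_l; [lra|].
    pose proof (t_le_exp e t He). pose proof (exp_pos (e * t)). nra.
  - intros t T Ht H1 H2. rewrite <- RtoC_minus, Cmod_R.
    replace (T / L - t / L) with ((T - t) * / L) by (field; lra).
    rewrite Rabs_pos_eq by (apply Rmult_le_pos; lra).
    assert (exp (- t) <= exp ((e - al) * t)) by (apply exp_le_mono; nra).
    pose proof (exp_pos (- t)). rewrite Rmult_comm, Rmult_assoc. apply Rmult_le_compat_l; [lra|]. nra.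
Qed.

Lemma lh_ext al b g h : (forall t, g t = h t) -> lh al b g -> lh al b h.
Proof.
  intros E [C0 [B D]]. exists C0. split.
  - intros t Ht. rewrite <- E. apply B, Ht.
  - intros t T. rewrite <- !E. apply D.
Qed.

Lemma lh_pow al L e k : al <= 1 -> 0 < L -> 0 < e -> lh al (INR k * e) (fun t => RtoC ((t / L) ^ k)).
Proof.
  intros Hal HL He. induction k as [|k IH].
  - simpl. rewrite Rmult_0_l. apply lh_const.
  - rewrite S_INR. replace ((INR k + 1) * e) with (e + INR k * e) by ring.
    apply (lh_ext _ _ (fun t => RtoC (t / L) * RtoC ((t / L) ^ k))%C).
    + intros t. rewrite <- RtoC_mult. reflexivity.
    + apply lh_mult; [apply lh_id; assumption | exact IH].
Qed.

(** * Periodic Hölder continuous functions and the main term *)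

Lemma periodic1_Z Phi : periodic1 Phi -> forall u (n : Z), Phi (u + IZR n) = Phi u.
Proof.
  intros H.
  assert (N : forall u (n : nat), Phi (u + INR n) = Phi u).
  { intros u n; induction n as [|n IH]; [simpl; rewrite Rplus_0_r; reflexivity|].
    rewrite S_INR, <- Rplus_assoc, H. exact IH. }
  intros u n. destruct (Z_le_gt_dec 0 n) as [P|P].
  - rewrite <- (Z2Nat.id n P), <- INR_IZR_INZ. apply N.
  - rewrite <- (N (u + IZR n) (Z.to_nat (- n))). f_equal.
    rewrite INR_IZR_INZ, Z2Nat.id by lia. rewrite opp_IZR. ring.
Qed.

Lemma periodic1_frac Phi u : periodic1 Phi -> Phi (frac_part u) = Phi u.
Proof.
  intros H. unfold frac_part. rewrite <- (periodic1_Z Phi H (u - IZR (Int_part u)) (Int_part u)).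
  f_equal. ring.
Qed.

(** The case x = y suffices because [Rpower] is an exponential and hence positive even at base 0.
    Since [Rpower] does not vanish there, coincident points are treated separately in the estimates
    below. *)
Lemma holder_nonneg alpha Phi K :
  (forall x y, Cmod (Phi x - Phi y)%C <= K * Rpower (Rabs (x - y)) alpha) -> 0 <= K.
Proof.
  intros H. specialize (H 0 0). pose proof (Cmod_ge_0 (Phi 0 - Phi 0)%C).
  assert (0 < Rpower (Rabs (0 - 0)) alpha) by apply exp_pos.
  apply Rnot_lt_le. intros N. nra.
Qed.

Lemma Rpower_le_base a b c : 0 <= c -> 0 < a -> a <= b -> Rpower a c <= Rpower b c.
Proof. intros Hc Ha Hab. apply Rle_Rpower_l; [exact Hc | split; assumption]. Qed.

Lemma holder_bounded alpha Phi : 0 < alpha -> periodic1 Phi -> holder alpha Phi ->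
  exists M, 0 <= M /\ forall u, Cmod (Phi u) <= M.
Proof.
  intros Ha Hp [K HK]. pose proof (holder_nonneg alpha Phi K HK) as K0.
  exists (Cmod (Phi 0) + K). split; [pose proof (Cmod_ge_0 (Phi 0)); lra|].
  intros u. rewrite <- (periodic1_frac Phi u Hp).
  destruct (base_fp u) as [F0 F1]. set (v := frac_part u) in *.
  replace (Phi v) with (Phi 0 + (Phi v - Phi 0))%C by ring.
  eapply Rle_trans; [apply Cmod_triangle|]. apply Rplus_le_compat_l.
  destruct (Req_dec v 0) as [->|N].
  - replace (Phi 0 - Phi 0)%C with (RtoC 0) by ring. rewrite Cmod_0. exact K0.
  - eapply Rle_trans; [apply HK|]. rewrite Rminus_0_r, Rabs_pos_eq by lra.
    rewrite <- (Rmult_1_r K) at 2. apply Rmult_le_compat_l; [exact K0|].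
    replace 1 with (Rpower 1 alpha) by (unfold Rpower; rewrite ln_1, Rmult_0_r; apply exp_0).
    apply Rpower_le_base; lra.
Qed.

Lemma holder_cc alpha Phi : 0 < alpha -> holder alpha Phi -> forall u, cc Phi u.
Proof.
  intros Ha [K HK] u. pose proof (holder_nonneg alpha Phi K HK) as K0.
  apply cc_eps. intros eps He.
  assert (P : 0 < eps / (K + 1)) by (apply Rdiv_lt_0_compat; lra).
  assert (R0 : 0 < Rpower (eps / (K + 1)) (/ alpha)) by apply exp_pos.
  exists (mkposreal _ R0). intros v Hv. change (Rabs (v - u) < Rpower (eps / (K + 1)) (/ alpha)) in Hv.
  destruct (Req_dec v u) as [->|N].
  - replace (Phi u - Phi u)%C with (RtoC 0) by ring. rewrite Cmod_0. exact He.
  - eapply Rle_lt_trans; [apply HK|].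
    assert (A : 0 < Rabs (v - u)) by (apply Rabs_pos_lt; lra).
    assert (B : Rpower (Rabs (v - u)) alpha <= eps / (K + 1)).
    { replace (eps / (K + 1)) with (Rpower (Rpower (eps / (K + 1)) (/ alpha)) alpha).
      - apply Rpower_le_base; lra.
      - rewrite Rpower_mult, Rinv_l, Rpower_1 by lra. reflexivity. }
    apply Rle_lt_trans with (K * (eps / (K + 1))); [apply Rmult_le_compat_l; assumption|].
    apply Rlt_le_trans with ((K + 1) * (eps / (K + 1))); [nra|]. right. field. lra.
Qed.

(** A step of length at most exp(-t) changes Phi(t/L) by O(exp(-al t)), which is the gain of [al]
    over mere boundedness. *)
Lemma lh_holder al Phi L : 0 < al -> 0 < L -> periodic1 Phi -> holder al Phi ->
  lh al 0 (fun t => Phi (t / L)).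
Proof.
  intros Ha HL Hp Hh. destruct (holder_bounded al Phi Ha Hp Hh) as [M [M0 HM]].
  destruct Hh as [K HK]. pose proof (holder_nonneg al Phi K HK) as K0.
  assert (RP : 0 < Rpower (/ L) al) by apply exp_pos.
  exists (M + K * Rpower (/ L) al). split.
  - intros t Ht. rewrite Rmult_0_l, exp_0, Rmult_1_r. specialize (HM (t / L)). nra.
  - intros t T Ht H1 H2.
    assert (P : 0 <= (M + K * Rpower (/ L) al)) by nra.
    destruct (Req_dec T t) as [->|N].
    + replace (Phi (t / L)%R - Phi (t / L)%R)%C with (RtoC 0) by ring. rewrite Cmod_0.
      apply Rmult_le_pos; [exact P | left; apply exp_pos].
    + eapply Rle_trans; [apply HK|].
      assert (PL := Rinv_0_lt_compat L HL).
      replace (T / L - t / L) with ((T - t) * / L) by (field; lra).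
      rewrite Rabs_pos_eq by (apply Rmult_le_pos; lra).
      apply Rle_trans with (K * (Rpower (/ L) al * exp ((0 - al) * t))).
      * apply Rmult_le_compat_l; [exact K0|].
        apply Rle_trans with (Rpower (exp (- t) * / L) al).
        -- apply Rpower_le_base; try lra; [apply Rmult_lt_0_compat; lra|]. apply Rmult_le_compat_r; lra.
        -- right. unfold Rpower. rewrite ln_mult by (try apply exp_pos; assumption). rewrite ln_exp, <- exp_plus. f_equal. ring.
      * rewrite <- Rmult_assoc. apply Rmult_le_compat_r; [left; apply exp_pos | lra].
Qed.

Definition mainterm (kappa : C) (L : R) (Phi : nat -> R -> C) (k : nat) (t : R) : C :=
  (cexp (kappa * RtoC t) * (RtoC ((t / L) ^ k) * Phi k (t / L)%R))%C.

Definition mainsum kappa L Phi m t : C := csum (fun k => mainterm kappa L Phi k t) 0 m.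

Lemma mainterm_lh al kappa L Phi k e : 0 < al -> al <= 1 -> 0 < L -> 0 < e ->
  periodic1 (Phi k) -> holder al (Phi k) -> lh al (fst kappa + INR k * e) (mainterm kappa L Phi k).
Proof.
  intros Ha Ha1 HL He Hp Hh. apply lh_mult; [apply lh_cexp, Ha1|].
  replace (INR k * e) with (INR k * e + 0) by ring.
  apply lh_mult; [apply lh_pow; assumption | apply lh_holder; assumption].
Qed.

Lemma eventually_bound_all (u v : nat -> R) : (forall n, 0 < v n) ->
  (exists C0 N0, forall N, (N0 <= N)%nat -> u N <= C0 * v N) -> exists C1, 0 <= C1 /\ forall N, u N <= C1 * v N.
Proof.
  intros Hv [C0 [N0 H]]. revert C0 H. induction N0 as [|N0 IH]; intros C0 H.
  - exists (Rabs C0). split; [apply Rabs_pos|]. intros N. eapply Rle_trans; [apply H; lia|].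
    apply Rmult_le_compat_r; [left; apply Hv | apply Rle_abs].
  - apply (IH (Rmax C0 (u N0 / v N0))). intros N HN.
    destruct (Nat.eq_dec N N0) as [->|D].
    + apply Rle_trans with (u N0 / v N0 * v N0).
      * right. field. apply Rgt_not_eq, Hv.
      * apply Rmult_le_compat_r; [left; apply Hv | apply Rmax_r].
    + eapply Rle_trans; [apply H; lia|]. apply Rmult_le_compat_r; [left; apply Hv | apply Rmax_l].
Qed.

Lemma cc_scale (F : R -> C) L t : (forall u, cc F u) -> cc (fun t : R => F (t / L)) t.
Proof.
  intros H. apply (cc_comp_R F (fun t => t / L)); [apply H|].
  apply continuous_Rmult; [apply continuous_id | apply continuous_const].
Qed.

Lemma mainterm_cc kappa L Phi k : (forall u, cc (Phi k) u) -> forall t, cc (mainterm kappa L Phi k) t.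
Proof.
  intros H t. apply cc_mult; [apply cc_exp_lin|]. apply cc_mult; [|apply cc_scale, H].
  apply (cc_scale (fun u => RtoC (u ^ k))). intros u. apply cc_RtoC. continuous_by_derive. exact I.
Qed.

Lemma csum_cc {U : UniformSpace} (g : nat -> U -> C) m x : (forall k, (k < m)%nat -> cc (g k) x) ->
  cc (fun t => csum (fun k => g k t) 0 m) x.
Proof.
  intros H; induction m as [|m IH]; simpl; [apply cc_const|].
  apply cc_plus; [apply IH; intros; apply H; lia | apply H; lia].
Qed.

(** Each of the [k] factors t/L is granted the exponent e/(k+1), so together they cost less than
    [e]. *)
Lemma main_lh_small kappa L Phi m al e : 0 < al -> al <= 1 -> 0 < L -> 0 < e ->
  (forall k, (k < m)%nat -> periodic1 (Phi k) /\ holder al (Phi k)) ->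
  lh al (fst kappa + e) (mainsum kappa L Phi m).
Proof.
  intros Ha Ha1 HL He HPhi. apply lh_csum. intros k Hk. destruct (HPhi k Hk) as [Hp Hh].
  assert (P : 0 < INR k + 1) by (pose proof (pos_INR k); lra).
  apply (lh_weaken al (fst kappa + INR k * (e / (INR k + 1)))).
  - apply Rplus_le_compat_l. apply Rle_trans with ((INR k + 1) * (e / (INR k + 1))).
    + apply Rmult_le_compat_r; [apply Rdiv_le_0_compat; lra | lra].
    + right. field. lra.
  - apply mainterm_lh; try assumption. apply Rdiv_lt_0_compat; assumption.
Qed.

(** The summatory function at real [t] equals its value just before the next integer, so the given
    expansion applies there; it remains to carry the main term back from the logarithm of that
    integer to [t]. *)
Lemma err_bound f kappa kappa0 L Phi m al : 0 < L -> al <= 1 -> kappa0 < fst kappa -> fst kappa - kappa0 < al ->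
  (forall k, (k < m)%nat -> periodic1 (Phi k) /\ holder al (Phi k)) ->
  (exists C0 N0, forall N : nat, (N0 <= N)%nat ->
     Cmod (csum f 1 (N - 1) - mainsum kappa L Phi m (ln (INR N)))%C <= C0 * exp (kappa0 * ln (INR N))) ->
  exists C1, expb (fun t => Shat f t - mainsum kappa L Phi m t)%C C1 kappa0.
Proof.
  intros HL Ha1 Hk Hal HPhi Has.
  (* This [e] is positive because the Hölder exponent exceeds Re kappa - kappa0, and it makes the
     exponent of the increments, fst kappa + e - al, equal to [kappa0]. *)
  destruct (main_lh_small kappa L Phi m al (al - (fst kappa - kappa0))) as [C2 [B2 D2]]; try lra; [exact HPhi|].
  destruct (eventually_bound_all (fun N => Cmod (csum f 1 (N - 1) - mainsum kappa L Phi m (ln (INR N)))%C)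
     (fun N => exp (kappa0 * ln (INR N)))) as [C1 [P1 H1]]; [intros; apply exp_pos | exact Has |].
  exists (C1 * exp (Rabs kappa0) + C2). intros t Ht.
  (* The expansion sums over indices below N, so at N = n+1 it describes exactly the sum up to n =
     floor(e^t). *)
  set (n := nfl (exp t)). set (T := ln (INR (S n))).
  pose proof (nfl_bounds (exp t) (Rlt_le _ _ (exp_pos t))) as [F1 F2]. fold n in F1, F2.
  assert (HN : INR (S n) = INR n + 1) by apply S_INR.
  assert (PN : 0 < INR (S n)) by (apply lt_0_INR; lia).
  assert (T1 : t <= T).
  { unfold T. rewrite <- (ln_exp t). left. apply ln_increasing; [apply exp_pos | lra]. }
  assert (T2 : T <= t + exp (- t)).
  (* Here exp(T-t) = (n+1) exp(-t) <= 1 + exp(-t), and 1 + y <= exp(y). *)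
  { assert (E : exp (T - t) <= exp (exp (- t))).
    { unfold Rminus. rewrite exp_plus. unfold T at 1. rewrite exp_ln by exact PN.
      pose proof (exp_pos (- t)). pose proof (exp_ineq1_le (exp (- t))).
      assert (K : exp t * exp (- t) = 1) by (rewrite <- exp_plus, Rplus_opp_r; apply exp_0). nra. }
    destruct (Rle_lt_dec T (t + exp (- t))) as [L1|L1]; [exact L1|].
    assert (exp (exp (- t)) < exp (T - t)) by (apply exp_increasing; lra). lra. }
  assert (E1 : Cmod (Shat f t - mainsum kappa L Phi m T)%C <= C1 * exp (kappa0 * T)).
  { specialize (H1 (S n)). cbv beta in H1. replace (S n - 1)%nat with n in H1 by lia. exact H1. }
  assert (T3 : T <= t + 1) by (pose proof (exp_neg_le_1 t Ht); lra).
  pose proof (exp_near kappa0 t T T1 T3) as E2.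
  specialize (D2 t T Ht T1 T2).
  replace (fst kappa + (al - (fst kappa - kappa0)) - al) with kappa0 in D2 by ring.
  replace (Shat f t - mainsum kappa L Phi m t)%C with
    ((Shat f t - mainsum kappa L Phi m T) + (mainsum kappa L Phi m T - mainsum kappa L Phi m t))%C by ring.
  eapply Rle_trans; [apply Cmod_triangle|]. pose proof (exp_pos (kappa0 * t)). nra.
Qed.

(** * Laplace transforms of periodic functions near a pole *)

(** The truncation at [T] makes integration by parts an exact identity; limits enter only through
    statements valid for all large [T]. *)
Definition pow_lap (k : nat) (Psi : R -> R) (x T : R) : R := RInt (fun t => t ^ k * Psi t * exp (- (x * t))) 0 T.

Lemma pow_le_exp k x t : 0 < x -> 0 <= t ->
  t ^ k <= (2 * (INR k + 1) / x) ^ k * exp (x / 2 * t).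
Proof.
  intros Hx Ht. set (eta := x / (2 * (INR k + 1))). pose proof (pos_INR k) as Pk.
  assert (He : 0 < eta) by (apply Rdiv_lt_0_compat; lra).
  pose proof (t_le_exp eta t He) as B.
  apply Rle_trans with ((/ eta * exp (eta * t)) ^ k); [apply pow_incr; lra|].
  rewrite Rpow_mult_distr. replace (/ eta) with (2 * (INR k + 1) / x) by (unfold eta; field; lra).
  apply Rmult_le_compat_l; [apply pow_le; left; apply Rdiv_lt_0_compat; lra|].
  assert (E : forall n, exp (eta * t) ^ n = exp (INR n * (eta * t))).
  { induction n as [|n IH]; [simpl; rewrite Rmult_0_l, exp_0; reflexivity|].
    rewrite S_INR. simpl. rewrite IH, <- exp_plus. f_equal. ring. }
  rewrite E. apply exp_le_mono. unfold eta.
  replace (x / 2 * t) with ((INR k + 1) * (x / (2 * (INR k + 1)) * t)) by (field; lra).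
  fold eta. assert (0 <= eta * t) by nra. nra.
Qed.

Lemma pow_exp_small k x eps : 0 < x -> 0 < eps ->
  exists T0, 0 <= T0 /\ forall T, T0 <= T -> T ^ k * exp (- (x * T)) < eps.
Proof.
  intros Hx He. set (A := (2 * (INR k + 1) / x) ^ k). pose proof (pos_INR k) as Pk.
  assert (PA : 0 < A) by (apply pow_lt, Rdiv_lt_0_compat; lra).
  destruct (exp_small (x / 2) (eps / A)) as [T0 [H0 HT]]; [lra | apply Rdiv_lt_0_compat; lra |].
  exists T0. split; [exact H0|]. intros T H. specialize (HT T H). apply Rlt_div_r in HT; [|exact PA].
  apply Rle_lt_trans with (A * exp (x / 2 * T) * exp (- (x * T))).
  - apply Rmult_le_compat_r; [left; apply exp_pos|]. apply pow_le_exp; lra.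
  - rewrite Rmult_assoc, <- exp_plus. replace (x / 2 * T + - (x * T)) with (- (x / 2 * T)) by field. lra.
Qed.

Lemma cont_pow_exp k x (t : R) : continuous (fun t => t ^ k * exp (- (x * t))) t.
Proof. continuous_by_derive. exact I. Qed.

Lemma pow_lap_cont k (Psi : R -> R) x (t : R) : (forall t, continuous Psi t) -> continuous (fun t => t ^ k * Psi t * exp (- (x * t))) t.
Proof.
  intros H. apply (continuous_ext (fun t => (t ^ k * exp (- (x * t))) * Psi t)); [intros u; change (@eq R (u ^ k * exp (- (x * u)) * Psi u) (u ^ k * Psi u * exp (- (x * u)))); ring|].
  apply continuous_Rmult; [apply cont_pow_exp | apply H].
Qed.

Lemma pow_lap_ex k (Psi : R -> R) x a b : (forall t, continuous Psi t) -> ex_RInt (fun t => t ^ k * Psi t * exp (- (x * t))) a b.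
Proof. intros H. apply ex_RInt_cont. intros t. apply pow_lap_cont, H. Qed.

(** The factor [0 ^ k] gives the boundary term at 0 for all [k] at once: it is 1 for k = 0 and 0
    otherwise. For k = 0 the value of [pred k] is harmless, since the factor [INR k] vanishes. *)
Lemma pow_lap_parts k (Psi Psi1 : R -> R) x T : (forall t, continuous Psi t) -> (forall t, is_derive Psi1 t (Psi t)) ->
  pow_lap k Psi x T = T ^ k * Psi1 T * exp (- (x * T)) - 0 ^ k * Psi1 0
    + x * pow_lap k Psi1 x T - INR k * pow_lap (pred k) Psi1 x T.
Proof.
  intros HC HD.
  assert (C1 : forall t, continuous Psi1 t).
  { intros t. apply (ex_derive_continuous (K := R_AbsRing) (V := RN)). exists (Psi t). apply HD. }
  set (df := fun t => t ^ k * Psi t * exp (- (x * t)) + ((- x) * (t ^ k * Psi1 t * exp (- (x * t)))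
     + INR k * (t ^ pred k * Psi1 t * exp (- (x * t))))).
  assert (H : is_RInt df 0 T (minus ((fun t => t ^ k * Psi1 t * exp (- (x * t))) T) ((fun t => t ^ k * Psi1 t * exp (- (x * t))) 0))).
  { apply (is_RInt_derive (V := RC) (fun t => t ^ k * Psi1 t * exp (- (x * t)))).
    - intros t _. unfold df.
      assert (E := HD t). auto_derive.
      + exists (Psi t); exact E.
      + replace (Derive (fun x0 : R => Psi1 x0) t) with (Psi t) by (symmetry; apply is_derive_unique, E). ring.
    - intros t _. unfold df. apply continuous_Rplus; [apply pow_lap_cont, HC|].
      apply continuous_Rplus; apply continuous_Rmult;
        try apply continuous_const; apply pow_lap_cont, C1. }
  apply (is_RInt_unique (V := RC)) in H. unfold df in H.
  rewrite (RInt_plus (V := RC)) in H.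
  2: apply pow_lap_ex, HC.
  2: apply (ex_RInt_plus (V := RN)); apply (ex_RInt_scal (V := RN)), pow_lap_ex, C1.
  rewrite (RInt_plus (V := RC)) in H.
  2: apply (ex_RInt_scal (V := RN)), pow_lap_ex, C1.
  2: apply (ex_RInt_scal (V := RN)), pow_lap_ex, C1.
  rewrite (RInt_scal (V := RC) (fun t => t ^ k * Psi1 t * exp (- (x * t)))) in H by apply pow_lap_ex, C1.
  rewrite (RInt_scal (V := RC) (fun t => t ^ pred k * Psi1 t * exp (- (x * t)))) in H by apply pow_lap_ex, C1.
  fold (pow_lap k Psi x T) (pow_lap k Psi1 x T) (pow_lap (pred k) Psi1 x T) in H.
  rewrite Rmult_0_r, Ropp_0, exp_0 in H.
  unfold plus, minus, opp, scal in H; simpl in H. unfold mult, plus in H; simpl in H. lra.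
Qed.

Lemma pow_lap_1 k x eps : 0 < x -> 0 < eps ->
  exists T0, forall T, T0 <= T -> Rabs (pow_lap k (fun _ => 1) x T - INR (fact k) / x ^ S k) < eps.
Proof.
  intros Hx. revert eps.
  (* Integration by parts for the pair Psi = 0, Psi1 = 1: the left side vanishes, and the identity
     can be solved for the transform of t^k. *)
  assert (Rec : forall k T, pow_lap k (fun _ => 1) x T = (INR k * pow_lap (pred k) (fun _ => 1) x T + 0 ^ k - T ^ k * exp (- (x * T))) / x).
  { intros j T.
    assert (P := pow_lap_parts j (fun _ => 0) (fun _ => 1) x T).
    assert (Z : pow_lap j (fun _ => 0) x T = 0).
    { unfold pow_lap. rewrite (RInt_ext _ (fun _ => 0)) by (intros t _; change (@eq R (t ^ j * 0 * exp (- (x * t))) 0); ring). rewrite RInt_const. unfold scal; simpl. unfold mult; simpl. ring. }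
    rewrite Z in P.
    assert (P' := P (fun t => continuous_const 0 t) (fun t => is_derive_const 1 t)).
    set (u := pow_lap j (fun _ => 1) x T) in *. set (v := pow_lap (pred j) (fun _ => 1) x T) in *.
    apply Rmult_eq_reg_l with x; [|lra]. field_simplify; lra. }
  induction k as [|k IH]; intros eps He.
  - destruct (pow_exp_small 0 x (eps * x) Hx) as [T0 [_ HT]]; [nra|].
    exists T0. intros T H. specialize (HT T H). rewrite Rec. simpl in *.
    replace ((0 * pow_lap 0 (fun _ => 1) x T + 1 - 1 * exp (- (x * T))) / x - 1 / (x * 1)) with (- (exp (- (x * T)) / x)) by (field; lra).
    rewrite Rabs_Ropp, Rabs_pos_eq.
    + apply Rlt_div_l; lra.
    + apply Rdiv_le_0_compat; [left; apply exp_pos | exact Hx].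
  - pose proof (pos_INR (S k)) as Pk.
    destruct (IH (eps * x / (2 * (INR (S k) + 1)))) as [T1 H1]; [apply Rdiv_lt_0_compat; nra|].
    destruct (pow_exp_small (S k) x (eps * x / 2) Hx) as [T0 [H00 HT]]; [nra|].
    exists (Rmax T0 T1). intros T H.
    specialize (HT T (Rle_trans _ _ _ (Rmax_l _ _) H)). specialize (H1 T (Rle_trans _ _ _ (Rmax_r _ _) H)).
    assert (H0T : 0 <= T) by (eapply Rle_trans; [exact H00 | eapply Rle_trans; [apply Rmax_l | exact H]]).
    rewrite Rec. cbn [pred]. rewrite pow_i by lia.
    set (v := pow_lap k (fun _ => 1) x T) in *. set (w := T ^ S k * exp (- (x * T))) in *.
    assert (W0 : 0 <= w) by (apply Rmult_le_pos; [apply pow_le, H0T | left; apply exp_pos]).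
    assert (X0 : x ^ k <> 0) by (apply pow_nonzero; lra).
    replace ((INR (S k) * v + 0 - w) / x - INR (fact (S k)) / x ^ S (S k)) with
      ((INR (S k) * (v - INR (fact k) / x ^ S k) - w) / x).
    2:{ rewrite fact_simpl, mult_INR. simpl pow. field. split; [exact X0 | lra]. }
    unfold Rdiv at 1. rewrite Rabs_mult, (Rabs_pos_eq (/ x)) by (left; apply Rinv_0_lt_compat, Hx).
    apply Rlt_div_l; [exact Hx|].
    apply Rle_lt_trans with (INR (S k) * Rabs (v - INR (fact k) / x ^ S k) + w).
    + unfold Rminus at 1. eapply Rle_trans; [apply Rabs_triang|].
      rewrite Rabs_mult, (Rabs_pos_eq (INR (S k))), Rabs_Ropp, (Rabs_pos_eq w) by assumption. lra.
    + assert (Q : (INR (S k) + 1) * (eps * x / (2 * (INR (S k) + 1))) = eps * x / 2) by (field; lra).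
      assert (Q0 : 0 < eps * x / (2 * (INR (S k) + 1))) by (apply Rdiv_lt_0_compat; nra).
      assert (INR (S k) * Rabs (v - INR (fact k) / x ^ S k) <= INR (S k) * (eps * x / (2 * (INR (S k) + 1)))) by (apply Rmult_le_compat_l; lra).
      nra.
Qed.

Definition perL (L : R) (Psi : R -> R) : Prop :=
  (forall t, continuous Psi t) /\ (forall t, Psi (t + L) = Psi t).

Lemma perL_ex L Psi a b : perL L Psi -> ex_RInt Psi a b.
Proof. intros [H _]. apply ex_RInt_cont. intros. apply H. Qed.

Lemma perL_shift L Psi t : perL L Psi -> RInt Psi t (t + L) = RInt Psi 0 L.
Proof.
  intros H. pose proof (perL_ex L Psi) as E.
  assert (S : RInt Psi L (t + L) = RInt Psi 0 t).
  { pose proof (RInt_comp_lin (V := RC) Psi 1 L 0 t (E _ _ H)) as P.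
    replace (1 * 0 + L) with L in P by ring. replace (1 * t + L) with (t + L) in P by ring.
    rewrite <- P. apply RInt_ext. intros y _. unfold scal; simpl. unfold mult; simpl.
    rewrite !Rmult_1_l. apply H. }
  pose proof (RInt_Chasles (V := RC) Psi 0 t (t + L) (E _ _ H) (E _ _ H)) as A.
  pose proof (RInt_Chasles (V := RC) Psi 0 L (t + L) (E _ _ H) (E _ _ H)) as B.
  unfold plus in A, B; simpl in A, B. lra.
Qed.

Lemma perL_bounded L Psi : 0 < L -> perL L Psi -> exists M, 0 <= M /\ forall t, 0 <= t -> Rabs (Psi t) <= M.
Proof.
  intros HL [HC HP].
  destruct (bounded_continuity (V := RN) Psi 0 L) as [M HM]; [intros; apply HC|].
  assert (M0 : 0 <= M).
  { pose proof (HM 0 ltac:(lra)). change (Rabs (Psi 0) < M) in H. pose proof (Rabs_pos (Psi 0)). lra. }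
  exists M. split; [exact M0|].
  assert (H : forall n t, 0 <= t <= INR n * L -> Rabs (Psi t) <= M).
  { induction n as [|n IH]; intros t Ht.
    - simpl in Ht. left. apply (HM t). lra.
    - rewrite S_INR in Ht. destruct (Rle_dec t L) as [D|D]; [left; apply (HM t); lra|].
      replace t with (t - L + L) by ring. rewrite HP. apply IH. lra. }
  intros t Ht. destruct (nfloor_ex (t / L)) as [n Hn]; [apply Rdiv_le_0_compat; lra|].
  apply (H (S n)). rewrite S_INR. split; [exact Ht|]. left. apply Rlt_div_l; lra.
Qed.

(** Mean zero is exactly what makes the primitive periodic; subtracting its own mean [c] restores
    mean zero, so that the construction can be iterated. *)
Lemma perL_primitive L Psi : 0 < L -> perL L Psi -> RInt Psi 0 L = 0 ->
  exists Psi1, (forall t, is_derive Psi1 t (Psi t)) /\ perL L Psi1 /\ RInt Psi1 0 L = 0.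
Proof.
  intros HL H Z.
  set (P := fun t => RInt Psi 0 t).
  assert (DP : forall t, is_derive P t (Psi t)).
  { intros t. apply (is_derive_RInt (V := RN) Psi P 0 t).
    - apply filter_forall. intros u. apply (RInt_correct (V := RC)), (perL_ex L Psi 0 u H).
    - apply H. }
  assert (CP : forall t, continuous P t).
  { intros t. apply (ex_derive_continuous (K := R_AbsRing) (V := RN)). exists (Psi t). apply DP. }
  set (c := RInt P 0 L / L).
  exists (fun t => P t - c). split; [|split; [split|]].
  - intros t. replace (Psi t) with (minus (Psi t) zero) by (unfold minus, plus, opp, zero; simpl; ring).
    apply (is_derive_minus (V := RN) P (fun _ => c)); [apply DP | apply (is_derive_const (V := RN))].
  - intros t. apply continuous_Rminus; [apply CP | apply continuous_const].
  - intros t. f_equal. unfold P.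
    pose proof (RInt_Chasles (V := RC) Psi 0 t (t + L) (perL_ex L Psi _ _ H) (perL_ex L Psi _ _ H)) as A.
    rewrite (perL_shift L Psi t H), Z in A. unfold plus in A; simpl in A. lra.
  - rewrite (RInt_minus (V := RC) P (fun _ => c)).
    + rewrite RInt_const. unfold minus, plus, opp, scal; simpl. unfold mult; simpl. unfold c. field. lra.
    + apply ex_RInt_cont. intros. apply CP.
    + apply ex_RInt_const.
Qed.

(** Half of the decay exp(-xt) absorbs t^k at a cost of order x^(-k); integrating the other half
    costs a further x^(-1). *)
Lemma pow_lap_crude L k Psi : 0 < L -> perL L Psi ->
  exists K, forall x, 0 < x -> forall T, 0 <= T -> x ^ S k * Rabs (pow_lap k Psi x T) <= K.
Proof.
  intros HL H. destruct (perL_bounded L Psi HL H) as [M [M0 HM]]. pose proof (pos_INR k) as Pk.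
  exists ((2 * (INR k + 1)) ^ k * M * 2). intros x Hx T HT.
  set (A := (2 * (INR k + 1) / x) ^ k).
  assert (PA : 0 < A) by (apply pow_lt, Rdiv_lt_0_compat; lra).
  assert (Hx2 : 0 < x / 2) by lra.
  pose proof (RInt_exp (A * M) (x / 2) 0 T Hx2) as HR.
  assert (B : Rabs (pow_lap k Psi x T) <= A * M / (x / 2)).
  { unfold pow_lap. eapply Rle_trans; [apply abs_RInt_le; [exact HT | apply pow_lap_ex, H]|].
    eapply Rle_trans; [apply (RInt_le _ (fun t => A * M * exp (- (x / 2 * t)))); [exact HT | | eexists; exact HR |]|].
    - apply (ex_RInt_continuous (V := RC)). intros t _.
      apply (continuous_comp _ Rabs); [apply pow_lap_cont, H | apply continuous_Rabs].
    - intros t Ht. rewrite !Rabs_mult, (Rabs_pos_eq (exp _)) by (left; apply exp_pos).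
      rewrite (Rabs_pos_eq (t ^ k)) by (apply pow_le; lra).
      replace (exp (- (x / 2 * t))) with (exp (x / 2 * t) * exp (- (x * t))) by (rewrite <- exp_plus; f_equal; field).
      rewrite <- Rmult_assoc. apply Rmult_le_compat_r; [left; apply exp_pos|].
      replace (A * M * exp (x / 2 * t)) with (A * exp (x / 2 * t) * M) by ring.
      apply Rmult_le_compat; [apply pow_le; lra | apply Rabs_pos | apply pow_le_exp; lra | apply HM; lra].
    - rewrite (is_RInt_unique _ _ _ _ HR). rewrite Rmult_0_r, Ropp_0, exp_0.
      assert (0 <= A * M / (x / 2)) by (apply Rdiv_le_0_compat; nra).
      pose proof (exp_pos (- (x / 2 * T))). nra. }
  apply Rle_trans with (x ^ S k * (A * M / (x / 2))).
  - apply Rmult_le_compat_l; [apply pow_le; lra | exact B].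
  - right. replace A with ((2 * (INR k + 1)) ^ k / x ^ k)
      by (unfold A, Rdiv; rewrite (Rpow_mult_distr (2 * (INR k + 1)) (/ x)), pow_inv; reflexivity).
    simpl. field. split; [apply pow_nonzero; lra | lra].
Qed.

(* Each integration by parts against a mean-zero primitive trades one power of x for either
   another factor x or a lower power of t; starting from the crude bound x^(k+1) this removes all powers. *)
Lemma pow_lap_bounded L : 0 < L -> forall k d j Psi, (j + d = S k)%nat -> perL L Psi -> RInt Psi 0 L = 0 ->
  exists K, forall x, 0 < x <= 1 -> exists T0, forall T, T0 <= T -> x ^ j * Rabs (pow_lap k Psi x T) <= K.
Proof.
  intros HL.
  (* [d] counts the powers of x already removed, d = 0 being the crude bound. After integration by
     parts the term with the factor x falls under the induction on [d], the one with a lower power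
     of t under the induction on [k]. *)
  assert (Main : forall k, (forall i, (i < k)%nat -> forall d j Psi, (j + d = S i)%nat -> perL L Psi -> RInt Psi 0 L = 0 ->
      exists K, forall x, 0 < x <= 1 -> exists T0, forall T, T0 <= T -> x ^ j * Rabs (pow_lap i Psi x T) <= K) ->
    forall d j Psi, (j + d = S k)%nat -> perL L Psi -> RInt Psi 0 L = 0 ->
      exists K, forall x, 0 < x <= 1 -> exists T0, forall T, T0 <= T -> x ^ j * Rabs (pow_lap k Psi x T) <= K).
  2:{ intros k. induction k as [k IH] using lt_wf_ind. apply Main. exact IH. }
  intros k IHk d. induction d as [|d IHd]; intros j Psi Hj HP Z.
  - destruct (pow_lap_crude L k Psi HL HP) as [K HK]. exists K. intros x Hx. exists 0. intros T HT.
    replace j with (S k) by lia. apply HK; lra.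
  - destruct (perL_primitive L Psi HL HP Z) as [Psi1 [D1 [P1 Z1]]].
    destruct (perL_bounded L Psi1 HL P1) as [M [M0 HM]].
    destruct (IHd (S j) Psi1 ltac:(lia) P1 Z1) as [K1 HK1].
    assert (Third : exists K2, forall x, 0 < x <= 1 -> exists T0, forall T, T0 <= T ->
              x ^ j * (INR k * Rabs (pow_lap (pred k) Psi1 x T)) <= K2).
    { destruct k as [|k'].
      - exists 0. intros x Hx. exists 0. intros T HT. simpl INR. lra.
      - destruct (IHk k' ltac:(lia) d j Psi1 ltac:(lia) P1 Z1) as [K2 HK2].
        exists (INR (S k') * K2). intros x Hx. destruct (HK2 x Hx) as [T0 HT0]. exists T0. intros T HT.
        specialize (HT0 T HT). simpl pred. pose proof (pos_INR (S k')).
        replace (x ^ j * (INR (S k') * Rabs (pow_lap k' Psi1 x T))) with (INR (S k') * (x ^ j * Rabs (pow_lap k' Psi1 x T))) by ring.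
        apply Rmult_le_compat_l; assumption. }
    destruct Third as [K2 HK2].
    exists (M + M + K1 + K2). intros x Hx.
    destruct (HK1 x Hx) as [T1 H1]. destruct (HK2 x Hx) as [T2 H2].
    destruct (pow_exp_small k x 1 ltac:(lra) Rlt_0_1) as [T3 [H30 H3]].
    exists (Rmax T3 (Rmax T1 T2)). intros T HT.
    assert (A3 : T3 <= T) by (eapply Rle_trans; [apply Rmax_l | exact HT]).
    assert (A12 : Rmax T1 T2 <= T) by (eapply Rle_trans; [apply Rmax_r | exact HT]).
    specialize (H1 T (Rle_trans _ _ _ (Rmax_l _ _) A12)). specialize (H2 T (Rle_trans _ _ _ (Rmax_r _ _) A12)).
    specialize (H3 T A3).
    rewrite (pow_lap_parts k Psi Psi1 x T (proj1 HP) D1).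
    assert (X1 : 0 <= x ^ j <= 1) by (split; [apply pow_le; lra | rewrite <- (pow1 j); apply pow_incr; lra]).
    set (u1 := T ^ k * Psi1 T * exp (- (x * T))). set (u2 := 0 ^ k * Psi1 0).
    assert (U1 : Rabs u1 <= M).
    { unfold u1. rewrite !Rabs_mult, (Rabs_pos_eq (exp _)), (Rabs_pos_eq (T ^ k)) by (try apply pow_le; try (left; apply exp_pos); lra).
      specialize (HM T ltac:(lra)). pose proof (Rabs_pos (Psi1 T)).
      assert (0 <= T ^ k * exp (- (x * T))) by (apply Rmult_le_pos; [apply pow_le; lra | left; apply exp_pos]).
      replace (T ^ k * Rabs (Psi1 T) * exp (- (x * T))) with (T ^ k * exp (- (x * T)) * Rabs (Psi1 T)) by ring. nra. }
    assert (U2 : Rabs u2 <= M).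
    { unfold u2. specialize (HM 0 (Rle_refl 0)). rewrite Rabs_mult. destruct k; simpl.
      - rewrite Rabs_R1. lra.
      - rewrite Rmult_0_l, Rabs_R0. lra. }
    set (J1 := pow_lap k Psi1 x T) in *. set (J2 := pow_lap (pred k) Psi1 x T) in *.
    assert (Tri : Rabs (u1 - u2 + x * J1 - INR k * J2) <= M + M + x * Rabs J1 + INR k * Rabs J2).
    { unfold Rminus. eapply Rle_trans; [apply Rabs_triang|]. rewrite Rabs_Ropp, Rabs_mult, (Rabs_pos_eq (INR k)) by apply pos_INR.
      apply Rplus_le_compat_r. eapply Rle_trans; [apply Rabs_triang|]. rewrite Rabs_mult, (Rabs_pos_eq x) by lra.
      apply Rplus_le_compat_r. eapply Rle_trans; [apply Rabs_triang|]. rewrite Rabs_Ropp. lra. }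
    apply Rle_trans with (x ^ j * (M + M + x * Rabs J1 + INR k * Rabs J2)); [apply Rmult_le_compat_l; lra|].
    simpl in H1. replace (x ^ j * (M + M + x * Rabs J1 + INR k * Rabs J2)) with
      (x ^ j * (M + M) + x * x ^ j * Rabs J1 + x ^ j * (INR k * Rabs J2)) by ring. nra.
Qed.

Lemma cexp_2pi_Z (l : Z) : cexp (0, 2 * PI * IZR l) = RtoC 1.
Proof.
  assert (N : forall n : nat, cexp (0, 2 * PI * INR n) = RtoC 1).
  { intros n. unfold cexp, Re, Im; simpl. rewrite exp_0.
    replace (2 * PI * INR n) with (0 + 2 * INR n * PI) by ring. rewrite cos_period, sin_period, cos_0, sin_0.
    apply injective_projections; simpl; ring. }
  destruct (Z_le_gt_dec 0 l) as [P|P].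
  - rewrite <- (Z2Nat.id l P), <- INR_IZR_INZ. apply N.
  - specialize (N (Z.to_nat (- l))). rewrite INR_IZR_INZ, Z2Nat.id, opp_IZR in N by lia.
    rewrite <- (cexp_opp (0, 2 * PI * IZR l)).
    replace (- (0, (2 * PI * IZR l)%R))%C with ((0, 2 * PI * - IZR l) : C).
    + rewrite N. ring.
    + apply injective_projections; simpl; ring.
Qed.

Definition twist (L : R) (F : R -> C) (l : Z) (t : R) : C :=
  (F (t / L)%R * cexp (- (0, 2 * PI * IZR l / L)%R * RtoC t))%C.

(* The l-th Fourier coefficient of F, written over a period of t = L u. *)
Definition mean (L : R) (F : R -> C) (l : Z) : C := (RtoC (/ L) * CI (twist L F l) 0 L)%C.

Lemma twist_per L F l t : 0 < L -> periodic1 F -> twist L F l (t + L) = twist L F l t.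
Proof.
  intros HL HF. unfold twist. replace ((t + L) / L) with (t / L + 1) by (field; lra). rewrite HF. f_equal.
  rewrite RtoC_plus, Cmult_plus_distr_l, cexp_plus.
  replace (- (0, (2 * PI * IZR l / L)%R) * RtoC L)%C with ((0, 2 * PI * IZR (- l)) : C).
  - rewrite cexp_2pi_Z. ring.
  - rewrite opp_IZR. apply injective_projections; simpl; field; lra.
Qed.

Lemma twist_cc L F l t : (forall u, cc F u) -> cc (twist L F l) t.
Proof. intros H. apply cc_mult; [apply cc_scale, H | apply cc_exp_lin]. Qed.

Lemma perL_component L F l (pr : C -> R) c : 0 < L -> periodic1 F ->
  (forall t, continuous (fun t => pr (twist L F l t)) t) -> c = RInt (fun t => pr (twist L F l t)) 0 L / L ->
  perL L (fun t => pr (twist L F l t) - c) /\ RInt (fun t => pr (twist L F l t) - c) 0 L = 0.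
Proof.
  intros HL HF HC Hc. split; [split|].
  - intros t. apply continuous_Rminus; [apply HC | apply continuous_const].
  - intros t. rewrite twist_per by assumption. reflexivity.
  - rewrite (RInt_minus (V := RC) (fun t => pr (twist L F l t)) (fun _ => c)).
    + rewrite RInt_const, Hc. unfold minus, plus, opp, scal; simpl. unfold mult; simpl. field. lra.
    + apply ex_RInt_cont. intros. apply HC.
    + apply ex_RInt_const.
Qed.

Lemma mainterm_twist kappa L Phi k l (x t : R) : 0 < L ->
  (mainterm kappa L Phi k t * cexp (- (kappa + (0, (2 * PI * IZR l / L)%R) + RtoC x) * RtoC t))%C =
  (RtoC (/ L ^ k) * (RtoC (t ^ k * exp (- (x * t))) * twist L (Phi k) l t))%C.
Proof.
  intros HL. unfold mainterm, twist.
  replace (- (kappa + (0, (2 * PI * IZR l / L)%R) + RtoC x) * RtoC t)%C with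
    (- (kappa * RtoC t) + ((- (0, (2 * PI * IZR l / L)%R) * RtoC t) + RtoC (- (x * t))))%C.
  2:{ rewrite RtoC_opp, RtoC_mult. ring. }
  rewrite !cexp_plus.
  assert (E : cexp (RtoC (- (x * t))) = RtoC (exp (- (x * t)))).
  { unfold cexp, Re, Im; simpl. rewrite cos_0, sin_0. apply injective_projections; simpl; ring. }
  rewrite E. pose proof (cexp_opp (kappa * RtoC t)) as K.
  replace ((t / L) ^ k) with (/ L ^ k * t ^ k) by (unfold Rdiv; rewrite Rpow_mult_distr, pow_inv; ring).
  rewrite !RtoC_mult.
  set (a := cexp (kappa * RtoC t)) in *. set (b := cexp (- (kappa * RtoC t))) in *.
  set (c := cexp (- (0, (2 * PI * IZR l / L)%R) * RtoC t)).
  transitivity ((b * a) * (RtoC (/ L ^ k) * (RtoC (t ^ k) * RtoC (exp (- (x * t))) * (Phi k (t / L)%R * c))))%C.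
  - ring.
  - rewrite K. ring.
Qed.

Lemma pole_term kappa L Phi k l : 0 < L -> periodic1 (Phi k) -> (forall u, cc (Phi k) u) ->
  (forall e, 0 < e -> exists C0, expb (mainterm kappa L Phi k) C0 (fst kappa + e)) ->
  exists K, forall x, 0 < x <= 1 ->
    Cmod (Lap (mainterm kappa L Phi k) (kappa + (0, (2 * PI * IZR l / L)%R) + RtoC x)
          - RtoC (INR (fact k) / (L ^ k * x ^ S k)) * mean L (Phi k) l)%C <= K.
Proof.
  intros HL HP HC HB. set (F := Phi k) in *. set (phi := mean L F l).
  assert (PLk : 0 < L ^ k) by (apply pow_lt, HL).
  destruct (perL_component L F l fst (fst phi) HL HP) as [P1 Z1].
  { intros t. apply (twist_cc L F l t HC). }
  { unfold phi, mean, CI; simpl. field. lra. }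
  destruct (perL_component L F l snd (snd phi) HL HP) as [P2 Z2].
  { intros t. apply (twist_cc L F l t HC). }
  { unfold phi, mean, CI; simpl. field. lra. }
  set (Psi1 := fun t => fst (twist L F l t) - fst phi) in *.
  set (Psi2 := fun t => snd (twist L F l t) - snd phi) in *.
  (* Taking j = 0 removes all powers of x: the mean-zero part stays bounded as x tends to 0. *)
  destruct (pow_lap_bounded L HL k (S k) 0 Psi1 (eq_refl _) P1 Z1) as [K1 H1].
  destruct (pow_lap_bounded L HL k (S k) 0 Psi2 (eq_refl _) P2 Z2) as [K2 H2].
  exists (/ L ^ k * (K1 + K2)). intros x Hx.
  set (s := (kappa + (0, (2 * PI * IZR l / L)%R) + RtoC x)%C).
  assert (Hs : fst s = fst kappa + x) by (unfold s; simpl; ring).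
  destruct (HB (x / 2)) as [C0 HC0]; [lra|].
  assert (Lc : loci (mainterm kappa L Phi k)) by (apply loci_cc; intros t; apply mainterm_cc, HC).
  pose proof (Lap_spec _ C0 (fst kappa + x / 2) s Lc HC0 ltac:(rewrite Hs; lra)) as HL0.
  set (lap := Lap (mainterm kappa L Phi k) s) in *.
  apply le_epsilon. intros eps He.
  destruct (HL0 (eps / 2)) as [T1 HT1]; [lra|].
  assert (PP : 0 < / L ^ k * (Cmod phi + 1)).
  { apply Rmult_lt_0_compat; [apply Rinv_0_lt_compat, PLk | pose proof (Cmod_ge_0 phi); lra]. }
  destruct (pow_lap_1 k x (eps / 2 / (/ L ^ k * (Cmod phi + 1)))) as [T2 HT2]; [lra | apply Rdiv_lt_0_compat; lra |].
  destruct (H1 x Hx) as [T3 HT3]. destruct (H2 x Hx) as [T4 HT4].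
  set (T := Rmax (Rmax T1 T2) (Rmax T3 T4)).
  specialize (HT1 T (Rle_trans _ _ _ (Rmax_l _ _) (Rmax_l _ _))).
  specialize (HT2 T (Rle_trans _ _ _ (Rmax_r _ _) (Rmax_l _ _))).
  specialize (HT3 T (Rle_trans _ _ _ (Rmax_l _ _) (Rmax_r _ _))).
  specialize (HT4 T (Rle_trans _ _ _ (Rmax_r _ _) (Rmax_r _ _))).
  simpl pow in HT3, HT4. rewrite Rmult_1_l in HT3, HT4.
  assert (E : CI (fun t => mainterm kappa L Phi k t * cexp (- s * RtoC t))%C 0 T =
    (RtoC (/ L ^ k) * (RtoC (pow_lap k (fun _ => 1%R) x T) * phi + (pow_lap k Psi1 x T, pow_lap k Psi2 x T)))%C).
  { rewrite (CI_ext _ (fun t => RtoC (/ L ^ k) * (phi * RtoC (t ^ k * 1 * exp (- (x * t)))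
        + (t ^ k * Psi1 t * exp (- (x * t)), t ^ k * Psi2 t * exp (- (x * t)))%R))%C).
    2:{ intros t _. unfold s. rewrite mainterm_twist by exact HL. f_equal. fold F.
        replace (twist L F l t) with (phi + (Psi1 t, Psi2 t))%C.
        - rewrite Rmult_1_r. apply injective_projections; simpl; ring.
        - unfold Psi1, Psi2. apply injective_projections; simpl; ring. }
    assert (I1 : cint (fun t => RtoC (t ^ k * 1 * exp (- (x * t)))) 0 T).
    { split; simpl; [apply (pow_lap_ex k (fun _ => 1)); intros; apply continuous_const | apply ex_RInt_const]. }
    assert (I2 : cint (fun t => (t ^ k * Psi1 t * exp (- (x * t)), t ^ k * Psi2 t * exp (- (x * t)))) 0 T).
    { split; simpl; apply pow_lap_ex; [apply P1 | apply P2]. }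
    rewrite CI_mult_const by (apply cint_plus; [apply cint_mult_const, I1 | exact I2]).
    rewrite (CI_plus (fun t => phi * RtoC (t ^ k * 1 * exp (- (x * t))))%C) by (first [exact I2 | apply cint_mult_const, I1]).
    rewrite CI_mult_const by exact I1. f_equal. f_equal.
    rewrite Cmult_comm. f_equal. unfold CI; simpl. rewrite RInt_const. unfold pow_lap, RtoC. f_equal.
    unfold scal; simpl. unfold mult; simpl. ring. }
  rewrite E in HT1.
  set (J := pow_lap k (fun _ => 1) x T) in *. set (J1 := pow_lap k Psi1 x T) in *. set (J2 := pow_lap k Psi2 x T) in *.
  assert (Xk : x ^ S k <> 0) by (apply pow_nonzero; lra).
  replace (lap - RtoC (INR (fact k) / (L ^ k * x ^ S k)) * phi)%C with
    (- (RtoC (/ L ^ k) * (RtoC J * phi + (J1, J2)) - lap) +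
      (RtoC (/ L ^ k) * (RtoC (J - INR (fact k) / x ^ S k) * phi) + RtoC (/ L ^ k) * (J1, J2)))%C.
  2:{ replace (INR (fact k) / (L ^ k * x ^ S k)) with (/ L ^ k * (INR (fact k) / x ^ S k)) by (field; split; lra).
      rewrite RtoC_mult, RtoC_minus. ring. }
  eapply Rle_trans; [apply Cmod_triangle|]. rewrite Cmod_opp.
  eapply Rle_trans; [apply Rplus_le_compat_l, Cmod_triangle|]. rewrite !Cmod_mult, !Cmod_R.
  rewrite (Rabs_pos_eq (/ L ^ k)) by (left; apply Rinv_0_lt_compat, PLk).
  pose proof (Rinv_0_lt_compat _ PLk) as Pinv. pose proof (Cmod_ge_0 phi) as Pphi.
  assert (B3 : Cmod (J1, J2) <= K1 + K2).
  { eapply Rle_trans; [apply Cmod_le_abs|]. simpl. lra. }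
  assert (B2 : / L ^ k * (Rabs (J - INR (fact k) / x ^ S k) * Cmod phi) <= eps / 2).
  { apply Rlt_div_r in HT2; [|exact PP]. pose proof (Rabs_pos (J - INR (fact k) / x ^ S k)).
    apply Rle_trans with (Rabs (J - INR (fact k) / x ^ S k) * (/ L ^ k * (Cmod phi + 1))); [|lra].
    assert (0 <= Rabs (J - INR (fact k) / x ^ S k) * / L ^ k) by nra. nra. }
  assert (B4 : / L ^ k * Cmod (J1, J2) <= / L ^ k * (K1 + K2)) by (apply Rmult_le_compat_l; lra).
  lra.
Qed.

(** * Pointwise convergence of Fourier series *)

(** A shift by the half-period [tau] reverses the sign of the sine. Twice the integral is therefore
    the integral of (H(w) - H(w+tau)) times the sine, small by uniform continuity, plus two end
    pieces of length [tau]. The margin 1/3 beyond [b] leaves room for the shift. *)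
Lemma riemann_lebesgue (H : R -> R) a b : a <= b -> (forall w, a <= w <= b + / 3 -> continuous H w) ->
  forall eps, 0 < eps -> exists N, forall n, (N <= n)%nat ->
    Rabs (RInt (fun w => H w * sin ((2 * INR n + 1) * PI * w)) a b) < eps.
Proof.
  intros Hab HC eps He.
  destruct (bounded_continuity (V := RN) H a (b + / 3)) as [M HM]; [intros; apply HC; assumption|].
  assert (M0 : 0 <= M).
  { pose proof (HM a ltac:(lra)) as B. change (Rabs (H a) < M) in B. pose proof (Rabs_pos (H a)). lra. }
  assert (HB : forall w, a <= w <= b + / 3 -> Rabs (H w) <= M) by (intros w Hw; left; apply (HM w Hw)).
  assert (He' : 0 < eps / (b - a + 1)) by (apply Rdiv_lt_0_compat; lra).
  destruct (Heine_cor2 (f := H) (a := a) (b := b + / 3)) with (eps := mkposreal _ He') as [d Hd].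
  { intros x Hx. apply continuity_pt_filterlim, HC, Hx. }
  (* The three thresholds put [tau] below the modulus of continuity [d] and below the margin 1/3,
     and make 2 M tau < eps. *)
  destruct (nfloor_ex (Rmax (/ d) (Rmax 3 (2 * M / eps))) ) as [N [_ HN]].
  { eapply Rle_trans; [|apply Rmax_l]. left. apply Rinv_0_lt_compat, cond_pos. }
  exists (S N). intros n Hn. set (om := (2 * INR n + 1) * PI). set (tau := / (2 * INR n + 1)).
  apply le_INR in Hn. rewrite S_INR in Hn.
  pose proof (Rmax_l (/ d) (Rmax 3 (2 * M / eps))) as X1. pose proof (Rmax_r (/ d) (Rmax 3 (2 * M / eps))) as X2.
  pose proof (Rmax_l 3 (2 * M / eps)) as X3. pose proof (Rmax_r 3 (2 * M / eps)) as X4.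
  assert (B1 : / d < INR n) by lra. assert (B2 : 3 < INR n) by lra. assert (B3 : 2 * M / eps < INR n) by lra.
  assert (Dp := cond_pos d).
  assert (T0 : 0 < tau) by (apply Rinv_0_lt_compat; lra).
  assert (T1 : tau < / 3) by (apply Rinv_lt_contravar; lra).
  assert (T2 : tau < d).
  { rewrite <- (Rinv_inv d). apply Rinv_lt_contravar; [apply Rmult_lt_0_compat; [apply Rinv_0_lt_compat, Dp | lra] | lra]. }
  assert (T3 : 2 * M * tau < eps).
  { unfold tau. apply Rlt_div_l; [lra|]. apply Rlt_div_l in B3; [|exact He]. nra. }
  assert (OT : om * tau = PI) by (unfold om, tau; field; lra).
  set (s := fun w => sin (om * w)).
  assert (Cs : forall w, continuous s w) by (intros w; apply (ex_derive_continuous (K := R_AbsRing) (V := RN)); unfold s; auto_derive; exact I).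
  assert (Sb : forall w, Rabs (s w) <= 1) by (intros w; apply Rabs_le, SIN_bound).
  assert (EX : forall c e, a <= c -> c <= e -> e <= b + / 3 -> ex_RInt (fun w => H w * s w) c e).
  { intros c e Hc Hce He0. apply (ex_RInt_continuous (V := RC)). rewrite Rmin_left, Rmax_right by lra.
    intros w Hw. apply continuous_Rmult; [apply HC; lra | apply Cs]. }
  assert (CSh : forall w, a <= w <= b -> continuous (fun w => H (w + tau)) w).
  { intros w Hw. apply (continuous_comp (fun w => w + tau) H); [|apply HC; lra].
    apply continuous_Rplus; [apply continuous_id | apply continuous_const]. }
  assert (EX2 : ex_RInt (fun w => H (w + tau) * s w) a b).
  { apply (ex_RInt_continuous (V := RC)). rewrite Rmin_left, Rmax_right by lra.
    intros w Hw. apply continuous_Rmult; [apply CSh; lra | apply Cs]. }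
  set (A := RInt (fun w => H w * s w) a b). set (B := RInt (fun w => H (w + tau) * s w) a b).
  assert (EB : RInt (fun w => H w * s w) (a + tau) (b + tau) = - B).
  { pose proof (RInt_comp_lin (V := RC) (fun w => H w * s w) 1 tau a b) as P.
    replace (1 * a + tau) with (a + tau) in P by ring. replace (1 * b + tau) with (b + tau) in P by ring.
    rewrite <- P by (apply EX; lra). unfold B.
    rewrite <- (RInt_opp (V := RC)) by exact EX2.
    apply RInt_ext. intros w _. unfold scal, opp; simpl. unfold mult; simpl. rewrite !Rmult_1_l.
    unfold s. replace (om * (w + tau)) with (om * w + PI) by (rewrite <- OT; ring). rewrite neg_sin. ring. }
  pose proof (RInt_Chasles (V := RC) (fun w => H w * s w) a (a + tau) (b + tau) (EX (a) (a + tau) ltac:(lra) ltac:(lra) ltac:(lra)) (EX (a + tau) (b + tau) ltac:(lra) ltac:(lra) ltac:(lra))) as C1.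
  pose proof (RInt_Chasles (V := RC) (fun w => H w * s w) a b (b + tau) (EX (a) (b) ltac:(lra) ltac:(lra) ltac:(lra)) (EX (b) (b + tau) ltac:(lra) ltac:(lra) ltac:(lra))) as C2.
  rewrite EB in C1. fold A in C2. unfold plus in C1, C2; simpl in C1, C2.
  assert (HSb : forall w, a <= w <= b + / 3 -> Rabs (H w * s w) <= M).
  { intros w Hw. rewrite Rabs_mult. specialize (HB w Hw). specialize (Sb w).
    pose proof (Rabs_pos (H w)). pose proof (Rabs_pos (s w)). nra. }
  assert (N1 := abs_RInt_le_const (fun w => H w * s w) a (a + tau) M ltac:(lra) (EX (a) (a + tau) ltac:(lra) ltac:(lra) ltac:(lra)) ltac:(intros; apply HSb; lra)).
  assert (N2 := abs_RInt_le_const (fun w => H w * s w) b (b + tau) M ltac:(lra) (EX (b) (b + tau) ltac:(lra) ltac:(lra) ltac:(lra)) ltac:(intros; apply HSb; lra)).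
  assert (N3 : Rabs (A - B) <= (b - a) * (eps / (b - a + 1))).
  { unfold A, B. rewrite <- (RInt_minus (V := RC) (fun w => H w * s w)) by (first [exact EX2 | apply EX; lra]).
    apply abs_RInt_le_const; [exact Hab | apply (ex_RInt_minus (V := RN)); [apply EX; lra | exact EX2] |].
    intros w Hw. unfold minus, plus, opp; simpl.
    replace (H w * s w + - (H (w + tau) * s w)) with ((H w - H (w + tau)) * s w) by ring. rewrite Rabs_mult.
    assert (Q : Rabs (H w - H (w + tau)) < eps / (b - a + 1)).
    { apply Hd; [lra | lra |]. replace (w - (w + tau)) with (- tau) by ring. rewrite Rabs_Ropp, Rabs_pos_eq; lra. }
    specialize (Sb w). pose proof (Rabs_pos (s w)). pose proof (Rabs_pos (H w - H (w + tau))). nra. }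
  assert (N4 : (b - a) * (eps / (b - a + 1)) <= eps).
  { apply Rle_trans with ((b - a + 1) * (eps / (b - a + 1))); [apply Rmult_le_compat_r; lra | right; field; lra]. }
  change (Rabs A < eps).
  replace ((a + tau) - a) with tau in N1 by ring. replace (b + tau - b) with tau in N2 by ring.
  set (I1 := RInt (fun w => H w * s w) a (a + tau)) in *. set (I2 := RInt (fun w => H w * s w) b (b + tau)) in *.
  apply Rabs_le_between in N1. apply Rabs_le_between in N2. apply Rabs_le_between in N3.
  apply Rabs_def1; lra.
Qed.

(** The Dirichlet kernel, the sum of exp(2 pi i l w) over |l| <= n, in real form. *)
Fixpoint Dk (n : nat) (w : R) : R :=
  match n with O => 1 | S n' => Dk n' w + 2 * cos (2 * PI * INR (S n') * w) end.

Lemma Dk_S n w : Dk (S n) w = Dk n w + 2 * cos (2 * PI * INR (S n) * w).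
Proof. reflexivity. Qed.

Lemma Dk_cont n w : continuous (Dk n) w.
Proof.
  induction n as [|n IH]; simpl Dk.
  - apply continuous_const.
  - apply continuous_Rplus; [exact IH|].
    continuous_by_derive. exact I.
Qed.

Lemma Dk_sin n w : Dk n w * sin (PI * w) = sin ((2 * INR n + 1) * PI * w).
Proof.
  induction n as [|n IH].
  - change (1 * sin (PI * w) = sin ((2 * 0 + 1) * PI * w)). replace ((2 * 0 + 1) * PI * w) with (PI * w) by ring. ring.
  - change (Dk (S n) w) with (Dk n w + 2 * cos (2 * PI * INR (S n) * w)).
    rewrite Rmult_plus_distr_r, IH, S_INR.
    replace ((2 * INR n + 1) * PI * w) with (2 * PI * (INR n + 1) * w - PI * w) by ring.
    replace ((2 * (INR n + 1) + 1) * PI * w) with (2 * PI * (INR n + 1) * w + PI * w) by ring.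
    rewrite sin_minus, sin_plus. ring.
Qed.

Lemma Dk_even n w : Dk n (- w) = Dk n w.
Proof.
  induction n as [|n IH]; [reflexivity|]. rewrite !Dk_S, IH.
  replace (2 * PI * INR (S n) * - w) with (- (2 * PI * INR (S n) * w)) by ring. rewrite cos_neg. reflexivity.
Qed.

Lemma Dk_per n w : Dk n (w + 1) = Dk n w.
Proof.
  induction n as [|n IH]; [reflexivity|]. rewrite !Dk_S, IH. do 2 f_equal.
  replace (2 * PI * INR (S n) * (w + 1)) with (2 * PI * INR (S n) * w + 2 * INR (S n) * PI) by ring.
  apply cos_period.
Qed.

Lemma Dk_mass n : RInt (Dk n) 0 1 = 1.
Proof.
  induction n as [|n IH].
  - simpl Dk. rewrite RInt_const. unfold scal; simpl. unfold mult; simpl. ring.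
  - assert (H : is_RInt (fun w => 2 * cos (2 * PI * INR (S n) * w)) 0 1 0).
    { pose proof PI_RGT_0. assert (0 < INR (S n)) by (apply lt_0_INR; lia).
      assert (Sp : sin (2 * PI * INR (S n) * 1) = 0).
      { replace (2 * PI * INR (S n) * 1) with (0 + 2 * INR (S n) * PI) by ring. rewrite sin_period. apply sin_0. }
      set (N := INR (S n)) in *. clearbody N.
      set (F := fun w => / (PI * N) * sin (2 * PI * N * w)).
      replace 0 with (minus (F 1) (F 0)) at 2.
      - apply (is_RInt_derive (V := RC) F); intros w _.
        + unfold F. auto_derive; [exact I | field; split; lra].
        + continuous_by_derive. exact I.
      - unfold F. change (/ (PI * N) * sin (2 * PI * N * 1) + - (/ (PI * N) * sin (2 * PI * N * 0)) = 0).
        rewrite Sp, Rmult_0_r, Rmult_0_r, sin_0. ring. }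
    rewrite (RInt_ext _ (fun w => plus (Dk n w) (2 * cos (2 * PI * INR (S n) * w)))) by (intros; apply Dk_S).
    rewrite (RInt_plus (V := RC) (Dk n)).
    + rewrite IH, (is_RInt_unique _ _ _ _ H). unfold plus; simpl. ring.
    + apply ex_RInt_cont. intros. apply Dk_cont.
    + eexists; exact H.
Qed.

(** From sin x >= x - x^3/6 and x <= pi/2 <= 2: the factor is 1 - 4/6. Together with pi >= 3 it
    gives w <= sin(pi w) on [0, 1/2], as the bound on the kernel requires. *)
Lemma sin_ge_third x : 0 <= x <= PI / 2 -> x / 3 <= sin x.
Proof.
  intros [H0 H1]. pose proof PI_4.
  destruct (sin_bound x 0 H0 ltac:(lra)) as [B _].
  unfold sin_approx, sin_term in B. simpl in B.
  replace (1 * (x * 1 / 1) + -1 * 1 * (x * (x * (x * 1)) / 6)) with (x - x * x * x / 6) in B by field.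
  eapply Rle_trans; [|exact B].
  assert (x * x <= 4) by nra. nra.
Qed.

Lemma Dk_bound n w : 0 < w <= / 2 -> Rabs (Dk n w) <= / w.
Proof.
  intros Hw. pose proof PI2_3_2. pose proof PI_RGT_0.
  assert (S : w <= sin (PI * w)).
  { eapply Rle_trans; [|apply sin_ge_third]; nra. }
  apply Rmult_le_reg_r with (sin (PI * w)); [lra|].
  rewrite <- (Rabs_pos_eq (sin (PI * w))) at 1 by lra. rewrite <- Rabs_mult, Dk_sin.
  apply Rle_trans with 1; [apply Rabs_le, SIN_bound|].
  rewrite <- (Rinv_l w) by lra. apply Rmult_le_compat_l; [left; apply Rinv_0_lt_compat|]; lra.
Qed.

(** Near 0 the integrand is at most K w^(al-1) uniformly in [n], which is integrable because al > 0.
    Away from 0 it is the continuous function k(w)/sin(pi w) times a fast sine, and the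
    Riemann-Lebesgue lemma applies. *)
Lemma Dk_integral_small (k : R -> R) K al : 0 < al -> (forall w, continuous k w) ->
  (forall w, 0 < w <= / 2 -> Rabs (k w) <= K * Rpower w al) ->
  forall eps, 0 < eps -> exists N, forall n, (N <= n)%nat -> Rabs (RInt (fun w => k w * Dk n w) 0 (/ 2)) < eps.
Proof.
  intros Ha HC HK eps He.
  assert (K0 : 0 <= K).
  { specialize (HK (/ 2) ltac:(lra)). pose proof (Rabs_pos (k (/ 2))).
    assert (0 < Rpower (/ 2) al) by apply exp_pos. apply Rnot_lt_le. intros N. nra. }
  assert (CD : forall n w, continuous (fun w => k w * Dk n w) w).
  { intros n w. apply continuous_Rmult; [apply HC | apply Dk_cont]. }
  assert (EX : forall n a b, ex_RInt (fun w => k w * Dk n w) a b).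
  { intros n a b. apply ex_RInt_cont. intros. apply CD. }
  assert (Pe : 0 < eps * al / (2 * (K + 1))) by (apply Rdiv_lt_0_compat; nra).
  (* Chosen so that (K/al) d^al, the integral of K w^(al-1) over [0,d], is at most eps/2; K + 1
     guards against K = 0. *)
  set (d := Rmin (/ 2) (Rpower (eps * al / (2 * (K + 1))) (/ al))).
  assert (D0 : 0 < d) by (apply Rmin_glb_lt; [lra | apply exp_pos]).
  assert (D1 : d <= / 2) by apply Rmin_l.
  assert (D2 : Rpower d al <= eps * al / (2 * (K + 1))).
  { replace (eps * al / (2 * (K + 1))) with (Rpower (Rpower (eps * al / (2 * (K + 1))) (/ al)) al).
    - apply Rpower_le_base; [lra | exact D0 | apply Rmin_r].
    - rewrite Rpower_mult, Rinv_l, Rpower_1 by lra. reflexivity. }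
  assert (Near : forall n, Rabs (RInt (fun w => k w * Dk n w) 0 d) <= eps / 2).
  (* The majorant need not be bounded at 0, so an initial piece [0,h] is cut off and estimated by a
     bound [M] that may depend on [n], with [h] so short that the piece contributes at most [e]. *)
  { intros n. apply le_epsilon. intros e Hee.
    destruct (bounded_continuity (V := RN) (fun w => k w * Dk n w) 0 d) as [M HM]; [intros; apply CD|].
    assert (M0 : 0 < M).
    { pose proof (HM 0 ltac:(lra)) as B. change (Rabs (k 0 * Dk n 0) < M) in B. pose proof (Rabs_pos (k 0 * Dk n 0)). lra. }
    set (h := Rmin d (e / M)).
    assert (H0 : 0 < h) by (apply Rmin_glb_lt; [exact D0 | apply Rdiv_lt_0_compat; assumption]).
    assert (H1 : h <= d) by apply Rmin_l.
    assert (H2 : h * M <= e) by (apply Rle_div_r; [exact M0 | apply Rmin_r]).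
    pose proof (RInt_Chasles (V := RC) (fun w => k w * Dk n w) 0 h d (EX _ _ _) (EX _ _ _)) as C1.
    unfold plus in C1; simpl in C1. rewrite <- C1. clear C1.
    eapply Rle_trans; [apply Rabs_triang|]. rewrite Rplus_comm. apply Rplus_le_compat.
    - set (F := fun w => K / al * exp (al * ln w)).
      assert (HI : is_RInt (fun w => K * (exp (al * ln w) * / w)) h d (F d - F h)).
      { change (F d - F h) with (minus (F d) (F h)).
        apply (is_RInt_derive (V := RC) F); rewrite Rmin_left, Rmax_right by exact H1; intros w Hw.
        - unfold F. auto_derive; [lra | field; lra].
        - continuous_by_derive. split; [lra|]. split; [lra | exact I]. }
      eapply Rle_trans; [apply abs_RInt_le; [exact H1 | apply EX]|].
      eapply Rle_trans; [apply (RInt_le _ (fun w => K * (exp (al * ln w) * / w))); [exact H1 | | eexists; exact HI |]|].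
      + apply (ex_RInt_continuous (V := RC)). intros w _.
        apply (continuous_comp _ Rabs); [apply CD | apply continuous_Rabs].
      + intros w Hw. rewrite Rabs_mult, <- Rmult_assoc.
        apply Rmult_le_compat; try apply Rabs_pos; [apply HK; lra | apply Dk_bound; lra].
      + rewrite (is_RInt_unique _ _ _ _ HI). unfold F.
        assert (0 <= K / al * exp (al * ln h)).
        { apply Rmult_le_pos; [apply Rdiv_le_0_compat; lra | left; apply exp_pos]. }
        change (exp (al * ln d)) with (Rpower d al).
        apply Rle_trans with (K / al * Rpower d al); [lra|].
        apply Rle_trans with (K / al * (eps * al / (2 * (K + 1)))).
        * apply Rmult_le_compat_l; [apply Rdiv_le_0_compat; lra | exact D2].
        * replace (K / al * (eps * al / (2 * (K + 1)))) with (eps / 2 * (K / (K + 1))) by (field; lra).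
          assert (K / (K + 1) <= 1) by (apply Rle_div_l; lra). nra.
    - eapply Rle_trans; [apply (abs_RInt_le_const _ 0 h M); [lra | apply EX |]|].
      + intros t Ht. left. apply (HM t). lra.
      + lra. }
  pose proof PI_RGT_0 as PI0.
  assert (SP : forall w, 0 < w < 1 -> sin (PI * w) <> 0).
  { intros w Hw. apply Rgt_not_eq. apply sin_gt_0; nra. }
  destruct (riemann_lebesgue (fun w => k w / sin (PI * w)) d (/ 2) D1) with (eps := eps / 2) as [N HN]; [| lra |].
  { intros w Hw. apply continuous_Rmult; [apply HC|].
    apply continuous_Rinv_gen; [|apply SP; lra].
    continuous_by_derive. exact I. }
  exists N. intros n Hn. specialize (HN n Hn). specialize (Near n).
  pose proof (RInt_Chasles (V := RC) (fun w => k w * Dk n w) 0 d (/ 2) (EX _ _ _) (EX _ _ _)) as C1.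
  unfold plus in C1; simpl in C1. rewrite <- C1.
  rewrite (RInt_ext (fun w => k w * Dk n w) (fun w => k w / sin (PI * w) * sin ((2 * INR n + 1) * PI * w)) d (/ 2)).
  - eapply Rle_lt_trans; [apply Rabs_triang|]. lra.
  - intros w Hw. rewrite Rmin_left, Rmax_right in Hw by exact D1. rewrite <- Dk_sin.
    change (@eq R (k w * Dk n w) (k w / sin (PI * w) * (Dk n w * sin (PI * w)))). field. apply SP. lra.
Qed.

(** The kernel has mass 1, so the difference is the integral of (g(v) - g(u)) D_n(u-v). Periodicity
    centres the interval at [u], and evenness of the kernel folds both halves onto [0, 1/2]. *)
Lemma dini_real (g : R -> R) K al u : 0 < al -> (forall w, continuous g w) -> (forall w, g (w + 1) = g w) ->
  (forall w, w <> 0 -> Rabs (g (u + w) - g u) <= K * Rpower (Rabs w) al) ->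
  forall eps, 0 < eps -> exists N, forall n, (N <= n)%nat ->
    Rabs (RInt (fun v => g v * Dk n (u - v)) 0 1 - g u) < eps.
Proof.
  intros Ha HC HP HK eps He.
  assert (Csh : forall c (s : R) (w : R), continuous (fun w => g (c + s * w)) w).
  { intros c s w. apply (continuous_comp (fun w => c + s * w) g); [|apply HC].
    continuous_by_derive. exact I. }
  destruct (Dk_integral_small (fun w => g (u + 1 * w) - g u) K al Ha) with (eps := eps / 2) as [N1 H1]; [| |lra|].
  { intros w. apply continuous_Rminus; [apply Csh | apply continuous_const]. }
  { intros w Hw. rewrite Rmult_1_l. rewrite <- (Rabs_pos_eq w) at 2 by lra. apply HK. lra. }
  destruct (Dk_integral_small (fun w => g (u + -1 * w) - g u) K al Ha) with (eps := eps / 2) as [N2 H2]; [| |lra|].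
  { intros w. apply continuous_Rminus; [apply Csh | apply continuous_const]. }
  { intros w Hw. replace (Rpower w al) with (Rpower (Rabs (-1 * w)) al).
    - apply HK. lra.
    - f_equal. rewrite Rabs_left; lra. }
  exists (Nat.max N1 N2). intros n Hn. specialize (H1 n ltac:(lia)). specialize (H2 n ltac:(lia)).
  assert (CDs : forall (v : R), continuous (fun v => Dk n (u - v)) v).
  { intros v. apply (continuous_comp (fun v => u - v) (Dk n)); [|apply Dk_cont].
    apply continuous_Rminus; [apply continuous_const | apply continuous_id]. }
  set (h := fun v => (g v - g u) * Dk n (u - v)).
  assert (Ph : perL 1 h).
  { split.
    - intros v. apply continuous_Rmult; [|apply CDs].
      apply continuous_Rminus; [apply HC | apply continuous_const].
    - intros v. unfold h. rewrite HP. f_equal.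
      rewrite <- (Dk_per n (u - (v + 1))). f_equal. ring. }
  assert (M1 : RInt (fun v => Dk n (u - v)) 0 1 = 1).
  { pose proof (RInt_comp_lin (V := RC) (Dk n) (-1) u 0 1) as P.
    replace (-1 * 0 + u) with u in P by ring. replace (-1 * 1 + u) with (u - 1) in P by ring.
    assert (E : ex_RInt (Dk n) u (u - 1)) by (apply ex_RInt_cont; intros; apply Dk_cont).
    specialize (P E). rewrite <- (opp_RInt_swap (V := RC) (Dk n) (u - 1) u) in P by (apply ex_RInt_swap, E).
    assert (Q : RInt (Dk n) (u - 1) u = 1).
    { transitivity (RInt (Dk n) 0 1); [|apply Dk_mass]. rewrite <- (perL_shift 1 (Dk n) (u - 1)); [f_equal; ring|].
      split; [intros; apply Dk_cont | intros; apply Dk_per]. }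
    rewrite Q in P.
    rewrite (RInt_ext (fun y => scal (-1) (Dk n (-1 * y + u))) (fun y => opp (Dk n (u - y)))) in P.
    - rewrite (RInt_opp (V := RC)) in P.
      + unfold opp in P; simpl in P. lra.
      + apply ex_RInt_cont. intros. apply CDs.
    - intros y _. unfold scal, opp; simpl. unfold mult; simpl. replace (-1 * y + u) with (u - y) by ring. ring. }
  assert (E1 : RInt (fun v => g v * Dk n (u - v)) 0 1 - g u = RInt h 0 1).
  { assert (X1 : ex_RInt (fun v => g v * Dk n (u - v)) 0 1).
    { apply (ex_RInt_continuous (V := RC)). intros v _.
      apply continuous_Rmult; [apply HC | apply CDs]. }
    assert (X2 : ex_RInt (fun v => g u * Dk n (u - v)) 0 1).
    { apply (ex_RInt_continuous (V := RC)). intros v _.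
      apply continuous_Rmult; [apply continuous_const | apply CDs]. }
    pose proof (RInt_minus (V := RC) _ _ _ _ X1 X2) as P.
    rewrite (RInt_scal (V := RC) (fun v => Dk n (u - v))) in P
      by (apply ex_RInt_cont; intros; apply CDs).
    rewrite M1 in P. symmetry. eapply eq_trans; [|eapply eq_trans; [exact P|]].
    - apply RInt_ext. intros v _. unfold h, minus, plus, opp; simpl. ring.
    - unfold minus, plus, opp, scal; simpl. unfold mult; simpl. ring. }
  rewrite E1.
  rewrite <- (perL_shift 1 h (u - / 2) Ph). replace (u - / 2 + 1) with (u + / 2) by field.
  pose proof (RInt_Chasles (V := RC) h (u - / 2) u (u + / 2) (perL_ex 1 h _ _ Ph) (perL_ex 1 h _ _ Ph)) as C1.
  rewrite <- C1.
  assert (E2 : RInt h u (u + / 2) = RInt (fun w => (g (u + 1 * w) - g u) * Dk n w) 0 (/ 2)).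
  { pose proof (RInt_comp_lin (V := RC) h 1 u 0 (/ 2)) as P.
    replace (1 * 0 + u) with u in P by ring. replace (1 * / 2 + u) with (u + / 2) in P by ring.
    rewrite <- P by (apply (perL_ex 1), Ph). apply RInt_ext. intros w _. unfold scal; simpl. unfold mult; simpl.
    unfold h. rewrite Rmult_1_l. replace (1 * w + u) with (u + 1 * w) by ring.
    replace (u - (u + 1 * w)) with (- w) by ring. rewrite Dk_even. reflexivity. }
  assert (E3 : RInt h (u - / 2) u = RInt (fun w => (g (u + -1 * w) - g u) * Dk n w) 0 (/ 2)).
  { pose proof (RInt_comp_lin (V := RC) h (-1) u 0 (/ 2)) as P.
    replace (-1 * 0 + u) with u in P by ring. replace (-1 * / 2 + u) with (u - / 2) in P by field.
    specialize (P (perL_ex 1 h _ _ Ph)). rewrite <- (opp_RInt_swap (V := RC) h (u - / 2) u) in P by apply (perL_ex 1), Ph.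
    rewrite (RInt_ext _ (fun w => opp ((g (u + -1 * w) - g u) * Dk n w))) in P.
    - rewrite (RInt_opp (V := RC)) in P.
      + unfold opp in P; simpl in P. lra.
      + apply (ex_RInt_continuous (V := RC)). intros w _.
        apply continuous_Rmult; [|apply Dk_cont].
        apply continuous_Rminus; [apply Csh | apply continuous_const].
    - intros w _. unfold scal, opp; simpl. unfold mult; simpl. unfold h.
      replace (-1 * w + u) with (u + -1 * w) by ring. replace (u - (u + -1 * w)) with w by ring. ring. }
  rewrite E2, E3. unfold plus; simpl. eapply Rle_lt_trans; [apply Rabs_triang|]. lra.
Qed.

Lemma csum_shift u n : csum u 0 (S n) = (u 0%nat + csum (fun j => u (S j)) 0 n)%C.
Proof.
  induction n as [|n IH]; [simpl; ring|].
  change (csum u 0 (S (S n))) with (csum u 0 (S n) + u (S n))%C. rewrite IH. simpl. ring.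
Qed.

Lemma symsum_S a n : symsum a (S n) = (symsum a n + (a (Z.of_nat (S n)) + a (- Z.of_nat (S n))%Z))%C.
Proof.
  unfold symsum. replace (2 * S n + 1)%nat with (S (S (2 * n + 1))) by lia.
  rewrite csum_shift.
  change (csum (fun j : nat => a (Z.of_nat (S j) - Z.of_nat (S n))%Z) 0 (S (2 * n + 1))) with
    (csum (fun j : nat => a (Z.of_nat (S j) - Z.of_nat (S n))%Z) 0 (2 * n + 1) +
      a (Z.of_nat (S (2 * n + 1)) - Z.of_nat (S n))%Z)%C.
  rewrite (csum_ext _ (fun j => a (Z.of_nat j - Z.of_nat n)%Z)).
  - replace (Z.of_nat 0 - Z.of_nat (S n))%Z with (- Z.of_nat (S n))%Z by lia.
    replace (Z.of_nat (S (2 * n + 1)) - Z.of_nat (S n))%Z with (Z.of_nat (S n)) by lia. ring.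
  - intros j _. f_equal. lia.
Qed.

Lemma CI_scale (f : R -> C) L : 0 < L -> (forall t, cc f t) -> CI f 0 L = (RtoC L * CI (fun v => f (L * v)%R) 0 1)%C.
Proof.
  intros HL HC.
  assert (CC : forall v, cc (fun v => f (L * v)) v).
  { intros v. apply (cc_comp_R f (fun v => L * v)); [apply HC | continuous_by_derive; exact I]. }
  rewrite <- CI_mult_const by (apply cint_cc; intros; apply CC).
  assert (Ha : forall pr : C -> R, (forall c, pr (RtoC L * c)%C = L * pr c) -> (forall t, continuous (fun t => pr (f t)) t) ->
     RInt (fun t => pr (f t)) 0 L = RInt (fun t => pr (RtoC L * f (L * t)%R)%C) 0 1).
  { intros pr Hpr Hc. pose proof (RInt_comp_lin (V := RC) (fun t => pr (f t)) L 0 0 1) as P.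
    replace (L * 0 + 0) with 0 in P by ring. replace (L * 1 + 0) with L in P by ring.
    rewrite <- P by (apply ex_RInt_cont; intros; apply Hc).
    apply RInt_ext. intros t _. rewrite Hpr. rewrite Rplus_0_r. reflexivity. }
  unfold CI. f_equal.
  - apply Ha; [intros c; simpl; ring | intros t; apply (HC t)].
  - apply Ha; [intros c; simpl; ring | intros t; apply (HC t)].
Qed.

Lemma mean_unit L F l : 0 < L -> (forall u, cc F u) ->
  mean L F l = CI (fun v => F v * cexp (- (0, 2 * PI * IZR l)%R * RtoC v))%C 0 1.
Proof.
  intros HL HC. unfold mean. rewrite CI_scale by (try exact HL; intros; apply twist_cc, HC).
  rewrite Cmult_assoc, <- RtoC_mult, Rinv_l, Cmult_1_l by lra.
  apply CI_ext. intros v _. unfold twist. replace (L * v / L) with v by (field; lra). f_equal. f_equal.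
  apply injective_projections; simpl; field; lra.
Qed.

(** The symmetric order of summation matters: the terms of index S n and -S n combine into the
    cosine added in [Dk]. *)
Lemma fourier_partial_sum L F u n : 0 < L -> (forall u, cc F u) ->
  symsum (fun l => mean L F l * cexp (0, (2 * IZR l * PI * u)%R))%C n = CI (fun v => F v * RtoC (Dk n (u - v)))%C 0 1.
Proof.
  intros HL HC.
  set (E := fun (l : Z) (v : R) => cexp (0, (2 * PI * IZR l * (u - v))%R)).
  assert (CE : forall l v, cc (E l) v).
  { intros l v. apply cc_cexp. split; [apply continuous_const|].
    apply (ex_derive_continuous (K := R_AbsRing) (V := RN)). simpl. auto_derive. exact I. }
  assert (IE : forall l, cint (fun v => F v * E l v)%C 0 1) by (intros l; apply cint_cc; intros; apply cc_mult; [apply HC | apply CE]).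
  assert (Term : forall l, (mean L F l * cexp (0, (2 * IZR l * PI * u)%R))%C = CI (fun v => F v * E l v)%C 0 1).
  { intros l. rewrite mean_unit by assumption. rewrite Cmult_comm, <- CI_mult_const.
    - apply CI_ext. intros v _.
      replace (cexp (0, (2 * IZR l * PI * u)%R) * (F v * cexp (- (0, 2 * PI * IZR l)%R * RtoC v)))%C with
        (F v * (cexp (0, (2 * IZR l * PI * u)%R) * cexp (- (0, 2 * PI * IZR l)%R * RtoC v)))%C by ring.
      rewrite <- cexp_plus. unfold E. do 2 f_equal. apply injective_projections; simpl; ring.
    - apply cint_cc. intros v _. apply cc_mult; [apply HC | apply cc_exp_lin]. }
  assert (CD : forall n v, cc (fun v => F v * RtoC (Dk n (u - v)))%C v).
  { intros j v. apply cc_mult; [apply HC|]. apply cc_RtoC.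
    apply (continuous_comp (fun v => u - v) (Dk j)); [|apply Dk_cont].
    apply continuous_Rminus; [apply continuous_const | apply continuous_id]. }
  induction n as [|n IH].
  - unfold symsum. simpl csum. rewrite (Term 0%Z), Cplus_0_l. apply CI_ext. intros v _. f_equal. unfold E.
    replace (2 * PI * 0 * (u - v)) with 0 by ring. apply cexp_0.
  - rewrite symsum_S, IH, !Term. clear IH.
    rewrite <- (CI_plus (fun v => F v * E (Z.of_nat (S n)) v)%C) by apply IE.
    rewrite <- CI_plus.
    + apply CI_ext. intros v _. rewrite Dk_S, RtoC_plus.
      replace (E (Z.of_nat (S n)) v) with
        ((cos (2 * PI * INR (S n) * (u - v)), sin (2 * PI * INR (S n) * (u - v))) : C).
      2:{ unfold E, cexp, Re, Im; cbn [fst snd]. rewrite exp_0, <- INR_IZR_INZ. f_equal; ring. }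
      replace (E (- Z.of_nat (S n))%Z v) with
        ((cos (2 * PI * INR (S n) * (u - v)), - sin (2 * PI * INR (S n) * (u - v))) : C).
      2:{ unfold E, cexp, Re, Im; cbn [fst snd]. rewrite exp_0, opp_IZR, <- INR_IZR_INZ.
          replace (2 * PI * - INR (S n) * (u - v)) with (- (2 * PI * INR (S n) * (u - v))) by ring.
          rewrite cos_neg, sin_neg. f_equal; ring. }
      set (c := cos _). set (s := sin _).
      replace (RtoC (2 * c)) with ((c, s) + (c, (- s)%R))%C by (apply injective_projections; simpl; ring). ring.
    + apply cint_cc. intros; apply CD.
    + apply cint_plus; apply IE.
Qed.

Lemma fourier_converges L F al u : 0 < L -> 0 < al -> periodic1 F -> holder al F ->
  forall eps, 0 < eps -> exists N, forall n, (N <= n)%nat ->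
    Cmod (F u - symsum (fun l => mean L F l * cexp (0, (2 * IZR l * PI * u)%R)) n)%C < eps.
Proof.
  intros HL Ha HP HH eps He. pose proof (holder_cc al F Ha HH) as HC. destruct HH as [K HK].
  assert (Comp : forall pr : C -> R, (forall z w, Rabs (pr z - pr w) <= Cmod (z - w)%C) ->
     (forall v, continuous (fun v => pr (F v)) v) ->
     exists N, forall n, (N <= n)%nat -> Rabs (RInt (fun v => pr (F v) * Dk n (u - v)) 0 1 - pr (F u)) < eps / 2).
  { intros pr Hpr Hc. apply (dini_real (fun v => pr (F v)) K al u Ha Hc).
    - intros w. rewrite HP. reflexivity.
    - intros w _. eapply Rle_trans; [apply Hpr|]. eapply Rle_trans; [apply HK|].
      replace (u + w - u) with w by ring. apply Rle_refl.
    - lra. }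
  destruct (Comp fst) as [N1 H1]; [intros z w; apply (fst_le_Cmod (z - w)%C) | intros v; apply (HC v)|].
  destruct (Comp snd) as [N2 H2]; [intros z w; apply (snd_le_Cmod (z - w)%C) | intros v; apply (HC v)|].
  exists (Nat.max N1 N2). intros n Hn. specialize (H1 n ltac:(lia)). specialize (H2 n ltac:(lia)).
  rewrite (fourier_partial_sum L F u n HL HC).
  rewrite <- Cmod_opp. eapply Rle_lt_trans; [apply Cmod_le_abs|].
  assert (E1 : fst (- (F u - CI (fun v => F v * RtoC (Dk n (u - v))) 0 1))%C = RInt (fun v => fst (F v) * Dk n (u - v)) 0 1 - fst (F u)).
  { unfold CI. simpl. rewrite (RInt_ext _ (fun v => fst (F v) * Dk n (u - v))); [ring|].
    intros v _. simpl. ring. }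
  assert (E2 : snd (- (F u - CI (fun v => F v * RtoC (Dk n (u - v))) 0 1))%C = RInt (fun v => snd (F v) * Dk n (u - v)) 0 1 - snd (F u)).
  { unfold CI. simpl. rewrite (RInt_ext (fun v => fst (F v) * 0 + snd (F v) * Dk n (u - v)) (fun v => snd (F v) * Dk n (u - v))); [ring|].
    intros v _. simpl. ring. }
  rewrite E1, E2. lra.
Qed.

(** * Continuation of the main term to the whole plane *)

(** Nilpotency of [g] under the difference operator of step [L], the property that powers of t times
    L-periodic functions share and that yields continuation of the transform. *)
Fixpoint dnil (L : R) (n : nat) (g : R -> C) : Prop :=
  match n with
  | O => forall t, g t = RtoC 0
  | S n' => dnil L n' (fun t => g (t + L)%R - g t)%C
  end.

Lemma dnil_ext L n g h : (forall t, g t = h t) -> dnil L n g -> dnil L n h.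
Proof.
  revert g h. induction n as [|n IH]; intros g h E H; simpl in *.
  - intros t. rewrite <- E. apply H.
  - apply (IH _ _ (fun t => f_equal2 Cminus (E (t + L)) (E t)) H).
Qed.

Lemma dnil_plus L n g h : dnil L n g -> dnil L n h -> dnil L n (fun t => g t + h t)%C.
Proof.
  revert g h. induction n as [|n IH]; intros g h Hg Hh; simpl in *.
  - intros t. rewrite Hg, Hh. ring.
  - eapply dnil_ext; [|apply (IH _ _ Hg Hh)]. intros t. simpl. ring.
Qed.

Lemma dnil_scal L n c g : dnil L n g -> dnil L n (fun t => c * g t)%C.
Proof.
  revert g. induction n as [|n IH]; intros g Hg; simpl in *.
  - intros t. rewrite Hg. ring.
  - eapply dnil_ext; [|apply (IH _ Hg)]. intros t. simpl. ring.
Qed.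

Lemma dnil_shift L n g : dnil L n g -> dnil L n (fun t => g (t + L)).
Proof.
  revert g. induction n as [|n IH]; intros g Hg; simpl in *.
  - intros t. apply Hg.
  - apply (IH _ Hg).
Qed.

(** The difference of t g(t) is t times the difference of [g], plus [L] times a shift of [g]; the
    first summand is covered by induction, the second by [dnil_shift]. *)
Lemma dnil_t L n g : dnil L n g -> dnil L (S n) (fun t => RtoC t * g t)%C.
Proof.
  revert g. induction n as [|n IH]; intros g Hg.
  - simpl in *. intros t. rewrite !Hg. ring.
  - change (dnil L (S n) (fun t => RtoC (t + L) * g (t + L)%R - RtoC t * g t)%C).
    eapply dnil_ext; [|apply dnil_plus; [apply (IH _ Hg) | apply (dnil_scal L (S n) (RtoC L)), (dnil_shift L (S n)), Hg]].
    intros t. simpl. rewrite RtoC_plus. ring.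
Qed.

Lemma dnil_pow L k F : 0 < L -> periodic1 F -> dnil L (S k) (fun t => RtoC ((t / L) ^ k) * F (t / L)%R)%C.
Proof.
  intros HL HP. induction k as [|k IH].
  - simpl. intros t. replace ((t + L) / L) with (t / L + 1) by (field; lra). rewrite HP. ring.
  - eapply dnil_ext; [|apply (dnil_scal L (S (S k)) (RtoC (/ L))), dnil_t, IH].
    intros t. cbv beta. simpl pow. rewrite (RtoC_mult (t / L)). unfold Rdiv at 3. rewrite RtoC_mult. ring.
Qed.

Lemma cdiff_cexp_lin (c z : C) : cdiff (fun w => cexp (c * w)) z.
Proof.
  apply cdiff_eps. exists (c * cexp (c * z))%C. intros eps He.
  pose proof (Cmod_ge_0 c) as C0. pose proof (exp_pos (fst (c * z)%C)) as E0.
  set (K := exp (fst (c * z)%C) * (Cmod c * Cmod c) * exp (Cmod c)).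
  assert (HK : 0 <= K).
  { apply Rmult_le_pos; [|left; apply exp_pos]. apply Rmult_le_pos; nra. }
  exists (Rmin 1 (eps / (K + 1))). split; [apply Rmin_glb_lt; [lra | apply Rdiv_lt_0_compat; lra]|].
  intros w Hw. set (h := (w - z)%C) in *.
  assert (H1 : Cmod h <= 1) by (left; eapply Rlt_le_trans; [exact Hw | apply Rmin_l]).
  assert (H2 : Cmod h < eps / (K + 1)) by (eapply Rlt_le_trans; [exact Hw | apply Rmin_r]).
  replace w with (z + h)%C by (unfold h; ring).
  replace (c * (z + h))%C with (c * z + c * h)%C by ring. rewrite cexp_plus.
  replace (cexp (c * z) * cexp (c * h) - cexp (c * z) - c * cexp (c * z) * h)%C with
    (cexp (c * z) * (cexp (c * h) - 1 - c * h))%C by ring.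
  rewrite Cmod_mult, Cmod_cexp. pose proof (Cmod_ge_0 h) as Hh0.
  assert (B : Cmod (cexp (c * h) - 1 - c * h)%C <= (Cmod c * Cmod h) ^ 2 * exp (Cmod c)).
  { eapply Rle_trans; [apply cexp_bound2|]. rewrite Cmod_mult.
    apply Rmult_le_compat_l; [apply pow2_ge_0 | apply exp_le_mono; nra]. }
  apply Rle_trans with (exp (fst (c * z)%C) * ((Cmod c * Cmod h) ^ 2 * exp (Cmod c))).
  - apply Rmult_le_compat_l; [lra | exact B].
  - replace (exp (fst (c * z)%C) * ((Cmod c * Cmod h) ^ 2 * exp (Cmod c))) with (K * Cmod h * Cmod h) by (unfold K; simpl; ring).
    apply Rmult_le_compat_r; [exact Hh0|]. apply Rlt_div_r in H2; [|lra]. nra.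
Qed.

Lemma cdiff_comp_shift V p z : cdiff V (z - p)%C -> cdiff (fun s => V (s - p)%C) z.
Proof.
  intros [psi [H E]]. exists (fun s => psi (s - p)%C). split.
  - apply (cc_comp (fun s => s - p)%C psi); [apply cc_minus; [apply cc_id | apply cc_const] | exact H].
  - intros w. rewrite E. ring.
Qed.

Definition truncate (L : R) (g : R -> C) (t : R) : C := if Rle_dec t L then g t else RtoC 0.

Lemma truncate_loci L (g : R -> C) : 0 < L -> (forall t, cc g t) -> loci (truncate L g).
Proof.
  intros HL Hg w Hw T HT.
  assert (A : forall b, 0 <= b -> b <= L -> cint (fun t => truncate L g t * w t)%C 0 b).
  { intros b H0 H1. apply (cint_ext (fun t => g t * w t)%C).
    - intros t Ht. rewrite Rmin_left, Rmax_right in Ht by lra. unfold truncate. destruct (Rle_dec t L); [reflexivity | lra].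
    - apply cint_cc. intros; apply cc_mult; [apply Hg | apply Hw]. }
  destruct (Rle_dec T L) as [D|D]; [apply A; lra|].
  apply (cint_Chasles _ 0 L T); [apply A; lra|].
  apply (cint_ext (fun _ => RtoC 0)).
  - intros t Ht. rewrite Rmin_left, Rmax_right in Ht by lra. unfold truncate. destruct (Rle_dec t L); [lra | ring].
  - apply cint_cc. intros; apply cc_const.
Qed.

Lemma truncate_is_lap L (g : R -> C) z : 0 < L -> (forall t, cc g t) ->
  is_lap (truncate L g) z (CI (fun t => g t * cexp (- z * RtoC t))%C 0 L).
Proof.
  intros HL Hg eps He. exists L. intros T HT.
  assert (Lc := truncate_loci L g HL Hg).
  rewrite <- (CI_Chasles _ 0 L T).
  2: apply loci_exp; [exact Lc | lra].
  2: apply (cint_sub _ 0 L T T); try lra; apply loci_exp; [exact Lc | lra].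
  rewrite (CI_ext (fun t => truncate L g t * cexp (- z * RtoC t))%C (fun t => g t * cexp (- z * RtoC t))%C 0 L).
  2:{ intros t Ht. rewrite Rmin_left, Rmax_right in Ht by lra. unfold truncate. destruct (Rle_dec t L); [reflexivity | lra]. }
  rewrite (CI_ext (fun t => truncate L g t * cexp (- z * RtoC t))%C (fun _ => RtoC 0) L T).
  2:{ intros t Ht. rewrite Rmin_left, Rmax_right in Ht by lra. unfold truncate. destruct (Rle_dec t L); [lra | ring]. }
  rewrite CI_const. match goal with |- Cmod ?e < _ => replace e with (RtoC 0) by ring end. rewrite Cmod_0. exact He.
Qed.

(** The integral over [0,L] is the Laplace transform of a function vanishing beyond [L]. Such a
    function satisfies [expb] with every exponent, in particular one below Re z, so the transform is
    differentiable everywhere. *)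
Lemma finite_laplace_cdiff L (g : R -> C) z : 0 < L -> (forall t, cc g t) ->
  cdiff (fun z => CI (fun t => g t * cexp (- z * RtoC t))%C 0 L) z.
Proof.
  intros HL Hg. apply cdiff_ext with (f := Lap (truncate L g)).
  { intros w. apply Lap_eq, truncate_is_lap; assumption. }
  destruct (cc_bounded g 0 L) as [M HM]; [intros; apply Hg|].
  assert (M0 : 0 <= M) by (specialize (HM 0 ltac:(lra)); pose proof (Cmod_ge_0 (g 0)); lra).
  set (a := fst z - 1).
  apply (Lap_cdiff _ (M * exp (Rabs a * L)) a); [apply truncate_loci; assumption | | unfold a; lra].
  intros t Ht. unfold truncate. destruct (Rle_dec t L).
  - eapply Rle_trans; [apply HM; lra|]. rewrite Rmult_assoc, <- exp_plus. rewrite <- (Rmult_1_r M) at 1.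
    apply Rmult_le_compat_l; [exact M0|]. rewrite <- exp_0. apply exp_le_mono.
    pose proof (Rabs_maj2 a). pose proof (Rabs_pos a). nra.
  - rewrite Cmod_0. apply Rmult_le_pos; [apply Rmult_le_pos; [exact M0|] |]; left; apply exp_pos.
Qed.

Definition subexp (g : R -> C) : Prop := forall a, 0 < a -> exists C0, expb g C0 a.

(** At z = s - kappa and L = log q this is 1 - q^(kappa-s), which vanishes exactly at the points
    kappa + chi_l. *)
Definition theta (L : R) (z : C) : C := (1 - cexp (- RtoC L * z))%C.

Lemma theta_cdiff L z : cdiff (theta L) z.
Proof. apply cdiff_minus; [apply cdiff_const | apply cdiff_cexp_lin]. Qed.

(** Translating the variable, the transform of g(t+L) is exp(zL) times what remains of the transform
    of [g] after removing the part over [0,L]. *)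
Lemma theta_lap L (g : R -> C) z : 0 < L -> (forall t, cc g t) -> subexp g -> 0 < fst z ->
  (theta L z * Lap g z)%C =
  (CI (fun t => g t * cexp (- z * RtoC t)) 0 L + cexp (- RtoC L * z) * Lap (fun t => g (t + L)%R - g t)%C z)%C.
Proof.
  intros HL Hg Hs Hz. destruct (Hs (fst z / 2)) as [C0 HC0]; [lra|].
  assert (Csh : forall t, cc (fun t => g (t + L)) t) by (intros t; apply cc_shift, Hg).
  assert (Lg : loci g) by (apply loci_cc, Hg). assert (Lsh : loci (fun t => g (t + L))) by (apply loci_cc, Csh).
  pose proof (Lap_spec g C0 (fst z / 2) z Lg HC0 ltac:(lra)) as HLap.
  set (l := Lap g z) in *.
  set (A := CI (fun t => g t * cexp (- z * RtoC t))%C 0 L).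
  assert (Ez : (cexp (z * RtoC L) * cexp (- RtoC L * z))%C = RtoC 1).
  { rewrite <- cexp_plus. replace (z * RtoC L + - RtoC L * z)%C with (RtoC 0) by ring. apply cexp_0. }
  assert (Hsh : is_lap (fun t => g (t + L)) z (cexp (z * RtoC L) * (l - A))%C).
  { intros eps He. set (M := Cmod (cexp (z * RtoC L))).
    assert (M0 : 0 < M) by (apply Cmod_gt_0, cexp_neq).
    destruct (HLap (eps / M)) as [T0 HT0]; [apply Rdiv_lt_0_compat; assumption|].
    exists (Rmax 0 T0). intros T HT.
    assert (T1 : 0 <= T) by (eapply Rle_trans; [apply Rmax_l | exact HT]).
    assert (T2 : T0 <= T) by (eapply Rle_trans; [apply Rmax_r | exact HT]).
    specialize (HT0 (T + L) ltac:(lra)).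
    rewrite <- (CI_Chasles _ 0 L (T + L)) in HT0.
    2: apply loci_exp; [exact Lg | lra].
    2: apply (cint_sub _ 0 L (T + L) (T + L)); try lra; apply loci_exp; [exact Lg | lra].
    fold A in HT0.
    assert (E : CI (fun t => g (t + L)%R * cexp (- z * RtoC t))%C 0 T =
                (cexp (z * RtoC L) * CI (fun t => g t * cexp (- z * RtoC t)) L (T + L))%C).
    { set (f := fun t => (g t * cexp (- z * RtoC t))%C).
      assert (If : forall pr : C -> R, (forall t, continuous (fun t => pr (f t)) t) ->
         RInt (fun t => pr (f (t + L))) 0 T = RInt (fun t => pr (f t)) L (T + L)).
      { intros pr Hpr. pose proof (RInt_comp_lin (V := RC) (fun t => pr (f t)) 1 L 0 T) as P.
        replace (1 * 0 + L) with L in P by ring. replace (1 * T + L) with (T + L) in P by ring.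
        rewrite <- P by (apply ex_RInt_cont; intros; apply Hpr).
        apply RInt_ext. intros t _. unfold scal; simpl. unfold mult; simpl. rewrite !Rmult_1_l. reflexivity. }
      assert (Cf : forall t, cc f t) by (intros t; apply cc_mult; [apply Hg | apply cc_exp_lin]).
      rewrite (CI_ext _ (fun t => cexp (z * RtoC L) * f (t + L)%R)%C).
      - rewrite CI_mult_const.
        + f_equal. unfold CI. rewrite (If fst (fun t => proj1 (Cf t))), (If snd (fun t => proj2 (Cf t))). reflexivity.
        + apply cint_cc. intros t _. unfold f. apply cc_mult; [apply Csh|]. apply cc_cexp, cc_mult; [apply cc_const|].
          apply cc_RtoC, (continuous_plus (V := RN)); [apply continuous_id | apply continuous_const].
      - intros t _. unfold f. rewrite RtoC_plus.
        replace (- z * (RtoC t + RtoC L))%C with (- z * RtoC t + - RtoC L * z)%C by ring. rewrite cexp_plus.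
        replace (cexp (z * RtoC L) * (g (t + L)%R * (cexp (- z * RtoC t) * cexp (- RtoC L * z))))%C with
          ((cexp (z * RtoC L) * cexp (- RtoC L * z)) * (g (t + L)%R * cexp (- z * RtoC t)))%C by ring.
        rewrite Ez. ring. }
    rewrite E. set (J := CI (fun t => g t * cexp (- z * RtoC t))%C L (T + L)) in *.
    replace (cexp (z * RtoC L) * J - cexp (z * RtoC L) * (l - A))%C with (cexp (z * RtoC L) * (A + J - l))%C by ring.
    rewrite Cmod_mult. fold M. apply Rlt_div_r in HT0; [|exact M0]. lra. }
  assert (HD : is_lap (fun t => g (t + L)%R - g t)%C z (cexp (z * RtoC L) * (l - A) + (-1) * l)%C).
  { apply is_lap_ext with (e := fun t => (g (t + L)%R + (-1) * g t)%C); [intros; ring|].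
    apply is_lap_plus; [exact Lsh | apply loci_scal, Lg | exact Hsh | apply is_lap_scal; assumption]. }
  rewrite (Lap_eq _ _ _ HD). unfold theta.
  replace (cexp (- RtoC L * z) * (cexp (z * RtoC L) * (l - A) + -1 * l))%C with
    ((cexp (z * RtoC L) * cexp (- RtoC L * z)) * (l - A) - cexp (- RtoC L * z) * l)%C by ring.
  rewrite Ez. ring.
Qed.

(* Each differencing step costs one factor theta, by theta_lap. *)
Lemma dnil_lap_entire L n : 0 < L -> forall g : R -> C, (forall t, cc g t) -> subexp g -> dnil L n g ->
  exists V : C -> C, (forall z, cdiff V z) /\
    forall z, 0 < fst z -> (cpown (theta L z) n * Lap g z)%C = V z.
Proof.
  intros HL. induction n as [|n IH]; intros g Hg Hs Hn.
  - exists (fun _ => RtoC 0). split; [intros; apply cdiff_const|]. intros z Hz.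
    rewrite (Lap_eq g z (RtoC 0)); [ring|]. simpl in Hn. intros eps He. exists 0. intros T HT.
    rewrite (CI_ext _ (fun _ => RtoC 0)) by (intros; rewrite Hn; ring). rewrite CI_const.
    match goal with |- Cmod ?e < _ => replace e with (RtoC 0) by ring end. rewrite Cmod_0. exact He.
  - destruct (IH (fun t => g (t + L)%R - g t)%C) as [V' [HV EV]].
    + intros t. apply cc_minus; [apply cc_shift|]; apply Hg.
    + intros a Ha. destruct (Hs a Ha) as [C0 HC0]. exists (C0 * exp (a * L) + C0). intros t Ht.
      unfold Cminus. eapply Rle_trans; [apply Cmod_triangle|]. rewrite Cmod_opp, Rmult_plus_distr_r.
      apply Rplus_le_compat; [|apply HC0, Ht]. eapply Rle_trans; [apply HC0; lra|].
      rewrite Rmult_assoc, <- exp_plus. right. do 2 f_equal. ring.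
    + exact Hn.
    + exists (fun z => cpown (theta L z) n * CI (fun t => g t * cexp (- z * RtoC t)) 0 L + cexp (- RtoC L * z) * V' z)%C. split.
      * intros z. apply cdiff_plus; apply cdiff_mult.
        -- apply cdiff_pown, theta_cdiff.
        -- apply finite_laplace_cdiff; assumption.
        -- apply cdiff_cexp_lin.
        -- apply HV.
      * intros z Hz. rewrite <- EV by exact Hz. pose proof (theta_lap L g z HL Hg Hs Hz) as T.
        change (cpown (theta L z) (S n)) with (theta L z * cpown (theta L z) n)%C.
        replace (theta L z * cpown (theta L z) n * Lap g z)%C with (cpown (theta L z) n * (theta L z * Lap g z))%C by ring.
        rewrite T. ring.
Qed.

(** * The generating function *)

Lemma mainterm_expb al kappa L Phi k e : 0 < al -> al <= 1 -> 0 < L -> 0 < e ->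
  periodic1 (Phi k) -> holder al (Phi k) -> exists C0, expb (mainterm kappa L Phi k) C0 (fst kappa + e).
Proof.
  intros Ha Ha1 HL He Hp Hh.
  assert (P : 0 < INR k + 1) by (pose proof (pos_INR k); lra).
  destruct (mainterm_lh al kappa L Phi k (e / (INR k + 1))) as [C0 [B _]]; try assumption.
  { apply Rdiv_lt_0_compat; assumption. }
  exists C0. apply (expb_weaken _ _ (fst kappa + INR k * (e / (INR k + 1)))); [|exact B].
  apply Rplus_le_compat_l. apply Rle_trans with ((INR k + 1) * (e / (INR k + 1))).
  - apply Rmult_le_compat_r; [apply Rdiv_le_0_compat; lra | lra].
  - right. field. lra.
Qed.

Lemma mainterm_is_lap al kappa L Phi k s : 0 < al -> al <= 1 -> 0 < L ->
  periodic1 (Phi k) -> holder al (Phi k) -> fst kappa < fst s ->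
  is_lap (mainterm kappa L Phi k) s (Lap (mainterm kappa L Phi k) s).
Proof.
  intros Ha Ha1 HL Hp Hh Hs.
  destruct (mainterm_expb al kappa L Phi k ((fst s - fst kappa) / 2)) as [C0 HC0]; try assumption; [lra|].
  apply (Lap_spec _ C0 (fst kappa + (fst s - fst kappa) / 2)); [|exact HC0 | lra].
  apply loci_cc. intros t. apply mainterm_cc, (holder_cc al); assumption.
Qed.

Lemma mainsum_loci al kappa L Phi m : 0 < al -> (forall k, (k < m)%nat -> holder al (Phi k)) ->
  loci (mainsum kappa L Phi m).
Proof.
  intros Ha H. apply loci_cc. intros t. apply csum_cc. intros k Hk. apply mainterm_cc, (holder_cc al), H; assumption.
Qed.

Lemma mainsum_is_lap al kappa L Phi m s : 0 < al -> al <= 1 -> 0 < L ->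
  (forall k, (k < m)%nat -> periodic1 (Phi k) /\ holder al (Phi k)) -> fst kappa < fst s ->
  is_lap (mainsum kappa L Phi m) s (csum (fun k => Lap (mainterm kappa L Phi k) s) 0 m).
Proof.
  intros Ha Ha1 HL H Hs. induction m as [|m IH].
  - intros eps He. exists 0. intros T _. simpl csum.
    rewrite (CI_ext _ (fun _ => RtoC 0)) by (intros; unfold mainsum; simpl; ring). rewrite CI_const.
    match goal with |- Cmod ?e < _ => replace e with (RtoC 0) by ring end. rewrite Cmod_0. exact He.
  - apply is_lap_ext with (e := fun t => (mainsum kappa L Phi m t + mainterm kappa L Phi m t)%C); [reflexivity|].
    apply is_lap_plus.
    + apply (mainsum_loci al); [exact Ha|]. intros k Hk. apply H. lia.
    + apply loci_cc. intros t. apply mainterm_cc, (holder_cc al); [exact Ha | apply H; lia].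
    + apply IH. intros k Hk. apply H. lia.
    + apply (mainterm_is_lap al); try assumption; apply H; lia.
Qed.

Lemma mainterm_entire al (kappa : C) L Phi k : 0 < al -> al <= 1 -> 0 < L -> periodic1 (Phi k) -> holder al (Phi k) ->
  exists V : C -> C, (forall s, cdiff V s) /\ forall s, fst kappa < fst s ->
    (cpown (theta L (s - kappa)) (S k) * Lap (mainterm kappa L Phi k) s)%C = V s.
Proof.
  intros Ha Ha1 HL Hp Hh. pose proof (holder_cc al _ Ha Hh) as HC.
  (* The main term for kappa = 0; the factor exp(kappa t) merely translates the variable of the
     transform by [kappa]. *)
  set (g := fun t : R => (RtoC ((t / L) ^ k) * Phi k (t / L)%R)%C).
  assert (Eg : forall t, mainterm 0 L Phi k t = g t).
  { intros t. unfold mainterm, g. rewrite Cmult_0_l, cexp_0, Cmult_1_l. reflexivity. }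
  assert (Cg : forall t, cc g t).
  { intros t. apply (cc_ext (mainterm 0 L Phi k)); [exact Eg | apply mainterm_cc, HC]. }
  assert (Sg : subexp g).
  { intros a Hpa. destruct (mainterm_expb al 0 L Phi k a) as [C0 HC0]; try assumption.
    exists C0. intros t Ht. rewrite <- Eg. replace a with (fst (RtoC 0) + a) by (simpl; ring). apply HC0, Ht. }
  destruct (dnil_lap_entire L (S k) HL g Cg Sg (dnil_pow L k (Phi k) HL Hp)) as [V [HV EV]].
  exists (fun s => V (s - kappa)%C). split; [intros s; apply cdiff_comp_shift, HV|].
  intros s Hs. rewrite <- EV by (simpl; lra). f_equal.
  apply Lap_eq. destruct (Sg ((fst s - fst kappa) / 2)) as [C0 HC0]; [lra|].
  assert (HL0 : is_lap g (s + - kappa)%C (Lap g (s - kappa))).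
  { apply (Lap_spec g C0 ((fst s - fst kappa) / 2)); [apply loci_cc, Cg | exact HC0 | simpl; lra]. }
  apply (proj1 (is_lap_shift g s (- kappa)%C _)) in HL0.
  revert HL0. apply is_lap_ext. intros t _. unfold mainterm, g. replace (- - kappa)%C with kappa by ring. ring.
Qed.

Lemma mainsum_entire al (kappa : C) L Phi m : 0 < al -> al <= 1 -> 0 < L ->
  (forall k, (k < m)%nat -> periodic1 (Phi k) /\ holder al (Phi k)) ->
  exists V : C -> C, (forall s, cdiff V s) /\ forall s, fst kappa < fst s ->
    (cpown (theta L (s - kappa)) m * csum (fun k => Lap (mainterm kappa L Phi k) s) 0 m)%C = V s.
Proof.
  intros Ha Ha1 HL. induction m as [|m IH]; intros H.
  - exists (fun _ => RtoC 0). split; [intros; apply cdiff_const | intros; simpl; ring].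
  - destruct IH as [V [HV EV]]; [intros k Hk; apply H; lia|].
    destruct (mainterm_entire al kappa L Phi m) as [W [HW EW]]; try assumption; try (apply H; lia).
    (* The exponent rises from m to m+1: the earlier terms receive one additional factor, while the
       term of index m needs all m+1. *)
    exists (fun s => theta L (s - kappa) * V s + W s)%C. split.
    + intros s. apply cdiff_plus; [|apply HW]. apply cdiff_mult; [|apply HV].
      apply cdiff_comp_shift, theta_cdiff.
    + intros s Hs. rewrite <- EV, <- EW by exact Hs. simpl. ring.
Qed.

Lemma cexp_1_inv z : cexp z = RtoC 1 -> exists l : Z, z = (0, 2 * PI * IZR l).
Proof.
  intros H. pose proof PI_RGT_0 as P.
  assert (R0 : fst z = 0).
  { assert (E : Cmod (cexp z) = 1) by (rewrite H; apply Cmod_1). rewrite Cmod_cexp in E.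
    rewrite <- exp_0 in E. apply exp_inv, E. }
  set (y := snd z). set (l := Int_part (y / (2 * PI))).
  exists l. set (w := y - 2 * PI * IZR l).
  destruct (base_Int_part (y / (2 * PI))) as [B1 B2]. fold l in B1, B2.
  assert (W : 0 <= w < 2 * PI).
  { unfold w. apply Rle_div_r in B1; [|lra]. split; [lra|].
    assert (y / (2 * PI) < IZR l + 1) by lra. apply Rlt_div_l in H0; lra. }
  assert (Cw : cos w = 1).
  { assert (E : cexp (0, w) = RtoC 1).
    { replace ((0, w) : C) with (z + (0, (2 * PI * IZR (- l))%R))%C.
      - rewrite cexp_plus, H, cexp_2pi_Z. ring.
      - unfold w, y. rewrite opp_IZR. apply injective_projections; simpl; [rewrite R0; ring | ring]. }
    apply (f_equal fst) in E. unfold cexp, Re, Im in E; simpl in E. rewrite exp_0 in E. lra. }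
  assert (W0 : w = 0).
  { destruct (Req_dec w 0) as [E|N]; [exact E|]. exfalso.
    assert (S : 0 < sin (w / 2)) by (apply sin_gt_0; lra).
    replace w with (2 * (w / 2)) in Cw by field. rewrite cos_2a_sin in Cw. nra. }
  apply injective_projections; simpl; [exact R0|]. unfold w, y in W0. lra.
Qed.

(** * Finite sums, principal parts and residues *)

Lemma csum_plus u v a n : csum (fun j => u j + v j)%C a n = (csum u a n + csum v a n)%C.
Proof. induction n as [|n IH]; simpl; [ring | rewrite IH; ring]. Qed.

Lemma csum_scal c u a n : csum (fun j => c * u j)%C a n = (c * csum u a n)%C.
Proof. induction n as [|n IH]; simpl; [ring | rewrite IH; ring]. Qed.

Lemma csum_delta (u : nat -> C) i n : (i < n)%nat -> csum (fun j => if Nat.eq_dec j i then u j else RtoC 0) 0 n = u i.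
Proof.
  induction n as [|n IH]; intros Hi; [lia|]. simpl. destruct (Nat.eq_dec n i) as [->|N].
  - rewrite (csum_ext _ (fun _ => RtoC 0)).
    + rewrite csum_0. ring.
    + intros j Hj. destruct (Nat.eq_dec j i); [lia | reflexivity].
  - rewrite IH by lia. ring.
Qed.

Lemma csum_bound u a n : exists B, 0 <= B /\ forall x : nat -> R, (forall j, 0 <= x j <= 1) ->
  Cmod (csum (fun j => u j * RtoC (x j))%C a n) <= B.
Proof.
  induction n as [|n [B [B0 HB]]]; simpl.
  - exists 0. split; [lra|]. intros x _. rewrite Cmod_0. lra.
  - exists (B + Cmod (u (a + n)%nat)). split; [pose proof (Cmod_ge_0 (u (a + n)%nat)); lra|].
    intros x Hx. eapply Rle_trans; [apply Cmod_triangle|]. specialize (HB x Hx).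
    rewrite Cmod_mult, Cmod_R, Rabs_pos_eq by apply Hx.
    pose proof (Cmod_ge_0 (u (a + n)%nat)). specialize (Hx (a + n)%nat). nra.
Qed.

(** Letting x tend to 0 forces the constant coefficient to vanish; dividing by x then lowers [n]. *)
Lemma poly_zero n (d : nat -> C) K x0 : 0 < x0 ->
  (forall x, 0 < x < x0 -> Cmod (csum (fun j => d j * RtoC (x ^ j))%C 0 n) <= K * x ^ n) ->
  forall j, (j < n)%nat -> d j = RtoC 0.
Proof.
  revert d. induction n as [|n IH]; intros d Hx0 H j Hj; [lia|].
  set (Q := fun x : R => csum (fun j => d (S j) * RtoC (x ^ j))%C 0 n).
  assert (E : forall x, csum (fun j => d j * RtoC (x ^ j))%C 0 (S n) = (d 0%nat + RtoC x * Q x)%C).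
  { intros x. rewrite csum_shift. unfold Q. rewrite <- csum_scal. f_equal; [simpl; ring|].
    apply csum_ext. intros i _. simpl pow. rewrite RtoC_mult. ring. }
  destruct (csum_bound (fun j => d (S j)) 0 n) as [B [B0 HB]].
  assert (D0 : d 0%nat = RtoC 0).
  { apply Cmod_eq_0, Rle_antisym; [|apply Cmod_ge_0]. apply Rnot_lt_le. intros P.
    set (M := Rabs K + B + 1). assert (HM : 0 < M) by (pose proof (Rabs_pos K); unfold M; lra).
    (* At this point x (|K| + B) is less than half of |d 0|, although the hypothesis bounds |d 0| by
       it. *)
    set (x := Rmin (Rmin (x0 / 2) 1) (Cmod (d 0%nat) / (2 * M))).
    assert (X0 : 0 < x) by (repeat apply Rmin_glb_lt; try lra; apply Rdiv_lt_0_compat; lra).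
    assert (X1 : x <= x0 / 2) by (eapply Rle_trans; [apply Rmin_l | apply Rmin_l]).
    assert (X2 : x <= 1) by (eapply Rle_trans; [apply Rmin_l | apply Rmin_r]).
    assert (X3 : x * (2 * M) <= Cmod (d 0%nat)) by (apply Rle_div_r; [lra | apply Rmin_r]).
    specialize (H x ltac:(lra)). rewrite E in H.
    assert (XP : forall i, 0 <= x ^ i <= 1) by (intros i; split; [apply pow_le; lra | rewrite <- (pow1 i); apply pow_incr; lra]).
    specialize (HB (fun j => x ^ j) XP). cbv beta in HB. fold (Q x) in HB.
    assert (T : Cmod (d 0%nat) <= K * x ^ S n + x * B).
    { replace (d 0%nat) with ((d 0%nat + RtoC x * Q x) + - (RtoC x * Q x))%C by ring.
      eapply Rle_trans; [apply Cmod_triangle|]. apply Rplus_le_compat; [exact H|].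
      rewrite Cmod_opp, Cmod_mult, Cmod_R, Rabs_pos_eq by lra. apply Rmult_le_compat_l; lra. }
    assert (T2 : K * x ^ S n <= Rabs K * x).
    { apply Rle_trans with (Rabs K * x ^ S n); [apply Rmult_le_compat_r; [apply XP | apply Rle_abs]|].
      apply Rmult_le_compat_l; [apply Rabs_pos|]. simpl. specialize (XP n). nra. }
    unfold M in *. nra. }
  destruct j as [|j]; [exact D0|].
  apply (IH (fun j => d (S j))); [exact Hx0| |lia].
  intros x Hx. specialize (H x Hx). rewrite E, D0, Cplus_0_l, Cmod_mult, Cmod_R, Rabs_pos_eq in H by lra.
  fold (Q x). simpl pow in H. apply Rmult_le_reg_l with x; lra.
Qed.

(** Multiplying the principal part, the sum of a_i x^(-i-1), by x^(m+k+1) gives exponents m+k-i, so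
    the coefficient of x^m comes from i = k alone. *)
Lemma laurent_poly (a : nat -> C) m k n : (k < m)%nat -> n = (m + k + 1)%nat ->
  exists b : nat -> C, b m = a k /\
    forall x : R, csum (fun i => a i * RtoC (x ^ (m + k - i)))%C 0 m = csum (fun j => b j * RtoC (x ^ j))%C 0 n.
Proof.
  intros Hk Hn.
  assert (H : forall m', (m' <= m)%nat -> exists b : nat -> C, b m = (if lt_dec k m' then a k else RtoC 0) /\
    forall x : R, csum (fun i => a i * RtoC (x ^ (m + k - i)))%C 0 m' = csum (fun j => b j * RtoC (x ^ j))%C 0 n).
  { induction m' as [|m' IH]; intros Hm'.
    - exists (fun _ => RtoC 0). split; [destruct (lt_dec k 0); [lia | reflexivity]|].
      intros x. simpl. rewrite (csum_ext _ (fun _ => RtoC 0)) by (intros; ring). rewrite csum_0. reflexivity.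
    - destruct IH as [b [Eb Hb]]; [lia|].
      exists (fun j => b j + (if Nat.eq_dec j (m + k - m') then a m' else RtoC 0))%C. split.
      + rewrite Eb. destruct (Nat.eq_dec m (m + k - m')), (lt_dec k m'), (lt_dec k (S m')); try lia; try ring.
        replace m' with k by lia. ring.
      + intros x. simpl csum. rewrite Hb.
        rewrite (csum_ext (fun j => (b j + (if Nat.eq_dec j (m + k - m') then a m' else 0)) * RtoC (x ^ j))%C
          (fun j => b j * RtoC (x ^ j) + (if Nat.eq_dec j (m + k - m') then a m' * RtoC (x ^ j) else RtoC 0))%C).
        * rewrite csum_plus. f_equal. rewrite (csum_delta (fun j => a m' * RtoC (x ^ j))%C) by lia. reflexivity.
        * intros j _. destruct (Nat.eq_dec j (m + k - m')); ring. }
  destruct (H m (le_n m)) as [b [Eb Hb]]. exists b. split; [|exact Hb].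
  rewrite Eb. destruct (lt_dec k m); [reflexivity | lia].
Qed.

Lemma cpown_RtoC x n : cpown (RtoC x) n = RtoC (x ^ n).
Proof. induction n as [|n IH]; simpl; [reflexivity | rewrite IH, RtoC_mult; reflexivity]. Qed.

(** The Taylor polynomial at [p] of (s-p)^(m+1) G(s)(s-p)^k/s and x^n times the principal part, with
    n = m+k+1, differ by O(x^n) at p + x. By [poly_zero] their coefficients agree, and the one of
    index m is the residue. *)
Lemma residue_of_pole (G h : C -> C) (p : C) (a : nat -> C) m k rho K x0 : (k < m)%nat -> 0 < rho -> 0 < x0 ->
  (forall s, Cmod (s - p)%C < rho -> cdiff h s) ->
  (forall s, 0 < Cmod (s - p)%C < rho -> h s = (cpown (s - p) m * G s)%C) ->
  (forall x, 0 < x < x0 ->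
     Cmod (G (p + RtoC x)%C / (p + RtoC x) - csum (fun i => a i * RtoC (/ x ^ S i)) 0 m)%C <= K) ->
  is_residue (fun s => G s * cpown (s - p) k / s)%C p (a k).
Proof.
  intros Hk Hrho Hx0 Hh Eh HK.
  (* If p = 0, the quotient by s uses up one of the m+1 factors s-p; otherwise s is kept away from 0
     by the radius [rho']. *)
  set (U := fun s => if Ceq_dec p 0 then (h s * cpown (s - p) k)%C else (h s * cpown (s - p) (S k) / s)%C).
  set (rho' := if Ceq_dec p 0 then rho else Rmin rho (Cmod p)).
  assert (R1 : rho' <= rho) by (unfold rho'; destruct (Ceq_dec p 0); [lra | apply Rmin_l]).
  assert (R0 : 0 < rho').
  { unfold rho'. destruct (Ceq_dec p 0) as [E|N]; [exact Hrho|]. apply Rmin_glb_lt; [exact Hrho|]. apply Cmod_gt_0, N. }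
  assert (Sn : forall s, p <> RtoC 0 -> Cmod (s - p)%C < rho' -> s <> RtoC 0).
  { intros s N Hs E. subst s. unfold rho' in Hs. destruct (Ceq_dec p 0); [contradiction|].
    replace (0 - p)%C with (- p)%C in Hs by ring. rewrite Cmod_opp in Hs. pose proof (Rmin_r rho (Cmod p)). lra. }
  assert (HU : forall s, Cmod (s - p)%C < rho' -> cdiff U s).
  { intros s Hs. unfold U. assert (Hs' : Cmod (s - p)%C < rho) by lra. destruct (Ceq_dec p 0) as [E|N].
    - apply cdiff_mult; [apply Hh, Hs' | apply cdiff_pown, cdiff_shift].
    - apply cdiff_div; [|apply cdiff_id | apply Sn; assumption].
      apply cdiff_mult; [apply Hh, Hs' | apply cdiff_pown, cdiff_shift]. }
  assert (EU : forall s, 0 < Cmod (s - p)%C < rho' ->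
     U s = (cpown (s - p) (S m) * (G s * cpown (s - p) k / s))%C).
  { intros s [H0 Hs]. unfold U. rewrite Eh by lra. destruct (Ceq_dec p 0) as [E|N].
    - assert (N : s <> RtoC 0).
      { intros E'. rewrite E, E' in H0. replace (0 - 0)%C with (RtoC 0) in H0 by ring. rewrite Cmod_0 in H0. lra. }
      rewrite E. replace (s - 0)%C with s by ring. simpl cpown. field. exact N.
    - simpl cpown. field. apply Sn; assumption. }
  (* The square of half-side [r] reaches at most 2r from [p], hence stays inside the disc of radius
     [rho']. *)
  set (r := rho' / 3). assert (Hr : 0 < r) by (unfold r; lra).
  assert (HUsq : forall z, insq p r z -> cdiff U z).
  { intros z [Z1 Z2]. apply HU. eapply Rle_lt_trans; [apply Cmod_le_abs|].
    change (fst (z - p)%C) with (fst z - fst p). change (snd (z - p)%C) with (snd z - snd p).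
    assert (Rabs (fst z - fst p) <= r) by (apply Rabs_le; lra).
    assert (Rabs (snd z - snd p) <= r) by (apply Rabs_le; lra). unfold r in *; lra. }
  exists m, (tcoef U p r), r. split; [exact Hr|]. split.
  { intros s [H0 Hs]. rewrite <- EU by (unfold r in Hs; lra). apply taylor; assumption. }
  set (n := (m + k + 1)%nat).
  destruct (laurent_poly a m k n Hk eq_refl) as [b [Eb Hb]].
  destruct (taylor_remainder U p r Hr HUsq) as [M [HM HT]].
  rewrite <- Eb. symmetry. apply Ceq_minus.
  (* Restricting to x < r/2 makes the denominator r - x of the Taylor remainder at least r/2. *)
  apply (poly_zero n (fun j => (tcoef U p r j - b j)%C) (M / (r / 2) / r ^ n + K) (Rmin x0 (r / 2))); [| |unfold n; lia].
  { apply Rmin_glb_lt; lra. }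
  intros x [X0 X1].
  assert (X2 : x < x0) by (eapply Rlt_le_trans; [exact X1 | apply Rmin_l]).
  assert (X3 : x < r / 2) by (eapply Rlt_le_trans; [exact X1 | apply Rmin_r]).
  set (w := (p + RtoC x)%C).
  assert (Ew : (w - p)%C = RtoC x) by (unfold w; ring).
  assert (Mw : Cmod (w - p)%C = x) by (rewrite Ew, Cmod_R, Rabs_pos_eq; lra).
  assert (Pn : 0 < x ^ n) by (apply pow_lt, X0). assert (Prn : 0 < r ^ n) by (apply pow_lt, Hr).
  specialize (HT w ltac:(lra) n). rewrite Mw, Ew in HT.
  rewrite (csum_ext _ (fun j => tcoef U p r j * RtoC (x ^ j))%C) in HT by (intros; rewrite cpown_RtoC; reflexivity).
  assert (E2 : csum (fun j => b j * RtoC (x ^ j))%C 0 n = (RtoC (x ^ n) * csum (fun i => a i * RtoC (/ x ^ S i)) 0 m)%C).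
  { rewrite <- Hb, <- csum_scal. apply csum_ext. intros i Hi.
    replace (x ^ (m + k - i)) with (x ^ n * / x ^ S i); [rewrite RtoC_mult; ring|].
    replace n with ((m + k - i) + S i)%nat by (unfold n; lia). rewrite pow_add. field. apply pow_nonzero. lra. }
  assert (E3 : U w = (RtoC (x ^ n) * (G w / w))%C).
  { rewrite EU by (rewrite Mw; unfold r in X3; lra). rewrite Ew, !cpown_RtoC.
    replace n with (S m + k)%nat by (unfold n; lia). rewrite pow_add, RtoC_mult. unfold Cdiv. ring. }
  rewrite (csum_ext _ (fun j => tcoef U p r j * RtoC (x ^ j) + (-1) * (b j * RtoC (x ^ j)))%C) by (intros; ring).
  rewrite csum_plus, csum_scal, E2.
  replace (csum (fun j => tcoef U p r j * RtoC (x ^ j)) 0 n + -1 * (RtoC (x ^ n) * csum (fun i => a i * RtoC (/ x ^ S i)) 0 m))%C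
    with ((csum (fun j => tcoef U p r j * RtoC (x ^ j)) 0 n - U w) +
          RtoC (x ^ n) * (G w / w - csum (fun i => a i * RtoC (/ x ^ S i)) 0 m))%C by (rewrite E3; ring).
  eapply Rle_trans; [apply Cmod_triangle|]. rewrite Rmult_plus_distr_r. apply Rplus_le_compat.
  - eapply Rle_trans; [exact HT|].
    replace ((x / r) ^ n) with (x ^ n / r ^ n) by (unfold Rdiv; rewrite Rpow_mult_distr, pow_inv; reflexivity).
    replace (M / (r / 2) / r ^ n * x ^ n) with (M / (r / 2) * (x ^ n / r ^ n)) by (field; lra).
    apply Rmult_le_compat_r; [apply Rdiv_le_0_compat; lra|].
    unfold Rdiv. apply Rmult_le_compat_l; [lra|]. apply Rinv_le_contravar; lra.
  - rewrite Cmod_mult, Cmod_R, Rabs_pos_eq by lra. specialize (HK x ltac:(lra)). fold w in HK. nra.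
Qed.

Lemma loci_ext e u : (forall t, e t = u t) -> loci e -> loci u.
Proof.
  intros E H w Hw T HT. apply (cint_ext (fun t => e t * w t)%C); [intros; rewrite E; reflexivity|]. apply H; assumption.
Qed.

(** The bound depends only on [B], so the estimate of the main terms near a pole becomes uniform in
    x. *)
Lemma csum_norm_bound (B : nat -> R) m : exists S, forall u : nat -> C,
  (forall k, (k < m)%nat -> Cmod (u k) <= B k) -> Cmod (csum u 0 m) <= S.
Proof.
  induction m as [|m [S IH]].
  - exists 0. intros u _. simpl. rewrite Cmod_0. lra.
  - exists (S + B m). intros u H. simpl. eapply Rle_trans; [apply Cmod_triangle|].
    apply Rplus_le_compat; [apply IH; intros; apply H; lia | apply H; lia].
Qed.

Lemma finite_choice_R (P : nat -> R -> Prop) m : (forall k, (k < m)%nat -> exists K, P k K) ->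
  exists B : nat -> R, forall k, (k < m)%nat -> P k (B k).
Proof.
  induction m as [|m IH]; intros H; [exists (fun _ => 0); intros; lia|].
  destruct IH as [B HB]; [intros; apply H; lia|]. destruct (H m) as [K HK]; [lia|].
  exists (fun k => if Nat.eq_dec k m then K else B k). intros k Hk.
  destruct (Nat.eq_dec k m) as [->|N]; [exact HK | apply HB; lia].
Qed.

(** [ys] is the first member of the progression strictly above 0. The height 0 itself may be a
    member, so it is left out. *)
Lemma pole_free_heights (y1 L : R) : 0 < L -> exists ys, 0 < ys /\
  forall y (l : Z), 0 < y < ys -> y <> y1 + 2 * PI * IZR l / L.
Proof.
  intros HL. pose proof PI_RGT_0 as P. set (w := - y1 * L / (2 * PI)).
  destruct (archimed w) as [A1 A2].
  exists ((IZR (up w) - w) * (2 * PI / L)). split.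
  { apply Rmult_lt_0_compat; [lra | apply Rdiv_lt_0_compat; lra]. }
  intros y l [Hy0 Hy1] E.
  assert (El : IZR l = w + y * L / (2 * PI)) by (rewrite E; unfold w; field; lra).
  assert (B1 : w < IZR l) by (rewrite El; assert (0 < y * L / (2 * PI)) by (apply Rdiv_lt_0_compat; nra); lra).
  assert (B2 : IZR l < IZR (up w)).
  { rewrite El. assert (y * L / (2 * PI) < IZR (up w) - w); [|lra].
    apply Rlt_div_l; [lra|]. apply Rmult_lt_reg_r with (/ L); [apply Rinv_0_lt_compat, HL|].
    replace (y * L * / L) with y by (field; lra).
    replace ((IZR (up w) - w) * (2 * PI) * / L) with ((IZR (up w) - w) * (2 * PI / L)) by (field; lra). exact Hy1. }
  assert (B3 : IZR (up w - 1) < IZR l) by (rewrite minus_IZR; lra).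
  apply lt_IZR in B2. apply lt_IZR in B3. lia.
Qed.

Theorem theoremA6
  (f : nat -> C) (kappa0 : R) (kappa : C) (delta q : R) (m : nat)
  (alpha sigma_a eta : R) (Phi : nat -> R -> C) (G : C -> C)
  (Hk0 : kappa0 <> 0) (Hk0m1 : -1 < kappa0) (Hkk0 : kappa0 < Re kappa)
  (Hdelta : 0 < delta) (Hq : 1 < q) (Hdq : delta <= PI / ln q)
  (Hdk : delta < Re kappa - kappa0) (Hm : (1 <= m)%nat)
  (Halpha : Re kappa - kappa0 < alpha) (Halpha1 : alpha <= 1)
  (HPhi : forall k, (k < m)%nat -> periodic1 (Phi k) /\ holder alpha (Phi k))
  (* F(N) = sum_{1<=n<N} f(n) = sum_{k<m} N^kappa (log_q N)^k Phi_k({log_q N}) + O(N^kappa0) *)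
  (Hasym : exists C0 : R, exists N0 : nat, forall N : nat, (N0 <= N)%nat ->
     Cmod (Cminus (csum f 1 (N - 1))
                  (csum (fun k => Cmult (cpowR (INR N) kappa)
                                   (Cmult (RtoC (logq q (INR N) ^ k))
                                          (Phi k (frac_part (logq q (INR N))))))
                        0 m))
     <= C0 * Rpower (INR N) kappa0)
  (* (i) absolute convergence for Re s > sigma_a *)
  (Hsa : Re kappa <= sigma_a)
  (Habs : forall s : C, sigma_a < Re s ->
     ex_series (fun n => Cmod (Cmult (f (S n)) (cpowR (INR (S n)) (Copp s)))))
  (* (ii) G is the meromorphic continuation of the Dirichlet series to
     Re s > kappa0 - delta, poles only at kappa + chi_l, of order <= m *)
  (HGF : forall s : C, sigma_a < Re s ->
     is_series (fun n => Cmult (f (S n)) (cpowR (INR (S n)) (Copp s))) (G s))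
  (HGhol : holomorphic_on G
     (fun s => kappa0 - delta < Re s /\ forall l : Z, s <> Cplus kappa (chi q l)))
  (HGpole : forall l : Z, exists rho : R, exists h : C -> C, 0 < rho /\
     holomorphic_on h (fun s => Cmod (Cminus s (Cplus kappa (chi q l))) < rho) /\
     forall s, 0 < Cmod (Cminus s (Cplus kappa (chi q l))) < rho ->
       h s = Cmult (cpown (Cminus s (Cplus kappa (chi q l))) m) (G s))
  (* (iii) polynomial growth in vertical strips away from the poles *)
  (Heta : 0 < eta)
  (Hgrowth : exists C1 T : R, forall s : C,
     kappa0 <= Re s <= sigma_a -> T <= Rabs (Im s) ->
     (forall l : Z, delta <= Cmod (Cminus s (Cplus kappa (chi q l)))) ->
     Cmod (G s) <= C1 * Rpower (Rabs (Im s)) eta) :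
  (forall k : nat, (k < m)%nat ->
     exists phi : Z -> C,
       (forall l : Z, exists r : C,
          is_residue (fun s => Cdiv (Cmult (G s) (cpown (Cminus s (Cplus kappa (chi q l))) k)) s)
                     (Cplus kappa (chi q l)) r /\
          phi l = Cmult (RtoC (ln q ^ k / INR (fact k))) r) /\
       forall u : R, forall eps : R, 0 < eps -> exists L0 : nat, forall L : nat, (L0 <= L)%nat ->
         Cmod (Cminus (Phi k u)
                      (symsum (fun l => Cmult (phi l) (cexp (0, 2 * IZR l * PI * u))) L)) < eps)
  /\
  (-1 < kappa0 < 0 -> (forall l : Z, kappa <> chi q l) -> G (RtoC 0) = RtoC 0).
Proof.
  clear Hgrowth Habs Heta.
  set (L := ln q) in *.
  assert (HL : 0 < L) by (unfold L; rewrite <- ln_1; apply ln_increasing; lra).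
  change (Re kappa) with (fst kappa) in *.
  assert (Ha : 0 < alpha) by lra.
  set (err := fun t => (Shat f t - mainsum kappa L Phi m t)%C).
  assert (Herr : exists C1, expb err C1 kappa0).
  { apply (err_bound f kappa kappa0 L Phi m alpha); try assumption.
    destruct Hasym as [C0 [N0 H]]. exists C0, N0. intros N HN. specialize (H N HN).
    unfold mainsum. rewrite (csum_ext (fun k => mainterm kappa L Phi k (ln (INR N)))
      (fun k => (cpowR (INR N) kappa * (RtoC (logq q (INR N) ^ k) * Phi k (frac_part (logq q (INR N)))))%C)).
    - exact H.
    - intros k Hk. rewrite periodic1_frac by (apply HPhi; lia). reflexivity. }
  destruct Herr as [C1 Herr].
  assert (Lmain : loci (mainsum kappa L Phi m)) by (apply (mainsum_loci alpha); [exact Ha | intros k Hk; apply HPhi, Hk]).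
  assert (Lerr : loci err).
  { apply (loci_ext (fun t => Shat f t + (-1) * mainsum kappa L Phi m t)%C); [intros t; unfold err; ring|].
    apply loci_plus; [apply Shat_loci | apply loci_scal, Lmain]. }
  assert (Bshat : forall a, fst kappa < a -> exists C0, expb (Shat f) C0 a).
  { intros a Hlt. destruct (main_lh_small kappa L Phi m alpha (a - fst kappa)) as [C2 [B2 _]]; try assumption; [lra|].
    exists (C1 + C2). intros t Ht. replace (Shat f t) with (err t + mainsum kappa L Phi m t)%C by (unfold err; ring).
    replace (fst kappa + (a - fst kappa)) with a in B2 by ring.
    apply (expb_plus err _ C1 C2 a); [apply (expb_weaken err C1 kappa0 a); [lra | exact Herr] | exact B2 | exact Ht]. }
  assert (LapS : forall s : C, fst kappa < fst s ->
     Lap (Shat f) s = (csum (fun k => Lap (mainterm kappa L Phi k) s) 0 m + Lap err s)%C).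
  { intros s Hs. apply Lap_eq.
    apply is_lap_ext with (e := fun t => (mainsum kappa L Phi m t + err t)%C); [intros t _; unfold err; ring|].
    apply is_lap_plus; [exact Lmain | exact Lerr | |].
    - apply (mainsum_is_lap alpha); assumption.
    - apply (Lap_spec err C1 kappa0); [exact Lerr | exact Herr | lra]. }
  assert (GS : forall s : C, sigma_a < fst s -> G s = (s * Lap (Shat f) s)%C).
  { intros s Hs. destruct (Bshat ((fst kappa + fst s) / 2)) as [C0 HC0]; [lra|].
    apply (dirichlet_laplace f s (G s) C0 ((fst kappa + fst s) / 2)); [exact HC0 | lra | apply HGF, Hs]. }
  assert (Gd : forall s : C, kappa0 - delta < fst s -> (forall l : Z, s <> Cplus kappa (chi q l)) -> cdiff G s).
  { intros s Hs N. apply cdiff_of_def, HGhol. split; assumption. }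
  assert (Pre : forall l : Z, fst (Cplus kappa (chi q l)) = fst kappa) by (intros l; simpl; ring).
  (* The series represents [G] only beyond [sigma_a], whereas the poles must be approached from just
     right of Re kappa. Both sides are holomorphic for Re s > Re kappa, so the identity descends to
     there. *)
  assert (GE : forall s : C, fst kappa < fst s ->
     G s = (s * (csum (fun k => Lap (mainterm kappa L Phi k) s) 0 m + Lap err s))%C).
  { intros [x y] Hs. rewrite <- LapS by exact Hs. apply Ceq_minus.
    apply (unique_continuation (fun s => G s - s * Lap (Shat f) s)%C (fst kappa) sigma_a y 1 Rlt_0_1); [| |exact Hs].
    - intros z Hz _. apply cdiff_minus.
      + apply Gd; [lra|]. intros l E. rewrite E, Pre in Hz. lra.
      + apply cdiff_mult; [apply cdiff_id|].
        destruct (Bshat ((fst kappa + fst z) / 2)) as [C0 HC0]; [lra|].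
        apply (Lap_cdiff (Shat f) C0 ((fst kappa + fst z) / 2)); [apply Shat_loci | exact HC0 | lra].
    - intros z Hz _. rewrite (GS z Hz). ring. }
  split.
  - intros k Hk. exists (fun l => mean L (Phi k) l). split.
    (* The coefficient of (s-p)^(-i-1) in the principal part of G(s)/s, as found in [pole_term];
       solving a k for the Fourier coefficient gives the asserted formula. *)
    + intros l. set (a := fun i => (RtoC (INR (fact i) / L ^ i) * mean L (Phi i) l)%C).
      exists (a k). split.
      2:{ unfold a. rewrite Cmult_assoc, <- RtoC_mult. fold L.
          replace (L ^ k / INR (fact k) * (INR (fact k) / L ^ k)) with 1; [ring|].
          field. split; [apply pow_nonzero; lra | apply INR_fact_neq_0]. }
      set (p := Cplus kappa (chi q l)).
      destruct (finite_choice_R (fun i K => forall x, 0 < x <= 1 ->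
         Cmod (Lap (mainterm kappa L Phi i) (p + RtoC x) - RtoC (INR (fact i) / (L ^ i * x ^ S i)) * mean L (Phi i) l)%C <= K) m)
         as [B HB].
      { intros i Hi. destruct (HPhi i Hi) as [Hp Hh].
        apply (pole_term kappa L Phi i l HL Hp (holder_cc alpha _ Ha Hh)).
        intros e He. apply (mainterm_expb alpha); assumption. }
      destruct (csum_norm_bound B m) as [S0 HS].
      (* If [p] is a negative real number, p + x meets 0, where division by s fails; x < |p|
         prevents this. For p = 0 every x > 0 is admissible. *)
      set (x0 := if Ceq_dec p 0 then 1 else Rmin 1 (Cmod p)).
      assert (X0 : 0 < x0).
      { unfold x0. destruct (Ceq_dec p 0) as [E|N]; [lra | apply Rmin_glb_lt; [lra | apply Cmod_gt_0, N]]. }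
      assert (X1 : x0 <= 1) by (unfold x0; destruct (Ceq_dec p 0); [lra | apply Rmin_l]).
      destruct (HGpole l) as [rho [h [Hrho [Hh Eh]]]]. fold p in Hh, Eh.
      apply (residue_of_pole G h p a m k rho (S0 + C1 / (fst kappa - kappa0)) x0 Hk Hrho X0).
      * intros s Hs. apply cdiff_of_def, Hh, Hs.
      * exact Eh.
      * intros x Hx. assert (Px : fst (p + RtoC x)%C = fst kappa + x) by (unfold p; simpl; ring).
        set (w := (p + RtoC x)%C) in *.
        assert (C10 := expb_nonneg _ _ _ Herr).
        assert (W0 : w <> RtoC 0).
        { intros E. assert (Ep : p = RtoC (- x)) by (rewrite RtoC_opp; transitivity (w - RtoC x)%C; [unfold w; ring | rewrite E; ring]).
          assert (Mp : Cmod p = x) by (rewrite Ep, Cmod_R, Rabs_Ropp, Rabs_pos_eq; lra).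
          unfold x0 in Hx. destruct (Ceq_dec p 0) as [E0|N].
          - rewrite E0, Cmod_0 in Mp. lra.
          - pose proof (Rmin_r 1 (Cmod p)). lra. }
        rewrite (GE w) by lra.
        replace (w * (csum (fun k0 => Lap (mainterm kappa L Phi k0) w) 0 m + Lap err w) / w - csum (fun i => a i * RtoC (/ x ^ S i)) 0 m)%C
          with (csum (fun i => Lap (mainterm kappa L Phi i) w + (-1) * (a i * RtoC (/ x ^ S i))) 0 m + Lap err w)%C.
        2:{ rewrite csum_plus, csum_scal. field. exact W0. }
        eapply Rle_trans; [apply Cmod_triangle|]. apply Rplus_le_compat.
        -- apply HS. intros i Hi. specialize (HB i Hi x ltac:(lra)). fold w in HB.
           eapply Rle_trans; [|exact HB]. right. f_equal. unfold a.
           replace (INR (fact i) / (L ^ i * x ^ S i)) with (INR (fact i) / L ^ i * / x ^ S i).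
           ++ rewrite RtoC_mult. ring.
           ++ field. split; apply pow_nonzero; lra.
        -- eapply Rle_trans; [apply (is_lap_norm err C1 kappa0 w); [exact Lerr | exact Herr | lra |]|].
           ++ apply (Lap_spec err C1 kappa0); [exact Lerr | exact Herr | lra].
           ++ unfold Rdiv. apply Rmult_le_compat_l; [exact C10|]. apply Rinv_le_contravar; lra.
    + intros u eps He. destruct (HPhi k Hk) as [Hp Hh].
      apply (fourier_converges L (Phi k) alpha u HL Ha Hp Hh eps He).
  - intros Hneg Hnp.
    destruct (pole_free_heights (snd kappa) L HL) as [ys [Hys Hfree]].
    destruct (mainsum_entire alpha kappa L Phi m Ha Halpha1 HL HPhi) as [V [HV EV]].
    (* The defect of the continued identity between theta^m G and s times the continued transform.
       At s = 0 the second product vanishes, because kappa0 < 0 makes the transform of [err]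
       holomorphic there, and theta(-kappa)^m G(0) remains. *)
    set (D := fun s => (cpown (theta L (s - kappa)) m * G s - s * (V s + cpown (theta L (s - kappa)) m * Lap err s))%C).
    assert (Cth : forall s, cdiff (fun s => cpown (theta L (s - kappa)) m) s).
    { intros s. apply (cdiff_pown (fun s => theta L (s - kappa)%C)), cdiff_comp_shift, theta_cdiff. }
    assert (Dd : forall s : C, kappa0 < fst s -> (forall l : Z, s <> Cplus kappa (chi q l)) -> cdiff D s).
    { intros s Hs N. apply cdiff_minus.
      - apply cdiff_mult; [apply Cth | apply Gd; [lra | exact N]].
      - apply cdiff_mult; [apply cdiff_id|]. apply cdiff_plus; [apply HV|].
        apply cdiff_mult; [apply Cth|]. apply (Lap_cdiff err C1 kappa0); assumption. }
    assert (D0 : forall s : C, fst kappa < fst s -> D s = RtoC 0).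
    { intros s Hs. unfold D. rewrite <- EV, (GE s) by exact Hs. ring. }
    (* At these heights no pole lies on the line, and half-width min(y, ys - y) keeps the whole
       strip between heights 0 and [ys]. *)
    assert (Dy : forall y, 0 < y < ys -> D (0, y) = RtoC 0).
    { intros y Hy. set (r := Rmin y (ys - y)).
      assert (R0 : 0 < r) by (apply Rmin_glb_lt; lra).
      apply (unique_continuation D kappa0 (fst kappa) y r R0); [| |lra].
      - intros z Hz1 Hz2. apply Dd; [exact Hz1|]. intros l E.
        apply (Hfree (snd z) l).
        + pose proof (Rmin_l y (ys - y)). pose proof (Rmin_r y (ys - y)). apply Rabs_def2 in Hz2. unfold r in Hz2. lra.
        + rewrite E. reflexivity.
      - intros z Hz _. apply D0, Hz. }
    assert (N0 : forall l : Z, RtoC 0 <> Cplus kappa (chi q l)).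
    { intros l E. apply (Hnp (- l)%Z). apply Ceq_minus.
      transitivity (kappa + chi q l)%C; [|symmetry; exact E].
      unfold chi. rewrite opp_IZR. apply injective_projections; simpl; fold L; field; lra. }
    (* The segment above 0 on which [D] vanishes has 0 as a limit point, and [D] is continuous at 0
       because 0 is not one of the possible poles. *)
    assert (DC : D (RtoC 0) = RtoC 0).
    { apply Cmod_eq_0, Rle_antisym; [|apply Cmod_ge_0]. apply Rnot_lt_le. intros P.
      destruct (proj1 (cc_C_eps D 0) (cdiff_cc D 0 (Dd 0 ltac:(simpl; lra) N0)) _ P) as [rho [Hrho HD]].
      set (y := Rmin (ys / 2) (rho / 2)).
      assert (Y0 : 0 < y) by (apply Rmin_glb_lt; lra).
      assert (Y1 : y <= ys / 2) by apply Rmin_l. assert (Y2 : y <= rho / 2) by apply Rmin_r.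
      specialize (HD (0, y)). rewrite Dy in HD by lra.
      replace (0 - D 0)%C with (- D 0)%C in HD by ring. rewrite Cmod_opp in HD.
      apply (Rlt_irrefl (Cmod (D 0))), HD.
      eapply Rle_lt_trans; [apply Cmod_le_abs|]. simpl.
      replace (0 + - 0) with 0 by ring. replace (y + - 0) with y by ring. rewrite Rabs_R0, Rabs_pos_eq; lra. }
    unfold D in DC.
    (* A zero here would place [kappa] at one of the points chi_l, which is excluded. *)
    assert (T0 : theta L (0 - kappa) <> RtoC 0).
    { intros E. unfold theta in E. symmetry in E.
      assert (E1 : cexp (- RtoC L * (0 - kappa)) = RtoC 1).
      { replace (cexp (- RtoC L * (0 - kappa))) with (1 - (1 - cexp (- RtoC L * (0 - kappa))))%C by ring. rewrite <- E. ring. }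
      destruct (cexp_1_inv _ E1) as [l El]. apply (Hnp l).
      replace kappa with (RtoC (/ L) * (- RtoC L * (0 - kappa)))%C.
      - rewrite El. unfold chi. fold L. apply injective_projections; simpl; field; lra.
      - rewrite RtoC_inv by lra. field. intros E2. apply RtoC_inj in E2. lra. }
    replace (cpown (theta L (0 - kappa)) m * G 0 - 0 * (V 0 + cpown (theta L (0 - kappa)) m * Lap err 0))%C
      with (cpown (theta L (0 - kappa)) m * G 0)%C in DC by ring.
    apply Cmod_eq_0. apply (f_equal Cmod) in DC. rewrite Cmod_mult, Cmod_0 in DC.
    apply Rmult_integral in DC. destruct DC as [DC|DC]; [|exact DC].
    exfalso. apply (cpown_neq _ m T0), Cmod_eq_0, DC.
Qed.
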